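(* Let $u_0\in\mathcal C^{-\alpha_0}$ with $\alpha_0>0$, and assume $\|u_0\|_{\mathcal C^{-\alpha_0}}\le R$ for some $R>0$. Let $\beta,\gamma$ satisfy $\beta>0$ and $\frac{\alpha_0+\beta}2<\gamma<\frac1{2m+1}$, and let $T>0$. Then (for the fixed, sufficiently small $\alpha,\alpha'$ and the fixed $\underline Z$) there exists $T^*\le T$ depending on $R$ and $\|\underline Z\|_{\alpha,\alpha',T}$ such that the equation $$\partial_tv=[(\mathrm i+\mu)\Delta-1]v+\Psi(v,\underline Z),\qquad v(0)=u_0,$$ has a unique mild solution on $[0,T^*]$.
   Context: $\mathbb T^2=\mathbb R^2/\mathbb Z^2$; $\mu>0$, $\nu,\tau\in\mathbb C$ with $\mathrm{Re}\,\nu>0$, $m\ge1$ integer. $\mathcal C^\alpha=\mathcal B^\alpha_{\infty,\infty}$ is the complex-valued Besov–Hölder space on $\mathbb T^2$ (via Littlewood–Paley blocks $\delta_j$, $\|f\|_{\mathcal C^\alpha}=\sup_{j\ge-1}2^{\alpha j}\|\delta_jf\|_{L^\infty}$). $A=(\mathrm i+\mu)\Delta-1$, $P_t=e^{tA}$. Let $L=\{(i,j)\in\mathbb N^2:0\le i\le m+1,\ 0\le j\le m,\ i\ge j,\ i+j>1\}$. For $\alpha,\alpha'\in(0,1)$, $T>0$ and $\underline Z=(Z_t,Z^{(i,j)}_t)_{(i,j)\in L}$ with $Z\in C([0,T];\mathcal C^{-\alpha})$, $Z^{(i,j)}\in C((0,T];\mathcal C^{-\alpha})$, set $\|\underline Z\|_{\alpha,\alpha',T}=\sup_{0\le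 t\le T}\big(\|Z_t\|_{\mathcal C^{-\alpha}}\vee\sup_{(i,j)\in L}t^{(i+j-1)\alpha'}\|Z^{(i,j)}_t\|_{\mathcal C^{-\alpha}}\big)$. Standing assumption: $\alpha,\alpha'\in(0,1)$ are fixed sufficiently small (depending on $\beta,\gamma,m$), and $\underline Z$ is a fixed (deterministic) such family with $\|\underline Z\|_{\alpha,\alpha',T}<\infty$. Extend notation by $Z^{:1,0:}_t=Z_t$, $Z^{:0,1:}_t=\overline{Z_t}$, $Z^{:0,0:}_t=1$, $Z^{:i,j:}_t=Z^{(i,j)}_t$ for $(i,j)\in L$ and $Z^{:j,i:}_t=\overline{Z^{(i,j)}_t}$ for $(i,j)\in L$. For $v$ with $v_t\in\mathcal C^{\beta}$ ($\beta>\alpha$) define $$\Psi(v_t,\underline Z_t)=-\nu\sum_{i=0}^{m+1}\sum_{j=0}^m\binom{m+1}i\binom mj v_t^i\overline{v_t}^{\,j}Z^{:m+1-i,m-j:}_t+(\tau+1)(v_t+Z_t).$$ Given $\alpha_0>0$, $\beta>0$, $\frac{\alpha_0+\beta}2<\gamma<\frac1{2m+1}$ and $u_0\in\mathcal C^{-\alpha_0}$, a mild solution up to time $T$ is $v\in C((0,T];\mathcal C^\beta)$ with $\sup_{0<t\le T}t^\gamma\|v_t\|_{\mathcal C^\beta}<\infty$ and $v_t=P_tu_0+\int_0^tP_{t-s}\Psi(v_s,\underline Z_s)\,ds$ for all $t\le T$. *)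

(* Defs.v *)
From Stdlib Require Import Reals ZArith.
From Coquelicot Require Import Coquelicot.
Open Scope R_scope.

(** * Distributions on T^2 = R^2/Z^2, represented by their Fourier coefficients:
    f(x) = sum_k f(k) e^{2 pi i k.x},  k in Z^2. *)
Definition Dist := (Z * Z)%type -> C.

Definition dzero : Dist := fun _ => RtoC 0.
Definition done : Dist := fun k => if (Z.eqb (fst k) 0 && Z.eqb (snd k) 0)%bool then RtoC 1 else RtoC 0.
Definition dadd (f g : Dist) : Dist := fun k => Cplus (f k) (g k).
Definition dsub (f g : Dist) : Dist := fun k => Cminus (f k) (g k).
Definition dscal (c : C) (f : Dist) : Dist := fun k => Cmult c (f k).
Definition dconj (f : Dist) : Dist := fun k => Cconj (f (Z.opp (fst k), Z.opp (snd k))).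

Definition cexp (z : C) : C := (exp (fst z) * cos (snd z), exp (fst z) * sin (snd z)).

Definition knorm (k : Z * Z) : R := sqrt (IZR (fst k) ^ 2 + IZR (snd k) ^ 2).

(** * A fixed (smooth, radial) dyadic partition of unity.
    g(x) = exp(-1/x) for x>0, 0 otherwise (smooth);
    h(r) = g(4/3 - r) / (g(4/3 - r) + g(r - 1)) : smooth, =1 on r<=1, =0 on r>=4/3;
    chi(xi) = h(|xi|),  rho(xi) = chi(xi/2) - chi(xi) (supported in 1<=|xi|<=8/3);
    rho_{-1} = chi,  rho_j = rho(2^{-j} .) for j >= 0. *)
Definition gsm (x : R) : R := if Rlt_dec 0 x then exp (- / x) else 0.
Definition hcut (r : R) : R := gsm (4/3 - r) / (gsm (4/3 - r) + gsm (r - 1)).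
Definition chi_r (r : R) : R := hcut r.
Definition rho_r (r : R) : R := chi_r (r / 2) - chi_r r.

(** Block index n : nat stands for j = n - 1 (so n = 0 is j = -1). *)
Definition rhoj (n : nat) (r : R) : R :=
  match n with
  | O => chi_r r
  | S j => rho_r (r / 2 ^ j)
  end.

(** S_N = sum_{j=-1}^{N-1} delta_j has multiplier chi(2^{-N} .) *)
Definition chiN (N : nat) (r : R) : R := chi_r (r / 2 ^ N).

Definition box_sum (M : nat) (F : Z * Z -> C) : C :=
  sum_n (fun a => sum_n (fun b =>
      F (Z.of_nat a - Z.of_nat M, Z.of_nat b - Z.of_nat M)%Z) (2 * M)) (2 * M).

Definition fourier_char (k : Z * Z) (x1 x2 : R) : C :=
  cexp (0, 2 * PI * (IZR (fst k) * x1 + IZR (snd k) * x2)).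

(** Littlewood-Paley block delta_j f, evaluated at the point (x1,x2) of the torus
    (a trigonometric polynomial; rho_j(k) = 0 outside the box of radius 2^(n+1), n = j+1). *)
Definition LP_block (n : nat) (f : Dist) (x1 x2 : R) : C :=
  box_sum (2 ^ (n + 1)) (fun k => Cmult (RtoC (rhoj n (knorm k))) (Cmult (f k) (fourier_char k x1 x2))).

(** ||f||_{C^a} <= K, i.e. sup_{j>=-1} 2^{a j} ||delta_j f||_{L^oo} <= K  (j = n - 1) *)
Definition besov_le (a : R) (f : Dist) (K : R) : Prop :=
  forall (n : nat) (x1 x2 : R), Rpower 2 (a * (INR n - 1)) * Cmod (LP_block n f x1 x2) <= K.

Definition in_besov (a : R) (f : Dist) : Prop := exists K, besov_le a f K.

Definition besov_continuous_on (a : R) (D : R -> Prop) (f : R -> Dist) : Prop :=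
  forall t, D t -> forall eps, 0 < eps -> exists delta, 0 < delta /\
    forall s, D s -> Rabs (s - t) < delta -> besov_le a (dsub (f s) (f t)) eps.

Definition Clim_seq (u : nat -> C) : C :=
  (real (Lim_seq (fun N => fst (u N))), real (Lim_seq (fun N => snd (u N)))).

(** Product of distributions: (f g)^(k) = lim_N  (S_N f . S_N g)^(k)
    (the limit exists and coincides with the paraproduct definition in the
    cases used here, e.g. f in C^b, g in C^{-a} with b > a). *)
Definition dmul (f g : Dist) : Dist := fun k =>
  Clim_seq (fun N => box_sum (2 ^ (N + 1)) (fun l =>
     Cmult (Cmult (RtoC (chiN N (knorm l))) (f l))
           (Cmult (RtoC (chiN N (knorm (fst k - fst l, snd k - snd l)%Z)))
                  (g (fst k - fst l, snd k - snd l)%Z)))).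

Fixpoint dpow (f : Dist) (n : nat) : Dist :=
  match n with O => done | S n' => dmul f (dpow f n') end.

Definition binom (n k : nat) : R := INR (fact n) / (INR (fact k) * INR (fact (n - k))).

Definition inL (m i j : nat) : Prop := (i <= m + 1)%nat /\ (j <= m)%nat /\ (j <= i)%nat /\ (1 < i + j)%nat.

Definition Zext (Zt : Dist) (Zij : nat -> nat -> Dist) (p q : nat) : Dist :=
  match p, q with
  | O, O => done
  | 1%nat, O => Zt
  | O, 1%nat => dconj Zt
  | _, _ => if Nat.leb q p then Zij p q else dconj (Zij q p)
  end.

Definition Psi (m : nat) (nu tau : C) (v Zt : Dist) (Zij : nat -> nat -> Dist) : Dist :=
  dadd
    (dscal (Copp nu)
      (fun k => sum_n (fun i => sum_n (fun j =>
          Cmult (RtoC (binom (m + 1) i * binom m j))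
                (dmul (dmul (dpow v i) (dpow (dconj v) j)) (Zext Zt Zij (m + 1 - i) (m - j)) k)) m) (m + 1)))
    (dscal (Cplus tau (RtoC 1)) (dadd v Zt)).

(** Fourier multiplier of A = (i + mu) Delta - 1 at frequency k:
    lambda_k = -(i + mu) 4 pi^2 |k|^2 - 1 ;  P_t f = e^{t A} f. *)
Definition lambdaA (mu : R) (k : Z * Z) : C :=
  let q := 4 * PI ^ 2 * (IZR (fst k) ^ 2 + IZR (snd k) ^ 2) in
  (- mu * q - 1, - q).

Definition semigroup (mu t : R) (f : Dist) : Dist :=
  fun k => Cmult (cexp (Cmult (RtoC t) (lambdaA mu k))) (f k).

Definition noise_ok (m : nat) (alpha alpha' T : R) (Zt : R -> Dist) (Zij : nat -> nat -> R -> Dist) : Prop :=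
  besov_continuous_on (- alpha) (fun t => 0 <= t <= T) Zt /\
  (forall i j, inL m i j -> besov_continuous_on (- alpha) (fun t => 0 < t <= T) (Zij i j)).

Definition noise_norm_le (m : nat) (alpha alpha' T : R) (Zt : R -> Dist) (Zij : nat -> nat -> R -> Dist) (K : R) : Prop :=
  (forall t, 0 <= t <= T -> besov_le (- alpha) (Zt t) K) /\
  (forall i j, inL m i j -> forall t, 0 < t <= T ->
     besov_le (- alpha) (Zij i j t) (K / Rpower t ((INR (i + j) - 1) * alpha'))).

(** Mild solution up to time T:
    v in C((0,T]; C^beta), sup_{0<t<=T} t^gamma ||v_t||_{C^beta} < oo, and
    v_t = P_t u0 + int_0^t P_{t-s} Psi(v_s, Z_s) ds  for 0 < t <= T
    (the time integral is taken Fourier-coefficientwise, as an improper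
    Riemann integral at s = 0+). *)
Definition mild_solution (m : nat) (mu : R) (nu tau : C) (beta gamma T : R)
    (u0 : Dist) (Zt : R -> Dist) (Zij : nat -> nat -> R -> Dist) (v : R -> Dist) : Prop :=
  besov_continuous_on beta (fun t => 0 < t <= T) v /\
  (exists K, forall t, 0 < t <= T -> besov_le beta (v t) (K / Rpower t gamma)) /\
  (forall t, 0 < t <= T -> forall k,
     exists I : C,
       is_RInt_gen (V := C_R_CompleteNormedModule)
         (fun s => semigroup mu (t - s) (Psi m nu tau (v s) (Zt s) (fun i j => Zij i j s)) k)
         (at_right 0) (at_point t) I /\
       v t k = Cplus (semigroup mu t u0 k) I).

(* Main.v *)
(** In [t^gamma]-weighted [C^beta], Duhamel's formula is a contraction on a short interval. The
    nonlinearity is estimated in [C^{-2 alpha}] by multilinear product bounds, and the semigroup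
    brings it back to [C^beta] at the cost of an integrable singularity.

    All sup-norm bounds rest on one multiplier estimate. A symbol [a] supported in a box of size [M],
    with [|a| <= B] and increments at most [B / M], acts on bounded trigonometric polynomials with norm
    [O(B (1 + ln M)^2)]: its values on a box are a finite combination of characters evaluated on a fine
    grid (discrete Fourier transform), whose coefficients are bounded in l^1 by weighting with
    [1 + M^2 (|e^{2 pi i y1} - 1|^2 + |e^{2 pi i y2} - 1|^2)], AM-GM and Parseval. Lipschitz symbols thus
    suffice, and the logarithm only costs an arbitrarily small amount of regularity in each product
    and smoothing estimate, which the strict inequalities on the exponents can absorb. *)
Require Import Defs.
From Stdlib Require Import Reals ZArith Lra Lia List Permutation.
From Stdlib Require Import FunctionalExtensionality.
From Coquelicot Require Import Coquelicot.
Open Scope R_scope.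

(** * Finite sums over lists *)

(** Littlewood-Paley blocks are trigonometric polynomials, so shifts along a fine grid replace
    convolution with a kernel and everything stays a finite sum. In dimension two, one difference of
    the symbol in each direction is the borderline for passing from l^2 to l^1; this is where the
    logarithm comes from. The exponents fit as follows. Each factor v costs t^(-gamma), so the worst
    monomial costs t^(-q) with q = (2m+1) gamma < 1. Duhamel returns t^(1-q-r) with r slightly above
    beta/2, and beta/2 < gamma makes this better than t^(-gamma). The integrand is singular at s = 0
    and at s = t; the second singularity is removed block by block, by keeping 4^(-n) next to t in
    the smoothing bound. Size and Lipschitz bounds are carried together, as a pair with a relative
    difference, so a single estimate of the nonlinearity serves for the invariant ball, the
    contraction, the time continuity and uniqueness. Uniqueness concerns solutions of any size on an
    interval chosen from R alone, so the smallness that defines this interval cannot give it. *)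

Fixpoint csum {A : Type} (l : list A) (F : A -> C) : C :=
  match l with nil => RtoC 0 | x :: l' => Cplus (F x) (csum l' F) end.

Fixpoint rsum {A : Type} (l : list A) (F : A -> R) : R :=
  match l with nil => 0 | x :: l' => F x + rsum l' F end.

Lemma csum_ext {A} (l : list A) F G :
  (forall x, In x l -> F x = G x) -> csum l F = csum l G.
Proof.
  induction l as [|x l IH]; intros H; simpl; auto.
  rewrite H by (left; auto). rewrite IH; auto. intros; apply H; right; auto.
Qed.

Lemma rsum_ext {A} (l : list A) F G :
  (forall x, In x l -> F x = G x) -> rsum l F = rsum l G.
Proof.
  induction l as [|x l IH]; intros H; simpl; auto.
  rewrite H by (left; auto). rewrite IH; auto. intros; apply H; right; auto.
Qed.

Lemma csum_plus {A} (l : list A) F G :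
  csum l (fun x => Cplus (F x) (G x)) = Cplus (csum l F) (csum l G).
Proof. induction l; simpl; [|rewrite IHl]; ring. Qed.

Lemma csum_minus {A} (l : list A) F G :
  csum l (fun x => Cminus (F x) (G x)) = Cminus (csum l F) (csum l G).
Proof. induction l; simpl; [|rewrite IHl]; ring. Qed.

Lemma csum_scal {A} (l : list A) c F :
  csum l (fun x => Cmult c (F x)) = Cmult c (csum l F).
Proof. induction l; simpl; [|rewrite IHl]; ring. Qed.

Lemma csum_scal_r {A} (l : list A) c F :
  csum l (fun x => Cmult (F x) c) = Cmult (csum l F) c.
Proof. induction l; simpl; [|rewrite IHl]; ring. Qed.

Lemma csum_zero {A} (l : list A) F :
  (forall x, In x l -> F x = RtoC 0) -> csum l F = RtoC 0.
Proof.
  induction l as [|x l IH]; intros H; simpl; auto.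
  rewrite H by (left; auto). rewrite IH; [ring|]. intros; apply H; right; auto.
Qed.

Lemma csum_swap {A B} (l : list A) (l' : list B) F :
  csum l (fun x => csum l' (fun y => F x y)) = csum l' (fun y => csum l (fun x => F x y)).
Proof.
  induction l as [|x l IH]; simpl.
  - symmetry; apply csum_zero; auto.
  - rewrite IH, <- csum_plus. reflexivity.
Qed.

Lemma csum_app {A} (l l' : list A) F : csum (l ++ l') F = Cplus (csum l F) (csum l' F).
Proof. induction l; simpl; [|rewrite IHl]; ring. Qed.

Lemma csum_map {A B} (f : A -> B) l F : csum (map f l) F = csum l (fun x => F (f x)).
Proof. induction l; simpl; [|rewrite IHl]; auto. Qed.

Lemma rsum_map {A B} (f : A -> B) l F : rsum (map f l) F = rsum l (fun x => F (f x)).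
Proof. induction l; simpl; [|rewrite IHl]; auto. Qed.

Lemma csum_prod {A B} (l : list A) (l' : list B) F :
  csum (list_prod l l') F = csum l (fun x => csum l' (fun y => F (x, y))).
Proof.
  induction l as [|x l IH]; simpl; auto.
  rewrite csum_app, csum_map, IH. reflexivity.
Qed.

Lemma csum_perm {A} (l l' : list A) F : Permutation l l' -> csum l F = csum l' F.
Proof. induction 1; simpl; try congruence; ring. Qed.

Lemma csum_filter {A} (p : A -> bool) l F :
  (forall x, In x l -> p x = false -> F x = RtoC 0) -> csum (filter p l) F = csum l F.
Proof.
  induction l as [|x l IH]; intros H; simpl; auto.
  rewrite <- IH by (intros; apply H; auto; right; auto).
  destruct (p x) eqn:E; simpl; auto. rewrite (H x) by (auto; left; auto). ring.
Qed.

(** Every reindexing below goes through this: enlarging a box, isolating one frequency, shifting or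
    reflecting a box permute the list or change it only where the summand vanishes. *)
Lemma csum_support {A} (eq_dec : forall x y : A, {x = y} + {x <> y}) (l l' : list A) F :
  NoDup l -> NoDup l' ->
  (forall x, In x l -> ~ In x l' -> F x = RtoC 0) ->
  (forall x, In x l' -> ~ In x l -> F x = RtoC 0) -> csum l F = csum l' F.
Proof.
  intros N N' H H'.
  rewrite <- (csum_filter (fun x => if in_dec eq_dec x l' then true else false) l).
  2:{ intros x Hx. destruct (in_dec eq_dec x l'); [discriminate|auto]. }
  rewrite <- (csum_filter (fun x => if in_dec eq_dec x l then true else false) l').
  2:{ intros x Hx. destruct (in_dec eq_dec x l); [discriminate|auto]. }
  apply csum_perm, NoDup_Permutation; try (apply NoDup_filter; auto).
  intros x; rewrite !filter_In.
  destruct (in_dec eq_dec x l'); destruct (in_dec eq_dec x l); intuition discriminate.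
Qed.

Lemma csum_single {A} (eq_dec : forall x y : A, {x = y} + {x <> y}) (l : list A) a F :
  NoDup l -> In a l -> (forall x, In x l -> x <> a -> F x = RtoC 0) -> csum l F = F a.
Proof.
  intros N Ha H.
  rewrite (csum_support eq_dec l (a :: nil)); auto.
  - simpl; ring.
  - constructor; auto. constructor.
  - intros x Hx Hn. apply H; auto. intros ->; apply Hn; left; auto.
  - intros x [<-|[]] Hn. contradiction.
Qed.

Lemma csum_conj {A} (l : list A) F : Cconj (csum l F) = csum l (fun x => Cconj (F x)).
Proof.
  induction l; simpl.
  - apply injective_projections; simpl; ring.
  - rewrite Cplus_conj, IHl. reflexivity.
Qed.

Lemma csum_RtoC {A} (l : list A) F : csum l (fun x => RtoC (F x)) = RtoC (rsum l F).
Proof. induction l; simpl; auto. rewrite IHl, RtoC_plus. reflexivity. Qed.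

Lemma Cmod_csum {A} (l : list A) F : Cmod (csum l F) <= rsum l (fun x => Cmod (F x)).
Proof.
  induction l; simpl.
  - rewrite Cmod_0; lra.
  - eapply Rle_trans; [apply Cmod_triangle|]. lra.
Qed.

Lemma rsum_le {A} (l : list A) F G :
  (forall x, In x l -> F x <= G x) -> rsum l F <= rsum l G.
Proof.
  induction l as [|x l IH]; intros H; simpl; [lra|].
  apply Rplus_le_compat; [apply H; left; auto|apply IH; intros; apply H; right; auto].
Qed.

Lemma rsum_const {A} (l : list A) c : rsum l (fun _ => c) = INR (length l) * c.
Proof. induction l; cbn [rsum length]; [simpl; ring|]. rewrite IHl, S_INR; ring. Qed.

Lemma rsum_le_const {A} (l : list A) F c :
  (forall x, In x l -> F x <= c) -> rsum l F <= INR (length l) * c.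
Proof. intros H. rewrite <- rsum_const. apply rsum_le; auto. Qed.

Lemma rsum_ge0 {A} (l : list A) F : (forall x, In x l -> 0 <= F x) -> 0 <= rsum l F.
Proof.
  intros H. apply Rle_trans with (rsum l (fun _ => 0)); [|apply rsum_le; auto].
  rewrite rsum_const; lra.
Qed.

Lemma rsum_plus {A} (l : list A) F G : rsum l (fun x => F x + G x) = rsum l F + rsum l G.
Proof. induction l; simpl; [|rewrite IHl]; ring. Qed.

Lemma rsum_scal {A} (l : list A) c F : rsum l (fun x => c * F x) = c * rsum l F.
Proof. induction l; simpl; [|rewrite IHl]; ring. Qed.

Lemma rsum_app {A} (l l' : list A) F : rsum (l ++ l') F = rsum l F + rsum l' F.
Proof. induction l; simpl; [|rewrite IHl]; ring. Qed.

Lemma rsum_prod_mult {A B} (l : list A) (l' : list B) F G :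
  rsum (list_prod l l') (fun p => F (fst p) * G (snd p)) = rsum l F * rsum l' G.
Proof.
  induction l as [|x l IH]; simpl; [ring|].
  rewrite rsum_app, rsum_map, IH. simpl. rewrite rsum_scal. ring.
Qed.

(** * Boxes of frequencies *)

Definition zrange (M : nat) : list Z :=
  map (fun a => (Z.of_nat a - Z.of_nat M)%Z) (seq 0 (2 * M + 1)).
Definition box (M : nat) : list (Z * Z) := list_prod (zrange M) (zrange M).
Definition zz_dec (x y : Z * Z) : {x = y} + {x <> y}.
Proof. decide equality; apply Z.eq_dec. Defined.

Lemma in_zrange M k : In k (zrange M) <-> (Z.abs k <= Z.of_nat M)%Z.
Proof.
  unfold zrange. rewrite in_map_iff. split.
  - intros [a [<- Ha]]. apply in_seq in Ha. lia.
  - intros H. exists (Z.to_nat (k + Z.of_nat M)). split; [lia|]. apply in_seq. lia.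
Qed.

Lemma in_box M k :
  In k (box M) <-> (Z.abs (fst k) <= Z.of_nat M /\ Z.abs (snd k) <= Z.of_nat M)%Z.
Proof. destruct k. unfold box. rewrite in_prod_iff, !in_zrange. reflexivity. Qed.

Lemma NoDup_list_prod {A B} (l : list A) (l' : list B) :
  NoDup l -> NoDup l' -> NoDup (list_prod l l').
Proof.
  intros N N'. induction N as [|x l Hx N IH]; simpl; [constructor|].
  apply NoDup_app; auto.
  - apply FinFun.Injective_map_NoDup; auto. intros a b E; congruence.
  - intros [a b] H1 H2. apply in_map_iff in H1 as [c [E _]].
    apply in_prod_iff in H2. inversion E; subst. tauto.
Qed.

Lemma NoDup_zrange M : NoDup (zrange M).
Proof.
  apply FinFun.Injective_map_NoDup; [|apply seq_NoDup]. intros a b; lia.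
Qed.

Lemma NoDup_box M : NoDup (box M).
Proof. apply NoDup_list_prod; apply NoDup_zrange. Qed.

Lemma length_zrange M : length (zrange M) = (2 * M + 1)%nat.
Proof. unfold zrange. rewrite length_map, length_seq. reflexivity. Qed.

(** [sum_n] includes its upper index, hence [n + 1] terms. *)
Lemma sum_n_csum (F : nat -> C) n : sum_n F n = csum (seq 0 (n + 1)) F.
Proof.
  induction n.
  - rewrite sum_O. simpl. ring.
  - rewrite sum_Sn, IHn. replace (S n + 1)%nat with ((n + 1) + 1)%nat by lia.
    rewrite (seq_app (n + 1) 1), csum_app. simpl.
    replace (n + 1)%nat with (S n) by lia. unfold plus; simpl. ring.
Qed.

Lemma box_sum_csum M F : box_sum M F = csum (box M) F.
Proof.
  unfold box_sum, box. rewrite csum_prod, sum_n_csum.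
  unfold zrange at 1. rewrite csum_map. apply csum_ext. intros a _.
  rewrite sum_n_csum. unfold zrange. rewrite csum_map. reflexivity.
Qed.

Lemma csum_box_ext M M' F :
  (forall k, ~ In k (box M) -> F k = RtoC 0) -> (M <= M')%nat ->
  csum (box M') F = csum (box M) F.
Proof.
  intros H L. apply (csum_support zz_dec); auto using NoDup_box.
  intros x H1 H2. exfalso; apply H2. rewrite in_box in *. lia.
Qed.

(** * Characters and trigonometric polynomials *)

Definition zadd (k l : Z * Z) : Z * Z := (fst k + fst l, snd k + snd l)%Z.
Definition zopp (k : Z * Z) : Z * Z := (- fst k, - snd k)%Z.
Definition zsub (k l : Z * Z) : Z * Z := (fst k - fst l, snd k - snd l)%Z.

Lemma fourier_char_eq k x1 x2 :
  fourier_char k x1 x2 =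
  (cos (2 * PI * (IZR (fst k) * x1 + IZR (snd k) * x2)),
   sin (2 * PI * (IZR (fst k) * x1 + IZR (snd k) * x2))).
Proof. unfold fourier_char, cexp; simpl. rewrite exp_0. f_equal; ring. Qed.

Lemma Cmod_fourier_char k x1 x2 : Cmod (fourier_char k x1 x2) = 1.
Proof.
  rewrite fourier_char_eq. unfold Cmod; simpl.
  set (t := 2 * PI * _).
  replace (cos t * (cos t * 1) + sin t * (sin t * 1)) with (Rsqr (sin t) + Rsqr (cos t))
    by (unfold Rsqr; ring).
  rewrite sin2_cos2. apply sqrt_1.
Qed.

Lemma fourier_char_zadd k l x1 x2 :
  fourier_char (zadd k l) x1 x2 = Cmult (fourier_char k x1 x2) (fourier_char l x1 x2).
Proof.
  rewrite !fourier_char_eq. unfold zadd, Cmult; simpl. rewrite !plus_IZR.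
  set (s := 2 * PI * (IZR (fst k) * x1 + _)). set (t := 2 * PI * (IZR (fst l) * x1 + _)).
  replace (2 * PI * _) with (s + t) by (unfold s, t; ring).
  rewrite cos_plus, sin_plus. f_equal; ring.
Qed.

Lemma fourier_char_add k x1 x2 y1 y2 :
  fourier_char k (x1 + y1) (x2 + y2) = Cmult (fourier_char k x1 x2) (fourier_char k y1 y2).
Proof.
  rewrite !fourier_char_eq. unfold Cmult; simpl.
  set (s := 2 * PI * (IZR (fst k) * x1 + _)). set (t := 2 * PI * (IZR (fst k) * y1 + _)).
  replace (2 * PI * _) with (s + t) by (unfold s, t; ring).
  rewrite cos_plus, sin_plus. f_equal; ring.
Qed.

Lemma fourier_char_zopp k x1 x2 : fourier_char (zopp k) x1 x2 = Cconj (fourier_char k x1 x2).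
Proof.
  rewrite !fourier_char_eq. unfold zopp, Cconj; simpl. rewrite !opp_IZR.
  set (s := 2 * PI * (IZR (fst k) * x1 + _)).
  replace (2 * PI * _) with (- s) by (unfold s; ring).
  rewrite cos_neg, sin_neg. reflexivity.
Qed.

Lemma fourier_char_split p q x1 x2 :
  fourier_char (p, q) x1 x2 = Cmult (fourier_char (p, 0%Z) x1 0) (fourier_char (q, 0%Z) x2 0).
Proof.
  rewrite !fourier_char_eq. unfold Cmult; simpl.
  set (s := 2 * PI * (IZR p * x1 + 0 * 0)). set (t := 2 * PI * (IZR q * x2 + 0 * 0)).
  replace (2 * PI * _) with (s + t) by (unfold s, t; ring).
  rewrite cos_plus, sin_plus. f_equal; ring.
Qed.

(** Once the box contains the support of [f] its size is irrelevant ([ev_ext_supp]), so polynomials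
    with different supports can be compared on a common large box. *)
Definition ev (M : nat) (f : Dist) (x1 x2 : R) : C :=
  csum (box M) (fun k => Cmult (f k) (fourier_char k x1 x2)).

Definition supp_in (M : nat) (f : Dist) : Prop := forall k, ~ In k (box M) -> f k = RtoC 0.

Lemma ev_ext_supp M M' f x1 x2 : supp_in M f -> (M <= M')%nat -> ev M' f x1 x2 = ev M f x1 x2.
Proof.
  intros H L. apply csum_box_ext; auto. intros k Hk. rewrite H by auto. ring.
Qed.

Lemma Cmod_ev_le M f x1 x2 : Cmod (ev M f x1 x2) <= rsum (box M) (fun k => Cmod (f k)).
Proof.
  unfold ev. eapply Rle_trans; [apply Cmod_csum|]. apply rsum_le. intros k _.
  rewrite Cmod_mult, Cmod_fourier_char. lra.
Qed.

(** * Discrete Fourier transform on a grid *)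

Definition grid (Q : nat) : list (nat * nat) := list_prod (seq 0 Q) (seq 0 Q).
Definition gx (Q p : nat) : R := INR p / INR Q.

Lemma csum_geom (z : C) n :
  Cmult (Cminus z (RtoC 1)) (csum (seq 0 n) (fun p => Cpow z p)) = Cminus (Cpow z n) (RtoC 1).
Proof.
  induction n; [simpl; ring|].
  rewrite seq_S, csum_app. simpl. rewrite Cmult_plus_distr_l, IHn. ring.
Qed.

Lemma fourier_char_pow k p Q :
  fourier_char (k, 0%Z) (gx Q p) 0 = Cpow (fourier_char (k, 0%Z) (gx Q 1) 0) p.
Proof.
  induction p.
  - simpl. rewrite fourier_char_eq. simpl. unfold gx. simpl (INR 0).
    replace (2 * PI * _) with 0 by (unfold Rdiv; ring). rewrite cos_0, sin_0. reflexivity.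
  - cbn [Cpow]. rewrite <- IHp, <- fourier_char_add. unfold gx. f_equal; [|ring].
    rewrite S_INR. simpl (INR 1). unfold Rdiv; ring.
Qed.

(** The real part decides: it is [1 - 2 sin^2 t] with [t = PI |k| / Q], and [0 < t < PI] makes the
    sine positive. *)
Lemma fourier_char_grid_ne1 (k : Z) (Q : nat) :
  k <> 0%Z -> (Z.abs k < Z.of_nat Q)%Z -> fourier_char (k, 0%Z) (gx Q 1) 0 <> RtoC 1.
Proof.
  intros Hk Hb E. rewrite fourier_char_eq in E. simpl in E.
  assert (Hc : cos (2 * PI * (IZR (Z.abs k) / INR Q)) = 1).
  { apply (f_equal fst) in E. cbn [fst RtoC] in E.
    destruct (Z.abs_spec k) as [[_ ->]|[_ ->]].
    - rewrite <- E. f_equal. unfold gx, Rdiv. simpl; ring.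
    - rewrite opp_IZR, <- E, <- cos_neg. f_equal. unfold gx, Rdiv. simpl; ring. }
  set (t := PI * (IZR (Z.abs k) / INR Q)) in *.
  replace (2 * PI * (IZR (Z.abs k) / INR Q)) with (2 * t) in Hc by (unfold t; ring).
  rewrite cos_2a_sin in Hc.
  assert (Hs : sin t = 0) by (apply Rsqr_0_uniq; unfold Rsqr; lra).
  assert (0 < IZR (Z.abs k) / INR Q < 1).
  { assert (0 < IZR (Z.abs k)) by (apply IZR_lt; lia).
    assert (IZR (Z.abs k) < INR Q) by (rewrite INR_IZR_INZ; apply IZR_lt; lia).
    split; [apply Rdiv_lt_0_compat; lra|apply Rlt_div_l; lra]. }
  assert (0 < t < PI) by (unfold t; pose proof PI_RGT_0; nra).
  pose proof (sin_gt_0 t). lra.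
Qed.

Lemma grid_orth1 (k : Z) (Q : nat) :
  (Z.abs k < Z.of_nat Q)%Z ->
  csum (seq 0 Q) (fun p => fourier_char (k, 0%Z) (gx Q p) 0) =
  if Z.eqb k 0 then RtoC (INR Q) else RtoC 0.
Proof.
  intros Hb. destruct (Z.eqb_spec k 0) as [->|Hk].
  - rewrite (csum_ext _ _ (fun _ => RtoC 1)).
    + rewrite csum_RtoC, rsum_const, length_seq. f_equal; ring.
    + intros p _. rewrite fourier_char_eq. simpl.
      replace (2 * PI * _) with 0 by ring. rewrite cos_0, sin_0. reflexivity.
  - rewrite (csum_ext _ _ (fun p => Cpow (fourier_char (k, 0%Z) (gx Q 1) 0) p))
      by (intros; apply fourier_char_pow).
    (* The character value is a [Q]-th root of unity other than 1, so [z^Q - 1 = 0] kills the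
       geometric sum. *)
    pose proof (csum_geom (fourier_char (k, 0%Z) (gx Q 1) 0) Q) as G.
    rewrite <- fourier_char_pow in G.
    assert (E : fourier_char (k, 0%Z) (gx Q Q) 0 = RtoC 1).
    { assert (HQ : 0 < INR Q) by (apply lt_0_INR; lia).
      rewrite fourier_char_eq. unfold gx. cbn [fst snd].
      replace (2 * PI * _) with (2 * IZR k * PI) by (field; lra).
      apply injective_projections; cbn [fst snd RtoC].
      - transitivity (cos 0); [|apply cos_0]. destruct (Z_le_gt_dec 0 k).
        + rewrite <- (cos_period 0 (Z.to_nat k)). f_equal. rewrite INR_IZR_INZ, Z2Nat.id by lia. ring.
        + rewrite <- (cos_period (2 * IZR k * PI) (Z.to_nat (- k))). f_equal.
          rewrite INR_IZR_INZ, Z2Nat.id, opp_IZR by lia. ring.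
      - transitivity (sin 0); [|apply sin_0]. destruct (Z_le_gt_dec 0 k).
        + rewrite <- (sin_period 0 (Z.to_nat k)). f_equal. rewrite INR_IZR_INZ, Z2Nat.id by lia. ring.
        + rewrite <- (sin_period (2 * IZR k * PI) (Z.to_nat (- k))). f_equal.
          rewrite INR_IZR_INZ, Z2Nat.id, opp_IZR by lia. ring. }
    rewrite E in G.
    pose proof (fourier_char_grid_ne1 k Q Hk Hb) as N.
    assert (N' : Cminus (fourier_char (k, 0%Z) (gx Q 1) 0) (RtoC 1) <> RtoC 0).
    { intros H. apply N. apply (f_equal (fun z => Cplus z (RtoC 1))) in H.
      ring_simplify in H. exact H. }
    apply (f_equal (Cmult (Cinv (Cminus (fourier_char (k, 0%Z) (gx Q 1) 0) (RtoC 1))))) in G.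
    rewrite Cmult_assoc, Cinv_l, Cmult_1_l in G by auto. rewrite G. ring.
Qed.

Lemma grid_orth (k : Z * Z) (Q : nat) :
  (Z.abs (fst k) < Z.of_nat Q)%Z -> (Z.abs (snd k) < Z.of_nat Q)%Z ->
  csum (grid Q) (fun p => fourier_char k (gx Q (fst p)) (gx Q (snd p))) =
  if zz_dec k (0, 0)%Z then RtoC (INR Q ^ 2) else RtoC 0.
Proof.
  intros H1 H2. destruct k as [k1 k2]; simpl fst in *; simpl snd in *.
  unfold grid. rewrite csum_prod. cbn [fst snd].
  rewrite (csum_ext _ _ (fun p => Cmult (fourier_char (k1, 0%Z) (gx Q p) 0)
     (csum (seq 0 Q) (fun q => fourier_char (k2, 0%Z) (gx Q q) 0)))).
  2:{ intros p _. rewrite <- csum_scal. apply csum_ext. intros q _. apply fourier_char_split. }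
  rewrite csum_scal_r, !grid_orth1 by auto.
  destruct (zz_dec (k1, k2) (0, 0)%Z) as [E|E].
  - injection E as -> ->. simpl. rewrite <- RtoC_mult. f_equal. ring.
  - destruct (Z.eqb_spec k1 0); destruct (Z.eqb_spec k2 0); subst; try ring. congruence.
Qed.

(** These coefficients act as weights of translations: multiplying Fourier coefficients by [a]
    becomes a finite combination of shifts by grid points. *)
Definition dft (M Q : nat) (a : Dist) (p : nat * nat) : C :=
  Cmult (RtoC (/ INR Q ^ 2))
    (csum (box M) (fun l => Cmult (a l) (fourier_char (zopp l) (gx Q (fst p)) (gx Q (snd p))))).

Lemma zsub_0_iff k l : zadd k (zopp l) = (0, 0)%Z <-> k = l.
Proof.
  destruct k, l; unfold zadd, zopp; simpl; split; intros H; injection H; intros; f_equal; lia.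
Qed.

(** [M + M' < Q] rules out aliasing: differences of a frequency in [box M'] and one in [box M] stay
    below [Q], so only [l = k] survives. The identity also covers frequencies of [box M'] outside
    the support of [a]. *)
Lemma dft_inv M M' Q a k :
  supp_in M a -> (M + M' < Q)%nat -> In k (box M') ->
  csum (grid Q) (fun p => Cmult (dft M Q a p) (fourier_char k (gx Q (fst p)) (gx Q (snd p)))) = a k.
Proof.
  intros Hs HQ Hk.
  assert (HQ0 : INR Q ^ 2 <> 0) by (apply pow_nonzero, not_0_INR; lia).
  unfold dft.
  rewrite (csum_ext _ _ (fun p => Cmult (RtoC (/ INR Q ^ 2)) (csum (box M) (fun l => Cmult (a l)
    (fourier_char (zadd k (zopp l)) (gx Q (fst p)) (gx Q (snd p))))))).
  2:{ intros p _. rewrite <- Cmult_assoc, <- csum_scal_r. f_equal. apply csum_ext. intros l _.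
      rewrite fourier_char_zadd. ring. }
  rewrite csum_scal, csum_swap.
  rewrite (csum_ext _ _ (fun l => Cmult (a l) (if zz_dec (zadd k (zopp l)) (0,0)%Z
      then RtoC (INR Q ^ 2) else RtoC 0))).
  2:{ intros l Hl. rewrite csum_scal, grid_orth; auto; rewrite in_box in *;
      unfold zadd, zopp; simpl; lia. }
  destruct (in_dec zz_dec k (box M)) as [I|I].
  - rewrite (csum_single zz_dec _ k); auto using NoDup_box.
    + destruct (zz_dec _ _) as [_|N]; [|exfalso; apply N, (proj2 (zsub_0_iff _ _)); reflexivity].
      rewrite (Cmult_comm (a k)), Cmult_assoc, <- RtoC_mult, Rinv_l by auto. ring.
    + intros l _ Hl. destruct (zz_dec _ _) as [E|_]; [|ring].
      apply (proj1 (zsub_0_iff _ _)) in E. exfalso; auto.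
  - rewrite csum_zero; [rewrite Hs by auto; ring|].
    intros l Hl. destruct (zz_dec _ _) as [E|_]; [|ring].
    apply (proj1 (zsub_0_iff _ _)) in E. subst; contradiction.
Qed.

Lemma dft_parseval M Q a :
  (2 * M < Q)%nat ->
  rsum (grid Q) (fun p => Cmod (dft M Q a p) ^ 2) =
  / INR Q ^ 2 * rsum (box M) (fun l => Cmod (a l) ^ 2).
Proof.
  intros HQ.
  apply RtoC_inj. rewrite <- csum_RtoC.
  rewrite (csum_ext _ _ (fun p => Cmult (RtoC (/ INR Q ^ 2 * / INR Q ^ 2))
    (csum (box M) (fun l => csum (box M) (fun l' => Cmult (Cmult (a l) (Cconj (a l')))
        (fourier_char (zadd l' (zopp l)) (gx Q (fst p)) (gx Q (snd p)))))))).
  2:{ intros p _. rewrite Cmod2_conj. unfold dft. rewrite Cmult_conj, csum_conj.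
      set (c := RtoC (/ INR Q ^ 2)).
      replace (Cconj c) with c by (unfold c; apply injective_projections; simpl; ring).
      rewrite RtoC_mult. fold c.
      match goal with |- Cmult (Cmult c ?X) (Cmult c ?Y) = _ =>
        transitivity (Cmult (Cmult c c) (Cmult X Y)); [ring|] end.
      f_equal. rewrite <- csum_scal_r. apply csum_ext. intros l _. rewrite <- csum_scal.
      apply csum_ext. intros l' _. rewrite Cmult_conj, fourier_char_zadd, <- (fourier_char_zopp (zopp l')).
      replace (zopp (zopp l')) with l' by (destruct l'; unfold zopp; simpl; f_equal; lia).
      ring. }
  rewrite csum_scal, csum_swap.
  rewrite (csum_ext _ _ (fun l => RtoC (INR Q ^ 2 * Cmod (a l) ^ 2))).
  2:{ intros l Hl. rewrite csum_swap.
      rewrite (csum_single zz_dec _ l); auto using NoDup_box.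
      - rewrite csum_scal, grid_orth by (unfold zadd, zopp; simpl; lia).
        destruct (zz_dec _ _) as [_|N]; [|exfalso; apply N, (proj2 (zsub_0_iff _ _)); reflexivity].
        rewrite RtoC_mult, Cmod2_conj. ring.
      - intros l' Hl' Hn. rewrite csum_scal, grid_orth;
          try (rewrite in_box in *; unfold zadd, zopp; simpl; lia).
        destruct (zz_dec _ _) as [E|_]; [|ring].
        apply (proj1 (zsub_0_iff _ _)) in E. exfalso; auto. }
  rewrite csum_RtoC, rsum_scal, <- RtoC_mult. f_equal. field. apply not_0_INR; lia.
Qed.

Definition translate (e : Z * Z) (a : Dist) : Dist := fun k => a (zadd k e).

(** A unit shift can push the support out of [box M], so both transforms are taken over
    [box (M + 1)]. *)
Lemma dft_translate M Q a e p :
  supp_in M a -> (Z.abs (fst e) <= 1)%Z -> (Z.abs (snd e) <= 1)%Z ->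
  dft (M + 1) Q (translate e a) p =
  Cmult (fourier_char e (gx Q (fst p)) (gx Q (snd p))) (dft (M + 1) Q a p).
Proof.
  intros Hs He1 He2. unfold dft.
  set (x1 := gx Q (fst p)). set (x2 := gx Q (snd p)).
  rewrite (Cmult_comm (fourier_char e x1 x2)), <- Cmult_assoc. f_equal.
  rewrite Cmult_comm, <- csum_scal.
  set (G := fun l => Cmult (fourier_char e x1 x2) (Cmult (a l) (fourier_char (zopp l) x1 x2))).
  change (csum (box (M+1)) (fun l => Cmult (a (zadd l e)) (fourier_char (zopp l) x1 x2)) = csum (box (M+1)) G).
  rewrite (csum_ext _ _ (fun l => G (zadd l e))).
  2:{ intros l _. unfold G.
      replace (zopp l) with (zadd e (zopp (zadd l e)))
        by (destruct l, e; unfold zadd, zopp; simpl; f_equal; lia).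
      rewrite fourier_char_zadd. ring. }
  rewrite <- (csum_map (fun l => zadd l e)).
  apply (csum_support zz_dec); auto using NoDup_box.
  - apply FinFun.Injective_map_NoDup; auto using NoDup_box.
    intros [a1 a2] [b1 b2]; unfold zadd; simpl. intros E; injection E; intros; f_equal; lia.
  - intros k _ Hk. unfold G. rewrite Hs; [ring|]. rewrite in_box in *. lia.
  - intros k Hk Hk'. unfold G. rewrite Hs; [ring|]. intros I. apply Hk'. apply in_map_iff.
    exists (zsub k e). split.
    + destruct k, e; unfold zadd, zsub; simpl. f_equal; lia.
    + rewrite in_box in *. unfold zsub; simpl. lia.
Qed.

(** * Fourier multipliers with Lipschitz symbols *)

Lemma ln_le_sub1 x : 0 < x -> ln x <= x - 1.
Proof.
  intros H. apply Rnot_lt_le. intros L. apply exp_increasing in L.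
  rewrite exp_ln in L by auto. pose proof (exp_ineq1_le (x - 1)). lra.
Qed.

(** Comparison with the integral of [1/x] over [[A - t, A]], in a form that telescopes under
    summation. *)
Lemma inv_le_ln_diff A t : 0 < t -> t < A -> / A <= / t * (ln A - ln (A - t)).
Proof.
  intros Ht HA. rewrite <- ln_div by lra.
  assert (E : ln (A / (A - t)) = - ln ((A - t) / A)).
  { rewrite <- ln_Rinv by (apply Rdiv_lt_0_compat; lra). f_equal. field; lra. }
  rewrite E. pose proof (ln_le_sub1 ((A - t) / A)) as L.
  assert (0 < (A - t) / A) by (apply Rdiv_lt_0_compat; lra).
  replace (/ A) with (/ t * (1 - (A - t) / A)) by (field; lra).
  apply Rmult_le_compat_l; [left; apply Rinv_0_lt_compat; lra|lra].
Qed.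

Lemma sum_inv_up t n : 0 < t ->
  rsum (seq 0 (S n)) (fun p => / (1 + t * INR p)) <= 1 + / t * ln (1 + t * INR n).
Proof.
  intros Ht. induction n.
  - simpl. replace (1 + t * 0) with 1 by ring. rewrite ln_1, Rinv_1. lra.
  - rewrite seq_S, rsum_app. cbn [rsum]. rewrite Nat.add_0_l.
    pose proof (pos_INR n).
    pose proof (inv_le_ln_diff (1 + t * INR (S n)) t Ht) as I.
    assert (L : t < 1 + t * INR (S n)) by (rewrite S_INR; nra). specialize (I L).
    replace (1 + t * INR (S n) - t) with (1 + t * INR n) in I by (rewrite S_INR; ring).
    rewrite Rmult_minus_distr_l in I. lra.
Qed.

Lemma sum_inv_down t Q n : 0 < t -> (n <= Q)%nat ->
  rsum (seq 0 n) (fun p => / (1 + t * (INR Q - INR p)))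
  <= / t * (ln (1 + t * INR Q) - ln (1 + t * (INR Q - INR n))).
Proof.
  intros Ht. induction n; intros Hn.
  - simpl. rewrite Rminus_0_r, Rminus_diag. lra.
  - rewrite seq_S, rsum_app. cbn [rsum]. rewrite Nat.add_0_l.
    assert (P : 1 <= INR Q - INR n) by (rewrite <- minus_INR by lia; apply (le_INR 1); lia).
    pose proof (inv_le_ln_diff (1 + t * (INR Q - INR n)) t Ht) as I.
    assert (L : t < 1 + t * (INR Q - INR n)) by nra. specialize (I L).
    replace (1 + t * (INR Q - INR n) - t) with (1 + t * (INR Q - INR (S n))) in I by (rewrite S_INR; ring).
    specialize (IHn ltac:(lia)).
    set (l1 := ln (1 + t * INR Q)) in *. set (l2 := ln (1 + t * (INR Q - INR n))) in *.
    set (l3 := ln (1 + t * (INR Q - INR (S n)))) in *.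
    rewrite Rmult_minus_distr_l in *. lra.
Qed.

(** [tdist Q p / Q] is the distance from [p / Q] to the nearest integer, for [p <= Q]. *)
Definition tdist (Q p : nat) : R := Rmin (INR p) (INR Q - INR p).

Lemma sum_inv_tdist (M Q : nat) : (1 <= M)%nat -> (M <= Q)%nat ->
  rsum (seq 0 Q) (fun p => / (1 + INR M / INR Q * tdist Q p))
  <= 4 * (INR Q / INR M) * (1 + ln (INR M)).
Proof.
  intros HM HQ.
  assert (M1 : 1 <= INR M) by (apply (le_INR 1); auto).
  assert (Q1 : INR M <= INR Q) by (apply le_INR; auto).
  set (t := INR M / INR Q).
  assert (Ht : 0 < t) by (apply Rdiv_lt_0_compat; lra).
  assert (Ht1 : t <= 1) by (apply Rle_div_l; lra).
  assert (Hi : / t = INR Q / INR M) by (unfold t; field; lra).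
  assert (Hi1 : 1 <= / t) by (rewrite <- Rinv_1; apply Rinv_le_contravar; lra).
  assert (HtQ : t * INR Q = INR M) by (unfold t; field; lra).
  rewrite <- Hi.
  (* With a minimum in the denominator, the term is at most the sum of the two alternatives: one
     harmonic sum from each end of the range. *)
  apply Rle_trans with (rsum (seq 0 Q) (fun p => / (1 + t * INR p) + / (1 + t * (INR Q - INR p)))).
  - apply rsum_le. intros p Hp. apply in_seq in Hp.
    pose proof (pos_INR p).
    assert (INR p <= INR Q) by (apply le_INR; lia).
    assert (0 < / (1 + t * INR p)) by (apply Rinv_0_lt_compat; nra).
    assert (0 < / (1 + t * (INR Q - INR p))) by (apply Rinv_0_lt_compat; nra).
    unfold tdist, Rmin. destruct (Rle_dec _ _); lra.
  - rewrite rsum_plus.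
    destruct Q as [|Q]; [lia|].
    pose proof (sum_inv_up t Q Ht) as U.
    pose proof (sum_inv_down t (S Q) (S Q) Ht (le_n _)) as D.
    rewrite HtQ, Rminus_diag, Rmult_0_r, Rplus_0_r, ln_1, Rminus_0_r in D.
    assert (L1 : ln (1 + t * INR Q) <= ln (1 + INR M)).
    { apply Rcomplements.ln_le.
      - pose proof (pos_INR Q). nra.
      - rewrite <- HtQ, S_INR. nra. }
    assert (L2 : ln (1 + INR M) <= 1 + ln (INR M)).
    { apply Rle_trans with (ln (2 * INR M)).
      - apply Rcomplements.ln_le; lra.
      - rewrite ln_mult by lra. pose proof (ln_le_sub1 2). lra. }
    assert (L0 : 0 <= ln (INR M)) by (rewrite <- ln_1; apply Rcomplements.ln_le; lra).
    nra.
Qed.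

Lemma sin_pi_lower x : 0 <= x <= / 2 -> x <= sin (PI * x).
Proof.
  intros H. pose proof PI_4. pose proof PI2_3_2.
  (* Cubic Taylor bound: with [y = PI * x <= 2], [sin y >= y - y^3/6 >= y/3], and [y >= 3 * x]. *)
  destruct (sin_bound (PI * x) 0) as [L _]; [nra|nra|].
  eapply Rle_trans; [|exact L].
  unfold sin_approx, sin_term. simpl.
  set (y := PI * x). assert (0 <= y <= 2) by (unfold y; nra).
  assert (3 * x <= y) by (unfold y; nra).
  field_simplify. nra.
Qed.

Lemma Cmod_fourier_char_sub1 k x1 x2 :
  Cmod (Cminus (fourier_char k x1 x2) (RtoC 1)) ^ 2 =
  4 * sin (PI * (IZR (fst k) * x1 + IZR (snd k) * x2)) ^ 2.
Proof.
  rewrite Cmod2_alt, fourier_char_eq. simpl.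
  set (t := IZR (fst k) * x1 + IZR (snd k) * x2).
  replace (2 * PI * t) with (2 * (PI * t)) by ring.
  pose proof (sin2_cos2 (2 * (PI * t))) as E. unfold Rsqr in E.
  pose proof (cos_2a_sin (PI * t)) as E2.
  nra.
Qed.

Lemma tdist_sin Q p : (p < Q)%nat -> (tdist Q p / INR Q) ^ 2 <= sin (PI * gx Q p) ^ 2.
Proof.
  intros Hp.
  pose proof (pos_INR p). assert (INR p < INR Q) by (apply lt_INR; auto).
  assert (0 <= gx Q p < 1).
  { unfold gx; split; [apply Rdiv_le_0_compat; lra|apply Rlt_div_l; lra]. }
  assert (E : tdist Q p / INR Q = Rmin (gx Q p) (1 - gx Q p)).
  { unfold tdist, gx, Rmin.
    assert (INR Q * (1 - INR p / INR Q) = INR Q - INR p) by (field; lra).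
    destruct (Rle_dec _ _); destruct (Rle_dec _ _); try (field; lra); exfalso; nra. }
  rewrite E. set (x := gx Q p) in *.
  assert (Rmin x (1 - x) <= sin (PI * x)).
  { unfold Rmin. destruct (Rle_dec x (1 - x)).
    - apply sin_pi_lower; lra.
    - replace (PI * x) with (PI - PI * (1 - x)) by ring.
      rewrite sin_PI_x. apply sin_pi_lower; lra. }
  assert (0 <= Rmin x (1 - x)) by (apply Rmin_glb; lra).
  apply pow_incr; lra.
Qed.

Definition weight (M Q : nat) (p : nat * nat) : R :=
  1 + INR M ^ 2 *
    (Cmod (Cminus (fourier_char (1, 0)%Z (gx Q (fst p)) (gx Q (snd p))) (RtoC 1)) ^ 2 +
     Cmod (Cminus (fourier_char (0, 1)%Z (gx Q (fst p)) (gx Q (snd p))) (RtoC 1)) ^ 2).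

Lemma weight_ge1 M Q p : 1 <= weight M Q p.
Proof.
  unfold weight.
  match goal with |- 1 <= 1 + _ * (?a ^ 2 + ?b ^ 2) =>
    pose proof (pow2_ge_0 a); pose proof (pow2_ge_0 b) end.
  nra.
Qed.

(** Since [(1 + u) (1 + v) <= 2 (1 + u^2 + v^2)], the sum over the square factorises into two
    one-dimensional sums, each with one logarithm; the constant is [2 * 4^2]. *)
Lemma sum_inv_weight (M Q : nat) : (1 <= M)%nat -> (M <= Q)%nat ->
  rsum (grid Q) (fun p => / weight M Q p) <= 32 * (INR Q / INR M) ^ 2 * (1 + ln (INR M)) ^ 2.
Proof.
  intros HM HQ.
  assert (M1 : 1 <= INR M) by (apply (le_INR 1); auto).
  assert (Q1 : INR M <= INR Q) by (apply le_INR; auto).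
  set (t := INR M / INR Q).
  assert (Ht : 0 < t) by (apply Rdiv_lt_0_compat; lra).
  set (phi := fun p => / (1 + t * tdist Q p)).
  apply Rle_trans with (rsum (grid Q) (fun p => (2 * phi (fst p)) * phi (snd p))).
  - apply rsum_le. intros [p q] Hp. unfold grid in Hp. apply in_prod_iff in Hp.
    rewrite !in_seq in Hp. unfold phi; simpl fst; simpl snd.
    assert (T : forall p, (p < Q)%nat -> 0 <= t * tdist Q p).
    { intros a Ha. apply Rmult_le_pos; [lra|]. unfold tdist. apply Rmin_glb.
      - apply pos_INR.
      - assert (INR a < INR Q) by (apply lt_INR; auto). lra. }
    pose proof (T p ltac:(lia)) as Tp. pose proof (T q ltac:(lia)) as Tq.
    assert (W : (1 + t * tdist Q p) * (1 + t * tdist Q q) <= 2 * weight M Q (p, q)).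
    { unfold weight. rewrite !Cmod_fourier_char_sub1. simpl fst; simpl snd.
      rewrite Rmult_0_l, Rmult_0_l, Rplus_0_r, Rplus_0_l, !Rmult_1_l.
      pose proof (tdist_sin Q p ltac:(lia)) as Sp. pose proof (tdist_sin Q q ltac:(lia)) as Sq.
      assert (Ep : (t * tdist Q p) ^ 2 = INR M ^ 2 * (tdist Q p / INR Q) ^ 2) by (unfold t; field; lra).
      assert (Eq : (t * tdist Q q) ^ 2 = INR M ^ 2 * (tdist Q q / INR Q) ^ 2) by (unfold t; field; lra).
      set (u := t * tdist Q p) in *. set (v := t * tdist Q q) in *.
      set (sp := sin (PI * gx Q p) ^ 2) in *. set (sq := sin (PI * gx Q q) ^ 2) in *.
      pose proof (pow2_ge_0 (INR M)).
      assert (u ^ 2 <= INR M ^ 2 * sp) by (rewrite Ep; apply Rmult_le_compat_l; auto).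
      assert (v ^ 2 <= INR M ^ 2 * sq) by (rewrite Eq; apply Rmult_le_compat_l; auto).
      pose proof (pow2_ge_0 (u - 1)). pose proof (pow2_ge_0 (v - 1)). pose proof (pow2_ge_0 (u - v)).
      assert (0 <= INR M ^ 2 * sp) by (apply Rmult_le_pos; [auto|apply pow2_ge_0]).
      assert (0 <= INR M ^ 2 * sq) by (apply Rmult_le_pos; [auto|apply pow2_ge_0]).
      lra. }
    assert (P : 0 < (1 + t * tdist Q p) * (1 + t * tdist Q q)) by nra.
    rewrite Rmult_assoc, <- Rinv_mult.
    replace (/ weight M Q (p, q)) with (2 * / (2 * weight M Q (p, q))).
    2:{ field; lra. }
    apply Rmult_le_compat_l; [lra|]. apply Rinv_le_contravar; auto.
  - unfold grid. rewrite (rsum_prod_mult _ _ (fun p => 2 * phi p) phi), rsum_scal.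
    pose proof (sum_inv_tdist M Q HM HQ) as S. fold t in S. fold phi in S.
    assert (0 <= rsum (seq 0 Q) phi).
    { apply rsum_ge0. intros p Hp. apply in_seq in Hp. left; apply Rinv_0_lt_compat.
      assert (0 <= tdist Q p); [|nra]. unfold tdist. apply Rmin_glb; [apply pos_INR|].
      assert (INR p < INR Q) by (apply lt_INR; lia). lra. }
    set (s := rsum (seq 0 Q) phi) in *.
    set (b := 4 * (INR Q / INR M) * (1 + ln (INR M))) in *.
    replace (32 * (INR Q / INR M) ^ 2 * (1 + ln (INR M)) ^ 2) with (2 * (b * b)) by (unfold b; ring).
    nra.
Qed.

Lemma dft_sub1 M Q a e p :
  supp_in M a -> (Z.abs (fst e) <= 1)%Z -> (Z.abs (snd e) <= 1)%Z ->
  dft (M + 1) Q (dsub (translate e a) a) p =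
  Cmult (Cminus (fourier_char e (gx Q (fst p)) (gx Q (snd p))) (RtoC 1)) (dft (M + 1) Q a p).
Proof.
  intros Hs H1 H2.
  transitivity (Cminus (dft (M + 1) Q (translate e a) p) (dft (M + 1) Q a p)).
  - unfold dft, dsub.
    match goal with |- _ = Cminus (Cmult ?c ?x) (Cmult ?c ?y) =>
      transitivity (Cmult c (Cminus x y)); [|ring] end.
    f_equal. rewrite <- csum_minus. apply csum_ext. intros; ring.
  - rewrite dft_translate by auto. ring.
Qed.

Lemma supp_in_le M M' f : supp_in M f -> (M <= M')%nat -> supp_in M' f.
Proof. intros H L k Hk. apply H. intros I. apply Hk. rewrite in_box in *. lia. Qed.

Lemma dft_l1 M Q a B :
  (1 <= M)%nat -> (2 * M + 2 < Q)%nat -> 0 < B -> supp_in M a ->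
  (forall k, Cmod (a k) <= B) ->
  (forall k, Cmod (Cminus (a (zadd k (1, 0)%Z)) (a k)) <= B / INR M) ->
  (forall k, Cmod (Cminus (a (zadd k (0, 1)%Z)) (a k)) <= B / INR M) ->
  rsum (grid Q) (fun p => Cmod (dft (M + 1) Q a p)) <= 54 * B * (1 + ln (INR M)) ^ 2.
Proof.
  intros HM HQ HB Hs Ha H1 H2.
  assert (M1 : 1 <= INR M) by (apply (le_INR 1); auto).
  assert (Q1 : INR M <= INR Q) by (apply le_INR; lia).
  set (Lg := (1 + ln (INR M)) ^ 2).
  (* The AM-GM weight, chosen so that the Parseval half ([75 * B], counting the symbol and its two
     differences) and the [sum_inv_weight] half ([32 * B * Lg]) are both of order [B]. As [1 <= Lg],
     half of their sum is at most [54 * B * Lg]. *)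
  set (kap := INR Q ^ 2 / (INR M ^ 2 * B)).
  assert (Hk : 0 < kap).
  { apply Rdiv_lt_0_compat; [apply pow_lt; lra|]. apply Rmult_lt_0_compat; auto. apply pow_lt; lra. }
  set (c := fun p => Cmod (dft (M + 1) Q a p)).
  assert (P : forall b D, 0 <= D -> (forall k, Cmod (b k) <= D) ->
     rsum (grid Q) (fun p => Cmod (dft (M + 1) Q b p) ^ 2) <= / INR Q ^ 2 * (25 * INR M ^ 2 * D ^ 2)).
  { intros b D HD Hb. rewrite dft_parseval by lia.
    apply Rmult_le_compat_l; [left; apply Rinv_0_lt_compat, pow_lt; lra|].
    eapply Rle_trans.
    - apply (rsum_le_const _ _ (D ^ 2)). intros k _. apply pow_incr. split; [apply Cmod_ge_0|auto].
    - apply Rmult_le_compat_r; [apply pow2_ge_0|].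
      unfold box. rewrite length_prod, length_zrange, mult_INR.
      (* Side length of the box: [2 M + 3 <= 5 M] because [1 <= M]; hence the 25. *)
      assert (INR (2 * (M + 1) + 1) <= 5 * INR M).
      { rewrite !plus_INR, mult_INR, plus_INR. simpl. lra. }
      pose proof (pos_INR (2 * (M + 1) + 1)). nra. }
  assert (HW : rsum (grid Q) (fun p => weight M Q p * c p ^ 2) <= / INR Q ^ 2 * (75 * INR M ^ 2 * B ^ 2)).
  (* Multiplying the transform by [character - 1] is taking a difference of the symbol, so the
     weighted square splits into three unweighted ones. *)
  { rewrite (rsum_ext _ _ (fun p => Cmod (dft (M + 1) Q a p) ^ 2 +
       (INR M ^ 2 * Cmod (dft (M + 1) Q (dsub (translate (1,0)%Z a) a) p) ^ 2 +
        INR M ^ 2 * Cmod (dft (M + 1) Q (dsub (translate (0,1)%Z a) a) p) ^ 2))).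
    2:{ intros p _. rewrite !dft_sub1 by (auto; simpl; lia). rewrite !Cmod_mult.
        unfold weight, c. ring. }
    rewrite !rsum_plus, !rsum_scal.
    pose proof (P a B ltac:(lra) Ha) as P0.
    assert (HD : 0 <= B / INR M) by (apply Rdiv_le_0_compat; lra).
    pose proof (P (dsub (translate (1,0)%Z a) a) (B / INR M) HD H1) as P1.
    pose proof (P (dsub (translate (0,1)%Z a) a) (B / INR M) HD H2) as P2.
    assert (E : 25 * INR M ^ 2 * (B / INR M) ^ 2 = 25 * B ^ 2) by (field; lra).
    rewrite E in P1, P2.
    assert (0 < INR M ^ 2) by (apply pow_lt; lra).
    apply (Rmult_le_compat_l (INR M ^ 2)) in P1; [|lra].
    apply (Rmult_le_compat_l (INR M ^ 2)) in P2; [|lra].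
    lra. }
  apply Rle_trans with (rsum (grid Q) (fun p => / 2 * (kap * (weight M Q p * c p ^ 2)
      + / kap * / weight M Q p))).
  - apply rsum_le. intros p _. fold (c p).
    pose proof (weight_ge1 M Q p) as W. set (w := weight M Q p) in *.
    (* AM-GM with weight [kap * w] *)
    assert (0 < kap * w) by nra.
    rewrite <- Rinv_mult, <- Rmult_assoc. set (z := kap * w) in *.
    assert (E : z * c p ^ 2 + / z - 2 * c p = / z * (z * c p - 1) ^ 2) by (field; lra).
    assert (0 <= / z * (z * c p - 1) ^ 2).
    { apply Rmult_le_pos; [left; apply Rinv_0_lt_compat; auto|apply pow2_ge_0]. }
    lra.
  - rewrite rsum_scal, rsum_plus, !rsum_scal.
    pose proof (sum_inv_weight M Q HM ltac:(lia)) as SW. fold Lg in SW.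
    apply (Rmult_le_compat_l kap) in HW; [|lra].
    assert (0 < / kap) by (apply Rinv_0_lt_compat; auto).
    apply (Rmult_le_compat_l (/ kap)) in SW; [|lra].
    assert (E1 : kap * (/ INR Q ^ 2 * (75 * INR M ^ 2 * B ^ 2)) = 75 * B)
      by (unfold kap; field; lra).
    assert (E2 : / kap * (32 * (INR Q / INR M) ^ 2 * Lg) = 32 * B * Lg)
      by (unfold kap; field; lra).
    rewrite E1 in HW. rewrite E2 in SW.
    assert (1 <= Lg).
    { unfold Lg. assert (0 <= ln (INR M)) by (rewrite <- ln_1; apply Rcomplements.ln_le; lra). nra. }
    nra.
Qed.

Theorem multiplier_bound M M' a h B S :
  (1 <= M)%nat -> 0 < B -> supp_in M a ->
  (forall k, Cmod (a k) <= B) ->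
  (forall k, Cmod (Cminus (a (zadd k (1, 0)%Z)) (a k)) <= B / INR M) ->
  (forall k, Cmod (Cminus (a (zadd k (0, 1)%Z)) (a k)) <= B / INR M) ->
  (forall x1 x2, Cmod (ev M' h x1 x2) <= S) ->
  forall x1 x2, Cmod (ev M' (fun k => Cmult (a k) (h k)) x1 x2) <= 54 * B * (1 + ln (INR M)) ^ 2 * S.
Proof.
  intros HM HB Hs Ha H1 H2 Hh x1 x2.
  (* The l^1 bound of [dft_l1] does not depend on [Q], so the grid may be refined until it also
     resolves [h], whose box [M'] is unrelated to [M]. *)
  set (Q := (2 * M + M' + 4)%nat).
  assert (E : ev M' (fun k => Cmult (a k) (h k)) x1 x2 =
    csum (grid Q) (fun p => Cmult (dft (M + 1) Q a p)
       (ev M' h (x1 + gx Q (fst p)) (x2 + gx Q (snd p))))).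
  { unfold ev.
    rewrite (csum_ext (box M') _ (fun k => csum (grid Q) (fun p => Cmult (dft (M + 1) Q a p)
       (Cmult (h k) (fourier_char k (x1 + gx Q (fst p)) (x2 + gx Q (snd p))))))).
    - rewrite csum_swap. apply csum_ext. intros p _. apply csum_scal.
    - intros k Hk. rewrite <- (dft_inv (M + 1) M' Q a k) by
        (solve [auto | apply (supp_in_le M); auto; lia | unfold Q; lia]).
      rewrite <- !csum_scal_r. apply csum_ext. intros p _. rewrite fourier_char_add. ring. }
  rewrite E. eapply Rle_trans; [apply Cmod_csum|].
  assert (HS : 0 <= S) by (eapply Rle_trans; [apply Cmod_ge_0|apply (Hh 0 0)]).
  apply Rle_trans with (rsum (grid Q) (fun p => S * Cmod (dft (M + 1) Q a p))).
  - apply rsum_le. intros p _. rewrite Cmod_mult, Rmult_comm.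
    apply Rmult_le_compat_r; [apply Cmod_ge_0|apply Hh].
  - rewrite rsum_scal, (Rmult_comm _ S). apply Rmult_le_compat_l; auto.
    apply dft_l1; auto. unfold Q; lia.
Qed.

(** * The dyadic partition of unity *)

Lemma gsm_pos x : 0 < x -> gsm x = exp (- / x).
Proof. intros H. unfold gsm. destruct (Rlt_dec 0 x); [reflexivity|lra]. Qed.

Lemma gsm_neg x : x <= 0 -> gsm x = 0.
Proof. intros H. unfold gsm. destruct (Rlt_dec 0 x); [lra|reflexivity]. Qed.

Lemma gsm_ge0 x : 0 <= gsm x.
Proof. unfold gsm. destruct (Rlt_dec 0 x); [left; apply exp_pos|lra]. Qed.

Lemma gsm_le_id x : 0 < x -> gsm x <= x.
Proof.
  intros H. rewrite gsm_pos, exp_Ropp by auto.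
  assert (0 < / x) by (apply Rinv_0_lt_compat; auto).
  rewrite <- (Rinv_inv x) at 2. apply Rinv_le_contravar; auto.
  pose proof (exp_ineq1_le (/ x)). lra.
Qed.

Lemma gsm_le_sqr x : 0 < x -> gsm x <= 4 * (x * x).
Proof.
  intros H. rewrite gsm_pos by auto.
  assert (0 < / x) by (apply Rinv_0_lt_compat; auto). set (u := / x) in *.
  replace x with (/ u) by (unfold u; apply Rinv_inv).
  rewrite exp_Ropp.
  assert (E : exp u = exp (u / 2) * exp (u / 2)) by (rewrite <- exp_plus; f_equal; field).
  pose proof (exp_ineq1_le (u / 2)) as I.
  replace (4 * (/ u * / u)) with (/ (u / 2 * (u / 2))) by (field; lra).
  apply Rinv_le_contravar; [nra|]. rewrite E. nra.
Qed.

(** Two regimes. If [y <= 2 x], the factor [/ x - / y] is compensated by [gsm y <= 4 y^2]; if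
    [y > 2 x], already [gsm y <= y <= 2 (y - x)]. *)
Lemma gsm_lip_lt x y : x < y -> Rabs (gsm y - gsm x) <= 8 * (y - x).
Proof.
  intros H. destruct (Rle_dec x 0) as [Hx|Hx].
  - rewrite (gsm_neg x), Rminus_0_r, Rabs_pos_eq by (auto using gsm_ge0).
    destruct (Rle_dec y 0); [rewrite gsm_neg; lra|].
    pose proof (gsm_le_id y). lra.
  - assert (E : gsm y - gsm x = gsm y * (1 - exp (- (/ x - / y)))).
    { rewrite !gsm_pos by lra. rewrite Rmult_minus_distr_l, <- exp_plus, Rmult_1_r.
      f_equal. f_equal. f_equal. ring. }
    assert (I : 0 < / x - / y).
    { assert (/ y < / x) by (apply Rinv_lt_contravar; nra). lra. }
    pose proof (exp_ineq1_le (- (/ x - / y))) as X.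
    assert (exp (- (/ x - / y)) <= 1) by (rewrite <- exp_0; left; apply exp_increasing; lra).
    pose proof (exp_pos (- (/ x - / y))). pose proof (gsm_ge0 y).
    rewrite E, Rabs_pos_eq by nra.
    destruct (Rle_dec y (2 * x)).
    + pose proof (gsm_le_sqr y ltac:(lra)) as G.
      apply Rle_trans with (4 * (y * y) * (/ x - / y)); [nra|].
      replace (4 * (y * y) * (/ x - / y)) with (4 * (y / x) * (y - x)) by (field; lra).
      assert (y / x <= 2) by (apply Rle_div_l; lra). nra.
    + pose proof (gsm_le_id y). nra.
Qed.

Lemma gsm_lip x y : Rabs (gsm x - gsm y) <= 8 * Rabs (x - y).
Proof.
  destruct (Rtotal_order x y) as [H|[->|H]].
  - rewrite Rabs_minus_sym, (Rabs_minus_sym x), (Rabs_pos_eq (y - x)) by lra.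
    apply gsm_lip_lt; auto.
  - rewrite !Rminus_diag, Rabs_R0. lra.
  - rewrite (Rabs_pos_eq (x - y)) by lra. apply gsm_lip_lt; auto.
Qed.

(** The arguments [4 / 3 - r] and [r - 1] add up to [1 / 3], so one of them is at least [1 / 6]. *)
Lemma hcut_den r : exp (- 6) <= gsm (4 / 3 - r) + gsm (r - 1).
Proof.
  assert (H : forall x, / 6 <= x -> exp (- 6) <= gsm x).
  { intros x Hx. rewrite gsm_pos by lra.
    assert (/ x <= 6) by (rewrite <- (Rinv_inv 6); apply Rinv_le_contravar; lra).
    destruct (Req_dec (/ x) 6) as [E|]; [right; f_equal; lra|]. left; apply exp_increasing; lra. }
  pose proof (gsm_ge0 (4 / 3 - r)). pose proof (gsm_ge0 (r - 1)).
  destruct (Rle_dec (/ 6) (r - 1)) as [L|L].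
  - pose proof (H _ L). lra.
  - pose proof (H (4 / 3 - r) ltac:(lra)). lra.
Qed.

Lemma hcut_bounds r : 0 <= hcut r <= 1.
Proof.
  unfold hcut. pose proof (hcut_den r). pose proof (exp_pos (- 6)).
  pose proof (gsm_ge0 (4 / 3 - r)). pose proof (gsm_ge0 (r - 1)).
  split; [apply Rdiv_le_0_compat; lra|apply Rle_div_l; lra].
Qed.

Lemma hcut_1 r : r <= 1 -> hcut r = 1.
Proof.
  intros H. unfold hcut. pose proof (hcut_den r). pose proof (exp_pos (- 6)).
  rewrite (gsm_neg (r - 1)) in * by lra. field. lra.
Qed.

Lemma hcut_0 r : 4 / 3 <= r -> hcut r = 0.
Proof. intros H. unfold hcut. rewrite (gsm_neg (4 / 3 - r)) by lra. unfold Rdiv; ring. Qed.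

(** 8 is the Lipschitz constant of [gsm], and [exp 6] the inverse of the lower bound in
    [hcut_den]. *)
Definition Lh : R := 8 * exp 6.

Lemma Lh_ge1 : 1 <= Lh.
Proof. unfold Lh. pose proof (exp_ineq1_le 6). lra. Qed.

Lemma hcut_lip r s : Rabs (hcut r - hcut s) <= Lh * Rabs (r - s).
Proof.
  unfold hcut, Lh. pose proof (hcut_den r) as Dr. pose proof (hcut_den s) as Ds.
  pose proof (exp_pos (- 6)) as P6.
  pose proof (gsm_ge0 (4 / 3 - s)). pose proof (gsm_ge0 (s - 1)).
  pose proof (gsm_lip (4 / 3 - r) (4 / 3 - s)) as L1.
  pose proof (gsm_lip (r - 1) (s - 1)) as L2.
  replace (4 / 3 - r - (4 / 3 - s)) with (- (r - s)) in L1 by ring. rewrite Rabs_Ropp in L1.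
  replace (r - 1 - (s - 1)) with (r - s) in L2 by ring.
  set (a := gsm (4 / 3 - r)) in *. set (b := gsm (r - 1)) in *.
  set (a' := gsm (4 / 3 - s)) in *. set (b' := gsm (s - 1)) in *.
  (* Written so that the bound on the numerator carries [a' + b'], which cancels one denominator;
     only the other one uses the lower bound [exp (- 6)]. *)
  replace (a / (a + b) - a' / (a' + b')) with
    (((a - a') * b' - a' * (b - b')) * / (a + b) * / (a' + b')) by (field; lra).
  rewrite !Rabs_mult, (Rabs_pos_eq (/ (a + b))), (Rabs_pos_eq (/ (a' + b')))
    by (left; apply Rinv_0_lt_compat; lra).
  assert (N : Rabs ((a - a') * b' - a' * (b - b')) <= 8 * Rabs (r - s) * (a' + b')).
  { unfold Rminus at 1. eapply Rle_trans; [apply Rabs_triang|].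
    rewrite Rabs_Ropp, !Rabs_mult, (Rabs_pos_eq b'), (Rabs_pos_eq a') by auto. nra. }
  assert (I : / (a + b) <= exp 6).
  { replace (exp 6) with (/ exp (- 6)) by (rewrite <- exp_Ropp; f_equal; lra).
    apply Rinv_le_contravar; lra. }
  assert (0 < / (a + b)) by (apply Rinv_0_lt_compat; lra).
  assert (P : 0 < / (a' + b')) by (apply Rinv_0_lt_compat; lra).
  apply Rle_trans with (8 * Rabs (r - s) * (a' + b') * / (a + b) * / (a' + b')).
  - apply Rmult_le_compat_r; [lra|]. apply Rmult_le_compat_r; lra.
  - replace (8 * Rabs (r - s) * (a' + b') * / (a + b) * / (a' + b')) with
      (8 * Rabs (r - s) * / (a + b)) by (field; lra).
    pose proof (Rabs_pos (r - s)). nra.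
Qed.

Lemma knorm_Cmod k : knorm k = Cmod (IZR (fst k), IZR (snd k)).
Proof. reflexivity. Qed.

Lemma knorm_ge0 k : 0 <= knorm k.
Proof. apply sqrt_pos. Qed.

Lemma knorm_sqr k : knorm k ^ 2 = IZR (fst k) ^ 2 + IZR (snd k) ^ 2.
Proof. unfold knorm. apply pow2_sqrt. pose proof (pow2_ge_0 (IZR (fst k))). pose proof (pow2_ge_0 (IZR (snd k))). lra. Qed.

Lemma knorm_zadd k l : knorm (zadd k l) <= knorm k + knorm l.
Proof.
  rewrite !knorm_Cmod. unfold zadd; simpl. rewrite !plus_IZR.
  apply (Cmod_triangle (IZR (fst k), IZR (snd k)) (IZR (fst l), IZR (snd l))).
Qed.

Lemma knorm_zopp k : knorm (zopp k) = knorm k.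
Proof. unfold knorm, zopp; simpl. rewrite !opp_IZR. f_equal. ring. Qed.

Lemma knorm_comp_le k : Rabs (IZR (fst k)) <= knorm k /\ Rabs (IZR (snd k)) <= knorm k.
Proof.
  pose proof (Rmax_Cmod (IZR (fst k), IZR (snd k))) as H. rewrite <- knorm_Cmod in H. simpl in H.
  split; eapply Rle_trans; [|exact H| |exact H]; [apply Rmax_l|apply Rmax_r].
Qed.

Lemma knorm_unit_step k e : knorm e = 1 -> Rabs (knorm (zadd k e) - knorm k) <= 1.
Proof.
  intros He. apply Rabs_le. pose proof (knorm_zadd k e).
  pose proof (knorm_zadd (zadd k e) (zopp e)) as H2. rewrite knorm_zopp in H2.
  replace (zadd (zadd k e) (zopp e)) with k in H2
    by (destruct k, e; unfold zadd, zopp; simpl; f_equal; lia).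
  lra.
Qed.

Lemma knorm_e1 : knorm (1, 0)%Z = 1.
Proof. unfold knorm; simpl. replace (1 * (1 * 1) + 0 * (0 * 1)) with 1 by ring. apply sqrt_1. Qed.
Lemma knorm_e2 : knorm (0, 1)%Z = 1.
Proof. unfold knorm; simpl. replace (0 * (0 * 1) + 1 * (1 * 1)) with 1 by ring. apply sqrt_1. Qed.

Lemma knorm_in_box M k : knorm k <= INR M -> In k (box M).
Proof.
  intros H. destruct (knorm_comp_le k) as [H1 H2]. rewrite in_box.
  rewrite <- abs_IZR in H1, H2. rewrite INR_IZR_INZ in H.
  split; apply le_IZR; lra.
Qed.

Lemma two_pow_pos n : 0 < 2 ^ n.
Proof. apply pow_lt; lra. Qed.

Lemma INR_pow2 n : INR (2 ^ n) = 2 ^ n.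
Proof. rewrite pow_INR. reflexivity. Qed.

Lemma two_pow_ge1 n : (1 <= 2 ^ n)%nat.
Proof. induction n; simpl; lia. Qed.

Lemma chiN_1 N r : r <= 2 ^ N -> chiN N r = 1.
Proof. intros H. apply hcut_1. apply Rle_div_l; [apply two_pow_pos|lra]. Qed.

Lemma chiN_0 N r : 4 / 3 * 2 ^ N <= r -> chiN N r = 0.
Proof. intros H. apply hcut_0. apply (Rle_div_r (4 / 3)); [apply two_pow_pos|lra]. Qed.

Lemma chiN_bounds N r : 0 <= chiN N r <= 1.
Proof. apply hcut_bounds. Qed.

Lemma chiN_lip N r s : Rabs (chiN N r - chiN N s) <= Lh * Rabs (r - s) / 2 ^ N.
Proof.
  unfold chiN, chi_r. eapply Rle_trans; [apply hcut_lip|].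
  replace (r / 2 ^ N - s / 2 ^ N) with ((r - s) * / 2 ^ N) by (unfold Rdiv; ring).
  rewrite Rabs_mult, (Rabs_pos_eq (/ 2 ^ N)) by (left; apply Rinv_0_lt_compat, two_pow_pos).
  unfold Rdiv; lra.
Qed.

Lemma rhoj_O r : rhoj 0 r = chiN 0 r.
Proof. unfold rhoj, chiN. simpl. f_equal. field. Qed.

Lemma rhoj_S j r : rhoj (S j) r = chiN (S j) r - chiN j r.
Proof.
  unfold rhoj, rho_r, chiN. f_equal. f_equal. simpl. field. apply pow_nonzero; lra.
Qed.

Lemma rhoj_abs n r : Rabs (rhoj n r) <= 1.
Proof.
  apply Rabs_le. destruct n.
  - rewrite rhoj_O. pose proof (chiN_bounds 0 r). lra.
  - rewrite rhoj_S. pose proof (chiN_bounds n r). pose proof (chiN_bounds (S n) r). lra.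
Qed.

Lemma rhoj_high n r : 4 / 3 * 2 ^ n <= r -> rhoj n r = 0.
Proof.
  intros H. destruct n.
  - rewrite rhoj_O. apply chiN_0; auto.
  - rewrite rhoj_S, !chiN_0; [ring| |auto]. simpl in H. pose proof (two_pow_pos n). lra.
Qed.

Lemma rhoj_low n r : r <= 2 ^ n -> rhoj (S n) r = 0.
Proof.
  intros H. rewrite rhoj_S, !chiN_1; [ring|auto|]. simpl. pose proof (two_pow_pos n). lra.
Qed.

(** Normalised by the radius [2 ^ (n + 1)] of the box containing the support, which is the form
    required by the multiplier bound. *)
Lemma rhoj_lip n r s : Rabs (rhoj n r - rhoj n s) <= 6 * Lh * Rabs (r - s) / 2 ^ (n + 1).
Proof.
  pose proof (Rabs_pos (r - s)) as P. pose proof Lh_ge1 as L.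
  rewrite pow_add, pow_1. destruct n.
  - rewrite !rhoj_O. eapply Rle_trans; [apply chiN_lip|]. simpl. nra.
  - rewrite !rhoj_S.
    replace (_ - _ - (_ - _)) with ((chiN (S n) r - chiN (S n) s) + - (chiN n r - chiN n s)) by ring.
    eapply Rle_trans; [apply Rabs_triang|]. rewrite Rabs_Ropp.
    pose proof (chiN_lip n r s) as A. pose proof (chiN_lip (S n) r s) as B.
    pose proof (two_pow_pos n).
    replace (6 * Lh * Rabs (r - s) / (2 ^ S n * 2)) with
      (Lh * Rabs (r - s) / 2 ^ S n + Lh * Rabs (r - s) / 2 ^ n) by (simpl; field; lra).
    lra.
Qed.

Lemma sum_rhoj N r : rsum (seq 0 (S N)) (fun n => rhoj n r) = chiN N r.
Proof.
  induction N.
  - simpl. rewrite Rplus_0_r. apply rhoj_O.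
  - rewrite seq_S, rsum_app, IHN. cbn [rsum Nat.add]. rewrite rhoj_S. ring.
Qed.

(** * Block symbols as Fourier multipliers *)

Definition rho_sym (n : nat) : Dist := fun k => RtoC (rhoj n (knorm k)).

Lemma rho_sym_supp n : supp_in (2 ^ (n + 1)) (rho_sym n).
Proof.
  intros k Hk. unfold rho_sym. rewrite rhoj_high; auto.
  apply Rnot_lt_le. intros L. apply Hk, knorm_in_box.
  rewrite INR_pow2, pow_add, pow_1. pose proof (two_pow_pos n). lra.
Qed.

Lemma LP_block_ev n f x1 x2 :
  LP_block n f x1 x2 = ev (2 ^ (n + 1)) (fun k => Cmult (rho_sym n k) (f k)) x1 x2.
Proof.
  unfold LP_block. rewrite box_sum_csum. apply csum_ext. intros k _. unfold rho_sym. ring.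
Qed.

Lemma LP_block_ev_big n M f x1 x2 : (2 ^ (n + 1) <= M)%nat ->
  LP_block n f x1 x2 = ev M (fun k => Cmult (rho_sym n k) (f k)) x1 x2.
Proof.
  intros H. rewrite LP_block_ev. symmetry. apply ev_ext_supp; auto.
  intros k Hk. rewrite rho_sym_supp by auto. ring.
Qed.

Lemma log_pow2 n : 1 + ln (INR (2 ^ (n + 1))) <= INR n + 2.
Proof.
  rewrite INR_pow2, ln_pow by lra. pose proof (ln_le_sub1 2).
  rewrite plus_INR. simpl (INR 1). pose proof (pos_INR n). nra.
Qed.

Lemma log_pow2_ge n : 1 <= 1 + ln (INR (2 ^ (n + 1))).
Proof.
  assert (0 <= ln (INR (2 ^ (n + 1)))); [|lra]. rewrite <- ln_1. apply Rcomplements.ln_le; [lra|].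
  apply (le_INR 1). apply two_pow_ge1.
Qed.

Lemma multiplier_bound_pow2 n M' a h B S :
  0 < B -> supp_in (2 ^ (n + 1)) a ->
  (forall k, Cmod (a k) <= B) ->
  (forall k e, knorm e = 1 -> Cmod (Cminus (a (zadd k e)) (a k)) <= B / 2 ^ (n + 1)) ->
  (forall x1 x2, Cmod (ev M' h x1 x2) <= S) ->
  forall x1 x2, Cmod (ev M' (fun k => Cmult (a k) (h k)) x1 x2) <= 54 * B * (INR n + 2) ^ 2 * S.
Proof.
  intros HB Hs Ha Hd Hh x1 x2.
  assert (HS : 0 <= S) by (eapply Rle_trans; [apply Cmod_ge_0|apply (Hh 0 0)]).
  eapply Rle_trans.
  - apply (multiplier_bound (2 ^ (n + 1)) M' a h B S); auto using two_pow_ge1.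
    + intros k. rewrite INR_pow2. apply Hd, knorm_e1.
    + intros k. rewrite INR_pow2. apply Hd, knorm_e2.
  - apply Rmult_le_compat_r; auto. apply Rmult_le_compat_l; [lra|].
    pose proof (log_pow2 n). pose proof (log_pow2_ge n). apply pow_incr; lra.
Qed.

(** Localising to a block costs [(n + 2)^2] in sup norm: the logarithmic loss in dyadic form. *)
Lemma rho_sym_multiplier n M' h S :
  (forall x1 x2, Cmod (ev M' h x1 x2) <= S) ->
  forall x1 x2, Cmod (ev M' (fun k => Cmult (rho_sym n k) (h k)) x1 x2)
     <= 54 * (6 * Lh) * (INR n + 2) ^ 2 * S.
Proof.
  intros Hh. pose proof Lh_ge1. apply multiplier_bound_pow2; auto using rho_sym_supp.
  - lra.
  - intros k. unfold rho_sym. rewrite Cmod_R. pose proof (rhoj_abs n (knorm k)). lra.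
  - intros k e He. unfold rho_sym. rewrite <- RtoC_minus, Cmod_R.
    eapply Rle_trans; [apply rhoj_lip|]. unfold Rdiv. apply Rmult_le_compat_r.
    + left; apply Rinv_0_lt_compat, two_pow_pos.
    + pose proof (knorm_unit_step k e He). nra.
Qed.

(** * Complex sequences *)

Definition cvgc (u : nat -> C) (l : C) : Prop :=
  forall eps, 0 < eps -> exists N, forall n, (N <= n)%nat -> Cmod (Cminus (u n) l) <= eps.

Lemma Cmod_minus_sym x y : Cmod (Cminus x y) = Cmod (Cminus y x).
Proof. rewrite <- Cmod_opp. f_equal. ring. Qed.

(** [Clim_seq] is total and returns some value even without convergence, so each use of it has to be
    accompanied by a proof of convergence. *)
Lemma cvgc_Clim u l : cvgc u l -> Clim_seq u = l.
Proof.
  intros H. unfold Clim_seq.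
  assert (P : forall (p : C -> R), (forall z w, Rabs (p z - p w) <= Cmod (Cminus z w)) ->
     is_lim_seq (fun n => p (u n)) (p l)).
  { intros p Hp. apply is_lim_seq_spec. intros eps.
    destruct (H (eps / 2)) as [N HN]; [destruct eps; simpl; lra|].
    exists N. intros n Hn. eapply Rle_lt_trans; [apply Hp|].
    specialize (HN n Hn). destruct eps; simpl in *; lra. }
  rewrite (is_lim_seq_unique _ _ (P fst (fun z w => Rle_trans _ _ _ (Rmax_l _ _) (Rmax_Cmod (Cminus z w))))).
  rewrite (is_lim_seq_unique _ _ (P snd (fun z w => Rle_trans _ _ _ (Rmax_r _ _) (Rmax_Cmod (Cminus z w))))).
  destruct l; reflexivity.
Qed.

Lemma cvgc_plus u v l m : cvgc u l -> cvgc v m -> cvgc (fun n => Cplus (u n) (v n)) (Cplus l m).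
Proof.
  intros Hu Hv eps He. destruct (Hu (eps / 2)) as [N HN]; [lra|].
  destruct (Hv (eps / 2)) as [N' HN']; [lra|].
  exists (N + N')%nat. intros n Hn. specialize (HN n ltac:(lia)). specialize (HN' n ltac:(lia)).
  replace (Cminus _ _) with (Cplus (Cminus (u n) l) (Cminus (v n) m)) by ring.
  eapply Rle_trans; [apply Cmod_triangle|]. lra.
Qed.

Lemma cvgc_scal c u l : cvgc u l -> cvgc (fun n => Cmult c (u n)) (Cmult c l).
Proof.
  intros Hu eps He. pose proof (Cmod_ge_0 c).
  destruct (Hu (eps / (1 + Cmod c))) as [N HN]; [apply Rdiv_lt_0_compat; lra|].
  exists N. intros n Hn. specialize (HN n Hn).
  replace (Cminus _ _) with (Cmult c (Cminus (u n) l)) by ring. rewrite Cmod_mult.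
  apply Rle_trans with (Cmod c * (eps / (1 + Cmod c))).
  - apply Rmult_le_compat_l; auto.
  - replace (Cmod c * (eps / (1 + Cmod c))) with (eps - eps / (1 + Cmod c)) by (field; lra).
    assert (0 < eps / (1 + Cmod c)) by (apply Rdiv_lt_0_compat; lra). lra.
Qed.

Lemma cvgc_const c : cvgc (fun _ => c) c.
Proof. intros eps He. exists 0%nat. intros n _. replace (Cminus c c) with (RtoC 0) by ring. rewrite Cmod_0. lra. Qed.

Lemma cvgc_minus u v l m : cvgc u l -> cvgc v m -> cvgc (fun n => Cminus (u n) (v n)) (Cminus l m).
Proof.
  intros Hu Hv. pose proof (cvgc_plus _ _ _ _ Hu (cvgc_scal (RtoC (-1)) _ _ Hv)) as H.
  intros eps He. destruct (H eps He) as [N HN]. exists N. intros n Hn. specialize (HN n Hn).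
  replace (Cminus (Cminus (u n) (v n)) (Cminus l m)) with
    (Cminus (Cplus (u n) (Cmult (RtoC (-1)) (v n))) (Cplus l (Cmult (RtoC (-1)) m))); auto.
  replace (RtoC (-1)) with (Copp (RtoC 1)) by (rewrite <- RtoC_opp; f_equal; lra). ring.
Qed.

Lemma cvgc_csum {A} (l : list A) (u : A -> nat -> C) (m : A -> C) :
  (forall x, cvgc (u x) (m x)) -> cvgc (fun n => csum l (fun x => u x n)) (csum l m).
Proof.
  intros H. induction l as [|x l IH]; simpl; [apply cvgc_const|]. apply cvgc_plus; auto.
Qed.

Lemma cvgc_ext u v l : (forall n, u n = v n) -> cvgc u l -> cvgc v l.
Proof. intros H Hu eps He. destruct (Hu eps He) as [N HN]. exists N. intros n Hn. rewrite <- H; auto. Qed.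

Lemma cvgc_bound u l K N : (forall n, (N <= n)%nat -> Cmod (u n) <= K) -> cvgc u l -> Cmod l <= K.
Proof.
  intros H Hu. apply Rnot_lt_le. intros L.
  destruct (Hu ((Cmod l - K) / 2)) as [N' HN']; [lra|].
  specialize (H (N + N')%nat ltac:(lia)). specialize (HN' (N + N')%nat ltac:(lia)).
  pose proof (Cmod_triangle (Cminus l (u (N + N')%nat)) (u (N + N')%nat)) as T.
  rewrite Cmod_minus_sym in HN'.
  replace (Cplus (Cminus l (u (N + N')%nat)) (u (N + N')%nat)) with l in T by ring. lra.
Qed.

Lemma cvgc_unique u l m : cvgc u l -> cvgc u m -> l = m.
Proof. intros H1 H2. rewrite <- (cvgc_Clim _ _ H1). apply cvgc_Clim; auto. Qed.

Lemma geom_telescope (u : nat -> C) A r : 0 <= r < 1 -> 0 <= A ->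
  (forall n, Cmod (Cminus (u (S n)) (u n)) <= A * r ^ n) ->
  forall n p, Cmod (Cminus (u (n + p)%nat) (u n)) <= A * r ^ n / (1 - r).
Proof.
  intros Hr HA H n p.
  assert (E : Cmod (Cminus (u (n + p)%nat) (u n)) <= A * r ^ n * ((1 - r ^ p) / (1 - r))).
  { induction p.
    - rewrite Nat.add_0_r. replace (Cminus (u n) (u n)) with (RtoC 0) by ring.
      rewrite Cmod_0. simpl. right; field; lra.
    - rewrite Nat.add_succ_r.
      replace (Cminus _ _) with
        (Cplus (Cminus (u (S (n + p))) (u (n + p)%nat)) (Cminus (u (n + p)%nat) (u n))) by ring.
      eapply Rle_trans; [apply Cmod_triangle|]. specialize (H (n + p)%nat).
      rewrite pow_add in H.
      replace (A * r ^ n * ((1 - r ^ S p) / (1 - r))) with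
        (A * (r ^ n * r ^ p) + A * r ^ n * ((1 - r ^ p) / (1 - r))) by (simpl; field; lra).
      lra. }
  eapply Rle_trans; [exact E|].
  assert (0 <= r ^ n) by (apply pow_le; lra). assert (0 <= r ^ p) by (apply pow_le; lra).
  unfold Rdiv. rewrite <- !Rmult_assoc.
  apply Rmult_le_compat_r; [left; apply Rinv_0_lt_compat; lra|].
  assert (0 <= A * r ^ n) by (apply Rmult_le_pos; lra). nra.
Qed.

Lemma R_cauchy_geom (u : nat -> R) A r : 0 <= r < 1 -> 0 <= A ->
  (forall n p, Rabs (u (n + p)%nat - u n) <= A * r ^ n) -> exists l : R, is_lim_seq u l.
Proof.
  intros Hr HA H.
  assert (G : ex_finite_lim_seq u); [|destruct G as [l Hl]; exists l; auto].
  apply ex_lim_seq_cauchy_corr. intros eps.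
  assert (Lr : is_lim_seq (fun n => A * r ^ n) 0).
  { replace 0 with (A * 0) by ring. apply (is_lim_seq_scal_l _ A 0).
    apply is_lim_seq_geom. rewrite Rabs_pos_eq; lra. }
  apply is_lim_seq_spec in Lr. destruct (Lr (pos_div_2 eps)) as [N HN].
  specialize (HN N (le_n _)). rewrite Rminus_0_r in HN.
  rewrite Rabs_pos_eq in HN by (apply Rmult_le_pos; [auto|apply pow_le; lra]). simpl in HN.
  exists N. intros n m Hn Hm.
  pose proof (H N (n - N)%nat) as H1. pose proof (H N (m - N)%nat) as H2.
  replace (N + (n - N))%nat with n in H1 by lia. replace (N + (m - N))%nat with m in H2 by lia.
  replace (u n - u m) with ((u n - u N) + - (u m - u N)) by ring.
  eapply Rle_lt_trans; [apply Rabs_triang|]. rewrite Rabs_Ropp. lra.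
Qed.

Lemma cvgc_of_components u a b :
  is_lim_seq (fun n => fst (u n)) (Finite a) -> is_lim_seq (fun n => snd (u n)) (Finite b) -> cvgc u (a, b).
Proof.
  intros Ha Hb eps He. apply is_lim_seq_spec in Ha, Hb.
  assert (He2 : 0 < eps / 2) by lra.
  destruct (Ha (mkposreal _ He2)) as [N HN]. destruct (Hb (mkposreal _ He2)) as [N' HN'].
  exists (N + N')%nat. intros n Hn. specialize (HN n ltac:(lia)). specialize (HN' n ltac:(lia)).
  simpl in *.
  eapply Rle_trans; [apply Cmod_2Rmax|]. simpl.
  change (fst (u n) + - a) with (fst (u n) - a). change (snd (u n) + - b) with (snd (u n) - b).
  assert (M : Rmax (Rabs (fst (u n) - a)) (Rabs (snd (u n) - b)) <= eps / 2) by (apply Rmax_lub; lra).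
  assert (0 <= Rmax (Rabs (fst (u n) - a)) (Rabs (snd (u n) - b)))
    by (eapply Rle_trans; [apply Rabs_pos|apply Rmax_l]).
  assert (sqrt 2 <= 2).
  { rewrite <- (sqrt_square 2) at 2 by lra. apply sqrt_le_1_alt. lra. }
  nra.
Qed.

Lemma cvgc_geom (u : nat -> C) A r : 0 <= r < 1 -> 0 <= A ->
  (forall n, Cmod (Cminus (u (S n)) (u n)) <= A * r ^ n) ->
  cvgc u (Clim_seq u) /\ forall n, Cmod (Cminus (Clim_seq u) (u n)) <= A * r ^ n / (1 - r).
Proof.
  intros Hr HA H. pose proof (geom_telescope u A r Hr HA H) as T.
  assert (HA' : 0 <= A / (1 - r)) by (apply Rdiv_le_0_compat; lra).
  destruct (R_cauchy_geom (fun n => fst (u n)) (A / (1 - r)) r Hr HA') as [a Ha].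
  { intros n p. eapply Rle_trans; [|eapply Rle_trans; [apply (T n p)|right; field; lra]].
    exact (Rle_trans _ _ _ (Rmax_l _ _) (Rmax_Cmod (Cminus (u (n + p)%nat) (u n)))). }
  destruct (R_cauchy_geom (fun n => snd (u n)) (A / (1 - r)) r Hr HA') as [b Hb].
  { intros n p. eapply Rle_trans; [|eapply Rle_trans; [apply (T n p)|right; field; lra]].
    exact (Rle_trans _ _ _ (Rmax_r _ _) (Rmax_Cmod (Cminus (u (n + p)%nat) (u n)))). }
  pose proof (cvgc_of_components u a b Ha Hb) as L.
  rewrite (cvgc_Clim _ _ L). split; auto.
  intros n. apply (cvgc_bound (fun p => Cminus (u p) (u n)) _ _ n).
  - intros p Hp. replace p with (n + (p - n))%nat by lia. apply T.
  - apply cvgc_minus; auto. apply cvgc_const.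
Qed.

(** * Besov bounds *)

(** With the shift [j = n - 1], [wt a 0] is [Rpower 2 (- a)] instead of 1; this is the source of the
    stray powers of two in later constants. *)
Definition wt (a : R) (n : nat) : R := Rpower 2 (a * (INR n - 1)).

Lemma wt_pos a n : 0 < wt a n.
Proof. apply exp_pos. Qed.

Lemma wt_plus a b n : wt (a + b) n = wt a n * wt b n.
Proof. unfold wt. rewrite <- Rpower_plus. f_equal. ring. Qed.

Lemma wt_opp a n : wt (- a) n = / wt a n.
Proof. unfold wt. rewrite <- Rpower_Ropp. f_equal. ring. Qed.

Lemma Rpower2_mono x y : x <= y -> Rpower 2 x <= Rpower 2 y.
Proof. intros H. apply Rle_Rpower; lra. Qed.

Lemma Rpower_pos x y : 0 < Rpower x y.
Proof. apply exp_pos. Qed.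

Lemma wt_lower a n : 0 <= a -> Rpower 2 (- a) <= wt a n.
Proof. intros H. apply Rpower2_mono. pose proof (pos_INR n). nra. Qed.

Lemma besov_le_iff a f K :
  besov_le a f K <-> forall n x1 x2, Cmod (LP_block n f x1 x2) <= K * wt (- a) n.
Proof.
  assert (E : forall n X, wt a n * X <= K <-> X <= K * wt (- a) n).
  { intros n X. rewrite wt_opp. pose proof (wt_pos a n). rewrite Rmult_comm. apply Rle_div_r; auto. }
  unfold besov_le. split; intros H n x1 x2; apply E, H.
Qed.

Lemma besov_le_ge0 a f K : besov_le a f K -> 0 <= K.
Proof.
  intros H. eapply Rle_trans; [|apply (H 0%nat 0 0)].
  apply Rmult_le_pos; [left; apply Rpower_pos|apply Cmod_ge_0].
Qed.

Lemma besov_le_mono a f K K' : besov_le a f K -> K <= K' -> besov_le a f K'.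
Proof. intros H L n x1 x2. eapply Rle_trans; [apply H|auto]. Qed.

Lemma LP_block_scal n g c x1 x2 :
  LP_block n (dscal c g) x1 x2 = Cmult c (LP_block n g x1 x2).
Proof.
  rewrite !LP_block_ev. unfold ev. rewrite <- csum_scal.
  apply csum_ext; intros; unfold dscal; ring.
Qed.

Lemma LP_block_add n f g x1 x2 :
  LP_block n (dadd f g) x1 x2 = Cplus (LP_block n f x1 x2) (LP_block n g x1 x2).
Proof.
  rewrite !LP_block_ev. unfold ev. rewrite <- csum_plus.
  apply csum_ext; intros; unfold dadd; ring.
Qed.

Lemma LP_block_sub n f g x1 x2 :
  LP_block n (dsub f g) x1 x2 = Cminus (LP_block n f x1 x2) (LP_block n g x1 x2).
Proof.
  rewrite !LP_block_ev. unfold ev. rewrite <- csum_minus.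
  apply csum_ext; intros; unfold dsub; ring.
Qed.

Lemma besov_add a f g K L : besov_le a f K -> besov_le a g L -> besov_le a (dadd f g) (K + L).
Proof.
  rewrite !besov_le_iff. intros Hf Hg n x1 x2. rewrite LP_block_add.
  eapply Rle_trans; [apply Cmod_triangle|]. rewrite Rmult_plus_distr_r.
  apply Rplus_le_compat; auto.
Qed.

Lemma besov_scal a c f K : besov_le a f K -> besov_le a (dscal c f) (Cmod c * K).
Proof.
  rewrite !besov_le_iff. intros Hf n x1 x2. rewrite LP_block_scal, Cmod_mult, Rmult_assoc.
  apply Rmult_le_compat_l; [apply Cmod_ge_0|auto].
Qed.

Lemma besov_sub a f g K L : besov_le a f K -> besov_le a g L -> besov_le a (dsub f g) (K + L).
Proof.
  rewrite !besov_le_iff. intros Hf Hg n x1 x2. rewrite LP_block_sub.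
  unfold Cminus. eapply Rle_trans; [apply Cmod_triangle|]. rewrite Cmod_opp, Rmult_plus_distr_r.
  apply Rplus_le_compat; auto.
Qed.

(** The factor comes from the block [j = -1] alone, the only one where the weight of larger exponent
    is the smaller one. *)
Lemma besov_embed a b f K : b <= a -> besov_le a f K -> besov_le b f (Rpower 2 (a - b) * K).
Proof.
  intros L H. pose proof (besov_le_ge0 _ _ _ H) as P. rewrite besov_le_iff in *. intros n x1 x2.
  eapply Rle_trans; [apply H|].
  replace (- b) with ((a - b) + - a) by ring. rewrite wt_plus.
  pose proof (wt_lower (a - b) n ltac:(lra)) as W. pose proof (wt_pos (- a) n).
  rewrite Rpower_Ropp in W. pose proof (Rpower_pos 2 (a - b)) as Q.
  assert (1 <= Rpower 2 (a - b) * wt (a - b) n).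
  { rewrite <- (Rinv_r (Rpower 2 (a - b))) by lra. apply Rmult_le_compat_l; lra. }
  replace (Rpower 2 (a - b) * K * (wt (a - b) n * wt (- a) n)) with
    (Rpower 2 (a - b) * wt (a - b) n * (K * wt (- a) n)) by ring.
  rewrite <- (Rmult_1_l (K * wt (- a) n)) at 1. apply Rmult_le_compat_r; [nra|auto].
Qed.

(** The symbols are radial and the boxes symmetric, so reflecting the frequencies changes
    neither. *)
Lemma LP_block_conj n f x1 x2 : LP_block n (dconj f) x1 x2 = Cconj (LP_block n f x1 x2).
Proof.
  rewrite !LP_block_ev. unfold ev. rewrite csum_conj.
  transitivity (csum (map zopp (box (2 ^ (n + 1)))) (fun k => Cmult (Cmult (rho_sym n k) (dconj f k)) (fourier_char k x1 x2))).
  - apply (csum_support zz_dec); auto using NoDup_box.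
    + apply FinFun.Injective_map_NoDup; auto using NoDup_box.
      intros [a b] [c d]; unfold zopp; simpl. intros E; injection E; intros; f_equal; lia.
    + intros k H1 H2. exfalso. apply H2, in_map_iff. exists (zopp k). split.
      * destruct k; unfold zopp; simpl. f_equal; lia.
      * rewrite in_box in *. unfold zopp; simpl. lia.
    + intros k H1 H2. exfalso. apply H2. apply in_map_iff in H1 as [l [<- H1]].
      rewrite in_box in *. unfold zopp; simpl. lia.
  - rewrite csum_map. apply csum_ext. intros k _.
    rewrite !Cmult_conj, fourier_char_zopp. f_equal. f_equal.
    + unfold rho_sym. rewrite knorm_zopp. apply injective_projections; simpl; ring.
    + unfold dconj. f_equal. f_equal. destruct k; unfold zopp; simpl. f_equal; lia.
Qed.

Lemma besov_conj a f K : besov_le a f K -> besov_le a (dconj f) K.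
Proof.
  rewrite !besov_le_iff. intros H n x1 x2. rewrite LP_block_conj, Cmod_conj. auto.
Qed.

Lemma dconj_dsub f g : dconj (dsub f g) = dsub (dconj f) (dconj g).
Proof. apply functional_extensionality. intros k. apply Cminus_conj. Qed.

Lemma done_eq k : done k = if zz_dec k (0, 0)%Z then RtoC 1 else RtoC 0.
Proof.
  unfold done. destruct k as [a b]. cbn [fst snd].
  destruct (Z.eqb_spec a 0) as [->|Na]; [destruct (Z.eqb_spec b 0) as [->|Nb]|];
    cbn [andb]; destruct (zz_dec _ _) as [E|E]; try reflexivity; exfalso; try (apply E; reflexivity);
    injection E; intros; contradiction.
Qed.

Lemma besov_done a : besov_le a done (Rpower 2 (- a)).
Proof.
  rewrite besov_le_iff. intros n x1 x2. rewrite LP_block_ev. unfold ev.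
  assert (N0 : knorm (0, 0)%Z = 0).
  { unfold knorm; simpl. replace (0 * (0 * 1) + 0 * (0 * 1)) with 0 by ring. apply sqrt_0. }
  rewrite (csum_single zz_dec _ (0, 0)%Z); auto using NoDup_box.
  - rewrite done_eq. destruct (zz_dec _ _) as [_|]; [|congruence].
    rewrite !Cmod_mult, Cmod_fourier_char, Cmod_1, !Rmult_1_r. unfold rho_sym. rewrite N0, Cmod_R.
    destruct n.
    + unfold wt. rewrite <- Rpower_plus. simpl.
      replace (- a + - a * (0 - 1)) with 0 by ring. rewrite Rpower_O by lra. apply (rhoj_abs 0).
    + rewrite rhoj_low by (left; apply two_pow_pos). rewrite Rabs_R0.
      apply Rmult_le_pos; [left; apply Rpower_pos|left; apply wt_pos].
  - rewrite in_box; simpl; lia.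
  - intros k _ Hk. rewrite done_eq. destruct (zz_dec _ _); [contradiction|]. ring.
Qed.

Lemma besov_zero a : besov_le a dzero 0.
Proof.
  rewrite besov_le_iff. intros n x1 x2. rewrite LP_block_ev. unfold ev.
  rewrite csum_zero; [rewrite Cmod_0; lra|]. intros; unfold dzero; ring.
Qed.

(** Averaging against a character over a grid of [2 M + 1] points per side isolates [h k] exactly;
    this average plays the role of the integral over the torus. *)
Lemma ev_coef M h S k :
  In k (box M) -> (forall x1 x2, Cmod (ev M h x1 x2) <= S) -> Cmod (h k) <= S.
Proof.
  intros Hk HS. set (Q := (2 * M + 1)%nat).
  assert (HQ : INR Q ^ 2 <> 0) by (apply pow_nonzero, not_0_INR; lia).
  assert (E : csum (grid Q) (fun p => Cmult (ev M h (gx Q (fst p)) (gx Q (snd p)))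
     (fourier_char (zopp k) (gx Q (fst p)) (gx Q (snd p)))) = Cmult (h k) (RtoC (INR Q ^ 2))).
  { unfold ev.
    rewrite (csum_ext _ _ (fun p => csum (box M) (fun l => Cmult (h l)
      (fourier_char (zadd l (zopp k)) (gx Q (fst p)) (gx Q (snd p)))))).
    2:{ intros p _. rewrite <- csum_scal_r. apply csum_ext. intros l _. rewrite fourier_char_zadd. ring. }
    rewrite csum_swap. rewrite (csum_single zz_dec _ k); auto using NoDup_box.
    - rewrite csum_scal, grid_orth by (unfold zadd, zopp; simpl; lia).
      destruct (zz_dec _ _) as [_|N]; [auto|]. exfalso; apply N, (proj2 (zsub_0_iff _ _)); reflexivity.
    - intros l Hl Hn. rewrite csum_scal, grid_orth; try (rewrite in_box in *; unfold zadd, zopp; simpl; lia).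
      destruct (zz_dec _ _) as [E|_]; [|ring]. apply (proj1 (zsub_0_iff _ _)) in E. exfalso; auto. }
  apply (f_equal Cmod) in E. rewrite Cmod_mult, Cmod_R, Rabs_pos_eq in E by apply pow2_ge_0.
  assert (B : Cmod (h k) * INR Q ^ 2 <= INR Q ^ 2 * S).
  { rewrite <- E. eapply Rle_trans; [apply Cmod_csum|].
    eapply Rle_trans; [apply (rsum_le_const _ _ S)|].
    - intros p _. rewrite Cmod_mult, Cmod_fourier_char, Rmult_1_r. apply HS.
    - unfold grid. rewrite length_prod, length_seq, mult_INR. simpl. lra. }
  pose proof (pow2_ge_0 (INR Q)). apply (Rmult_le_reg_r (INR Q ^ 2)); lra.
Qed.

(** A level from which on the cutoff equals 1 at [k], so that the blocks up to it recover the
    coefficient. *)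
Definition coef_level (k : Z * Z) : nat := Z.to_nat (Z.abs (fst k) + Z.abs (snd k)).

Lemma coef_level_spec k N : (coef_level k <= N)%nat -> knorm k <= 2 ^ N.
Proof.
  intros HN.
  assert (H : knorm k <= INR N).
  { eapply Rle_trans; [|apply le_INR, HN]. unfold coef_level.
    rewrite INR_IZR_INZ, Z2Nat.id, plus_IZR, !abs_IZR by lia.
    unfold knorm. pose proof (Rabs_pos (IZR (fst k))). pose proof (Rabs_pos (IZR (snd k))).
    rewrite <- (sqrt_square (Rabs (IZR (fst k)) + Rabs (IZR (snd k)))) by lra.
    apply sqrt_le_1_alt. rewrite <- (pow2_abs (IZR (fst k))), <- (pow2_abs (IZR (snd k))). nra. }
  eapply Rle_trans; [exact H|]. rewrite <- INR_pow2. apply le_INR.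
  clear. induction N; simpl; [lia|]. pose proof (two_pow_ge1 N). lia.
Qed.

Lemma coef_decomp f k N : (coef_level k <= N)%nat ->
  f k = csum (seq 0 (S N)) (fun n => Cmult (rho_sym n k) (f k)).
Proof.
  intros HN. rewrite csum_scal_r. unfold rho_sym.
  rewrite (csum_RtoC _ (fun n => rhoj n (knorm k))), sum_rhoj, chiN_1 by (apply coef_level_spec; auto). ring.
Qed.

Lemma LP_block_coef n f S k :
  (forall x1 x2, Cmod (LP_block n f x1 x2) <= S) -> Cmod (Cmult (rho_sym n k) (f k)) <= S.
Proof.
  intros H. destruct (in_dec zz_dec k (box (2 ^ (n + 1)))) as [I|I].
  - apply (ev_coef (2 ^ (n + 1)) (fun k => Cmult (rho_sym n k) (f k)) S k I).
    intros x1 x2. rewrite <- LP_block_ev. apply H.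
  - rewrite rho_sym_supp, Cmult_0_l, Cmod_0 by auto.
    eapply Rle_trans; [apply Cmod_ge_0|apply (H 0 0)].
Qed.

(** Adds up the bounds of the blocks that recover coefficient [k]. It may grow with [k]: it serves
    only statements about one coefficient at a time. *)
Definition coefC (a : R) (k : Z * Z) : R := rsum (seq 0 (S (coef_level k))) (fun n => wt (- a) n).

Lemma coefC_pos a k : 0 < coefC a k.
Proof.
  unfold coefC. cbn [seq rsum].
  pose proof (wt_pos (- a) 0). pose proof (rsum_ge0 (seq 1 (coef_level k)) (fun n => wt (- a) n)) as H1.
  assert (0 <= rsum (seq 1 (coef_level k)) (fun n => wt (- a) n)); [|lra].
  apply H1. intros; left; apply wt_pos.
Qed.

Lemma besov_coef a f K k : besov_le a f K -> Cmod (f k) <= K * coefC a k.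
Proof.
  rewrite besov_le_iff. intros H. rewrite (coef_decomp f k _ (le_n _)).
  eapply Rle_trans; [apply Cmod_csum|]. unfold coefC. rewrite <- rsum_scal.
  apply rsum_le. intros n _. apply LP_block_coef. auto.
Qed.

(** Turns arbitrarily small Besov distance into equality; the fixed-point equation and uniqueness
    both end here. *)
Lemma besov_eq0 a f : (forall eps, 0 < eps -> besov_le a f eps) -> forall k, f k = RtoC 0.
Proof.
  intros H k. apply Cmod_eq_0. apply Rle_antisym; [|apply Cmod_ge_0].
  apply Rnot_lt_le. intros L. pose proof (coefC_pos a k) as P.
  pose proof (besov_coef a f (Cmod (f k) / (2 * coefC a k)) k) as B.
  assert (Pe : 0 < Cmod (f k) / (2 * coefC a k)) by (apply Rdiv_lt_0_compat; lra).
  specialize (B (H _ Pe)).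
  replace (Cmod (f k) / (2 * coefC a k) * coefC a k) with (Cmod (f k) / 2) in B by (field; lra).
  lra.
Qed.

(** Fatou property: a block is a finite sum of coefficients, so a uniform bound survives
    coefficientwise convergence. *)
Lemma besov_lim a (f : nat -> Dist) (g : Dist) K N :
  (forall n, (N <= n)%nat -> besov_le a (f n) K) -> (forall k, cvgc (fun n => f n k) (g k)) ->
  besov_le a g K.
Proof.
  intros H L. rewrite besov_le_iff. intros q x1 x2.
  apply (cvgc_bound (fun n => LP_block q (f n) x1 x2) _ _ N).
  - intros n Hn. specialize (H n Hn). rewrite besov_le_iff in H. apply H.
  - rewrite LP_block_ev. unfold ev.
    eapply cvgc_ext; [intros n; symmetry; rewrite LP_block_ev; reflexivity|].
    unfold ev. apply (cvgc_csum _ (fun k n => Cmult (Cmult (rho_sym q k) (f n k)) (fourier_char k x1 x2))).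
    intros k. eapply cvgc_ext.
    2:{ replace (Cmult (Cmult (rho_sym q k) (g k)) (fourier_char k x1 x2)) with
       (Cmult (Cmult (rho_sym q k) (fourier_char k x1 x2)) (g k)) by ring. apply cvgc_scal, L. }
    intros n. simpl. ring.
Qed.

(** How the logarithms are paid for: an arbitrarily small power of the frequency dominates the
    polynomial factor. *)
Lemma poly_le_wt eps : 0 < eps -> exists D, 0 < D /\ forall n, (INR n + 2) ^ 2 <= D * wt eps n.
Proof.
  intros He. set (c := eps * ln 2 / 2).
  assert (Hl : 0 < ln 2) by (rewrite <- ln_1; apply ln_increasing; lra).
  assert (Hc : 0 < c) by (unfold c; nra).
  assert (Hi : 0 < / c) by (apply Rinv_0_lt_compat; auto).
  exists ((2 + / c) ^ 2 * Rpower 2 eps). split.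
  - apply Rmult_lt_0_compat; [apply pow_lt; lra|apply Rpower_pos].
  - intros n. unfold wt. rewrite Rmult_assoc, <- Rpower_plus.
    replace (eps + eps * (INR n - 1)) with (eps * INR n) by ring.
    pose proof (pos_INR n) as P.
    assert (E : Rpower 2 (eps * INR n) = exp (c * INR n) ^ 2).
    { unfold Rpower. simpl. rewrite Rmult_1_r, <- exp_plus. f_equal. unfold c. field. }
    rewrite E, <- Rpow_mult_distr. apply pow_incr. split; [lra|].
    pose proof (exp_ineq1_le (c * INR n)) as X.
    assert (0 <= c * INR n) by nra.
    apply Rle_trans with ((2 + / c) * (1 + c * INR n)).
    + replace ((2 + / c) * (1 + c * INR n)) with (2 + / c + 2 * (c * INR n) + INR n) by (field; lra). lra.
    + apply Rmult_le_compat_l; lra.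
Qed.

Ltac nonneg :=
  lazymatch goal with
  | |- 0 <= _ * _ => apply Rmult_le_pos; nonneg
  | |- 0 <= Rpower _ _ => left; apply Rpower_pos
  | |- 0 <= wt _ _ => left; apply wt_pos
  | |- 0 <= _ ^ 2 => apply pow2_ge_0
  | |- 0 <= Cmod _ => apply Cmod_ge_0
  | |- _ => first [assumption | lra | auto]
  end.

Ltac posit :=
  lazymatch goal with
  | |- 0 < _ * _ => apply Rmult_lt_0_compat; posit
  | |- 0 < _ + _ => apply Rplus_lt_0_compat; posit
  | |- 0 < Rpower _ _ => apply Rpower_pos
  | |- 0 < wt _ _ => apply wt_pos
  | |- _ => first [assumption | lra | auto]
  end.

(** * Products of distributions *)

Definition conv (M : nat) (f g : Dist) : Dist :=
  fun k => csum (box M) (fun l => Cmult (f l) (g (zsub k l))).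

Lemma conv_supp M M' f g : supp_in M' g -> supp_in (M + M') (conv M f g).
Proof.
  intros Hg k Hk. apply csum_zero. intros l Hl. rewrite Hg; [ring|].
  intros I. apply Hk. rewrite in_box in *. unfold zsub in I; simpl in I. lia.
Qed.

Lemma conv_widen M M' f g k : supp_in M f -> (M <= M')%nat -> conv M' f g k = conv M f g k.
Proof. intros Hf L. apply csum_box_ext; auto. intros l Hl. rewrite Hf by auto. ring. Qed.

Lemma ev_conv M M' f g x1 x2 : supp_in M' g ->
  ev (M + M') (conv M f g) x1 x2 = Cmult (ev M f x1 x2) (ev M' g x1 x2).
Proof.
  intros Hg. unfold ev, conv.
  rewrite (csum_ext _ _ (fun k => csum (box M) (fun l => Cmult (Cmult (f l) (fourier_char l x1 x2))
     (Cmult (g (zsub k l)) (fourier_char (zsub k l) x1 x2))))).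
  2:{ intros k _. rewrite <- csum_scal_r. apply csum_ext. intros l _.
      replace k with (zadd l (zsub k l)) at 2
        by (destruct k, l; unfold zadd, zsub; simpl; f_equal; lia).
      rewrite fourier_char_zadd. ring. }
  rewrite csum_swap, <- csum_scal_r. apply csum_ext. intros l Hl. rewrite csum_scal. f_equal.
  rewrite <- (csum_map (fun k => zsub k l) (box (M + M')) (fun j => Cmult (g j) (fourier_char j x1 x2))).
  apply (csum_support zz_dec); auto using NoDup_box.
  - apply FinFun.Injective_map_NoDup; auto using NoDup_box.
    intros [a1 a2] [b1 b2]; unfold zsub; simpl. intros E; injection E; intros; f_equal; lia.
  - intros j _ Hj. rewrite Hg by auto. ring.
  - intros j Hj Hn. exfalso. apply Hn, in_map_iff. exists (zadd j l). split.
    + destruct j, l; unfold zadd, zsub; simpl. f_equal; lia.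
    + rewrite in_box in *. unfold zadd; simpl. lia.
Qed.

Definition Crho : R := 54 * (6 * Lh).

Lemma Crho_pos : 0 < Crho.
Proof. unfold Crho. pose proof Lh_ge1. lra. Qed.

(** The analytic input for products: sup norms multiply, and localising the result to block [q]
    costs the multiplier bound. *)
Lemma LP_conv_bound q M M' f g A B : supp_in M' g ->
  (forall x1 x2, Cmod (ev M f x1 x2) <= A) -> (forall x1 x2, Cmod (ev M' g x1 x2) <= B) ->
  forall x1 x2, Cmod (LP_block q (conv M f g) x1 x2) <= Crho * (INR q + 2) ^ 2 * (A * B).
Proof.
  intros Hg HA HB x1 x2.
  rewrite (LP_block_ev_big q (2 ^ (q + 1) + (M + M'))) by lia.
  apply rho_sym_multiplier. intros y1 y2.
  rewrite (ev_ext_supp (M + M')) by (try apply conv_supp; auto; lia).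
  rewrite ev_conv, Cmod_mult by auto. apply Rmult_le_compat; auto using Cmod_ge_0.
Qed.

Definition Scut (N : nat) (f : Dist) : Dist := fun k => Cmult (RtoC (chiN N (knorm k))) (f k).
Definition dblock (n : nat) (f : Dist) : Dist := fun k => Cmult (rho_sym n k) (f k).

Lemma dblock_supp n f : supp_in (2 ^ (n + 1)) (dblock n f).
Proof. intros k Hk. unfold dblock. rewrite rho_sym_supp by auto. ring. Qed.

Lemma Scut_supp N f : supp_in (2 ^ (N + 1)) (Scut N f).
Proof.
  intros k Hk. unfold Scut. rewrite chiN_0; [ring|].
  apply Rnot_lt_le. intros L. apply Hk, knorm_in_box.
  rewrite INR_pow2, pow_add, pow_1. pose proof (two_pow_pos N). lra.
Qed.

Lemma Scut_S N f k : Scut (S N) f k = Cplus (Scut N f k) (dblock (S N) f k).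
Proof. unfold Scut, dblock, rho_sym. rewrite rhoj_S, RtoC_minus. ring. Qed.

Lemma Scut_sum N f k : Scut N f k = csum (seq 0 (S N)) (fun n => dblock n f k).
Proof.
  unfold dblock. rewrite csum_scal_r. unfold rho_sym.
  rewrite (csum_RtoC _ (fun n => rhoj n (knorm k))), sum_rhoj. reflexivity.
Qed.

Lemma ev_dblock n f M x1 x2 : (2 ^ (n + 1) <= M)%nat -> ev M (dblock n f) x1 x2 = LP_block n f x1 x2.
Proof. intros H. symmetry. apply LP_block_ev_big; auto. Qed.

Lemma pow2_le_mono n m : (n <= m)%nat -> (2 ^ n <= 2 ^ m)%nat.
Proof. intros. apply Nat.pow_le_mono_r; lia. Qed.

Lemma Scut_bound a f K N x1 x2 : besov_le a f K ->
  Cmod (ev (2 ^ (N + 1)) (Scut N f) x1 x2) <= K * rsum (seq 0 (S N)) (fun n => wt (- a) n).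
Proof.
  intros H. rewrite besov_le_iff in H.
  assert (E : ev (2 ^ (N + 1)) (Scut N f) x1 x2 = csum (seq 0 (S N)) (fun n => LP_block n f x1 x2)).
  { unfold ev. rewrite (csum_ext _ _ (fun k => csum (seq 0 (S N)) (fun n =>
      Cmult (dblock n f k) (fourier_char k x1 x2)))).
    2:{ intros k _. rewrite Scut_sum, csum_scal_r. reflexivity. }
    rewrite csum_swap. apply csum_ext. intros n Hn. apply in_seq in Hn.
    apply ev_dblock. apply pow2_le_mono. lia. }
  rewrite E. eapply Rle_trans; [apply Cmod_csum|]. rewrite <- rsum_scal. apply rsum_le. intros; apply H.
Qed.

Definition Gc (k : R) : R := / (1 - Rpower 2 (- k)).

Lemma Gc_pos k : 0 < k -> 0 < Gc k /\ Rpower 2 (- k) < 1.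
Proof.
  intros H. assert (Rpower 2 (- k) < 1).
  { rewrite <- (Rpower_O 2) by lra. apply Rpower_lt; lra. }
  split; auto. apply Rinv_0_lt_compat. lra.
Qed.

Lemma wt_S a n : wt a (S n) = Rpower 2 a * wt a n.
Proof. unfold wt. rewrite <- Rpower_plus, S_INR. f_equal. ring. Qed.

Lemma sum_wt_up k N : 0 < k -> rsum (seq 0 (S N)) (fun n => wt k n) <= Gc k * wt k N.
Proof.
  intros Hk. destruct (Gc_pos k Hk) as [G1 G2].
  assert (E : Gc k * (1 - Rpower 2 (- k)) = 1) by (unfold Gc; apply Rinv_l; lra).
  pose proof (Rpower_pos 2 (- k)).
  induction N.
  - simpl. pose proof (wt_pos k 0). nra.
  - rewrite seq_S, rsum_app. cbn [rsum Nat.add].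
    assert (E2 : wt k N = Rpower 2 (- k) * wt k (S N)).
    { rewrite wt_S, <- Rmult_assoc, <- Rpower_plus, Rplus_opp_l, Rpower_O by lra. ring. }
    pose proof (wt_pos k (S N)). rewrite E2 in IHN. nra.
Qed.

Lemma sum_wt_down k a p : 0 < k -> rsum (seq a p) (fun n => wt (- k) n) <= Gc k * wt (- k) a.
Proof.
  intros Hk. destruct (Gc_pos k Hk) as [G1 G2].
  assert (E : Gc k * (1 - Rpower 2 (- k)) = 1) by (unfold Gc; apply Rinv_l; lra).
  revert a.
  induction p; intros a; cbn [seq rsum].
  - apply Rmult_le_pos; [lra|left; apply wt_pos].
  - specialize (IHp (S a)). rewrite wt_S in IHp. pose proof (wt_pos (- k) a). nra.
Qed.

Definition prod_trunc (f g : Dist) (N : nat) : Dist := conv (2 ^ (N + 1)) (Scut N f) (Scut N g).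

Lemma dmul_eq f g k : dmul f g k = Clim_seq (fun N => prod_trunc f g N k).
Proof. unfold dmul. f_equal. apply functional_extensionality. intros N. apply box_sum_csum. Qed.

(** Discrete product rule for [S_{N+1} f S_{N+1} g - S_N f S_N g]: in the first increment the new
    block falls on [f], in the second on [g]. Summing these increments takes the place of the
    paraproduct decomposition. *)
Definition prod_step1 f g N := conv (2 ^ (S N + 1)) (dblock (S N) f) (Scut (S N) g).
Definition prod_step2 f g N := conv (2 ^ (N + 1)) (Scut N f) (dblock (S N) g).

Lemma prod_trunc_step f g N k :
  prod_trunc f g (S N) k = Cplus (prod_trunc f g N k) (Cplus (prod_step1 f g N k) (prod_step2 f g N k)).
Proof.
  unfold prod_step2.
  assert (L : (2 ^ (N + 1) <= 2 ^ (S N + 1))%nat) by (apply pow2_le_mono; lia).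
  rewrite <- (conv_widen _ _ (Scut N f) (dblock (S N) g) k (Scut_supp N f) L).
  unfold prod_trunc, prod_step1. rewrite <- (conv_widen _ _ (Scut N f) (Scut N g) k (Scut_supp N f) L).
  unfold conv. rewrite <- !csum_plus. apply csum_ext. intros l _. rewrite !Scut_S. ring.
Qed.

Lemma prod_trunc_low f g N k : 4 / 3 * 2 ^ (N + 1) <= knorm k -> prod_trunc f g N k = RtoC 0.
Proof.
  intros H. apply csum_zero. intros l _. unfold Scut.
  destruct (Rle_dec (4 / 3 * 2 ^ N) (knorm l)) as [L|L].
  - rewrite chiN_0 by auto. ring.
  - rewrite (chiN_0 N (knorm (zsub k l))); [ring|].
    pose proof (knorm_zadd l (zsub k l)) as T.
    replace (zadd l (zsub k l)) with k in T by (destruct k, l; unfold zadd, zsub; simpl; f_equal; lia).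
    rewrite pow_add, pow_1 in H. lra.
Qed.

(** Frequencies add: the truncated product lives below [4/3 * 2 ^ (N + 1)], hence below
    [2 ^ (N + 2)], while block [q] starts at [2 ^ (q - 1)]. *)
Lemma LP_prod_trunc_low f g N q x1 x2 : (N + 3 <= q)%nat -> LP_block q (prod_trunc f g N) x1 x2 = RtoC 0.
Proof.
  intros H. rewrite LP_block_ev. apply csum_zero. intros k _.
  destruct (Rle_dec (4 / 3 * 2 ^ (N + 1)) (knorm k)) as [L|L].
  - rewrite prod_trunc_low by auto. ring.
  - destruct q as [|q]; [lia|].
    unfold rho_sym. rewrite rhoj_low; [ring|].
    assert (2 ^ (N + 2) <= 2 ^ q) by (apply Rle_pow; [lra|lia]).
    replace (N + 2)%nat with (S (N + 1)) in H0 by lia. simpl in H0. pose proof (two_pow_pos (N + 1)). lra.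
Qed.

(* For [k] in the q-th annulus and [l] low-frequency, [k - l] is too small to meet the (N+1)-st
   block of [g] when [N >= q + 3]. *)
Lemma rho_prod_step2_high f g N q k : (q + 3 <= N)%nat ->
  Cmult (rho_sym q k) (prod_step2 f g N k) =
  Cmult (rho_sym q k) (conv (2 ^ (N + 1)) (dblock N f) (dblock (S N) g) k).
Proof.
  intros H. destruct (Rle_dec (4 / 3 * 2 ^ q) (knorm k)) as [L|L].
  - unfold rho_sym. rewrite rhoj_high by auto. ring.
  - f_equal. apply csum_ext. intros l _.
    destruct (Rle_dec (knorm (zsub k l)) (2 ^ N)) as [L2|L2].
    + unfold dblock at 1 3, rho_sym. rewrite rhoj_low by auto. ring.
    + f_equal. destruct N as [|N]; [lia|]. rewrite Scut_S.
      unfold Scut at 1. rewrite chiN_0; [ring|].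
      pose proof (knorm_zadd k (zopp l)) as T. rewrite knorm_zopp in T.
      replace (zadd k (zopp l)) with (zsub k l) in T
        by (destruct k, l; unfold zadd, zopp, zsub; simpl; f_equal; lia).
      assert (P : 2 ^ (q + 2) <= 2 ^ N) by (apply Rle_pow; [lra|lia]).
      rewrite pow_add in P. simpl in P, L2. pose proof (two_pow_pos q). lra.
Qed.

Lemma LP_prod_step2_high f g N q x1 x2 : (q + 3 <= N)%nat ->
  LP_block q (prod_step2 f g N) x1 x2 =
  LP_block q (conv (2 ^ (N + 1)) (dblock N f) (dblock (S N) g)) x1 x2.
Proof.
  intros H. rewrite !LP_block_ev. apply csum_ext. intros k _. rewrite rho_prod_step2_high; auto.
Qed.

Lemma wt_le_const a n m c : a * (INR n - INR m) <= c -> wt a n <= Rpower 2 c * wt a m.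
Proof.
  intros H. unfold wt. rewrite <- Rpower_plus. apply Rpower2_mono. lra.
Qed.

(** [b] is the regularity of the first factor and [s], possibly negative, that of the second. [eta]
    is the geometric rate at which the increments decay in [N]; [eta < b + s] is the resonance
    condition with room to spare. *)
Section ProductEstimate.
Variables (b s eta : R).
Hypotheses (He : 0 < eta) (Hse : s <= eta) (Hb : eta < b) (Hbs : eta < b + s).

Let kap := b - eta.

(** The partial sums of [g] grow at most like [2 ^ (kap N)] because [- s < kap], and
    [kap - b = - eta] leaves the decay. The factor [wt (eta - s) q], bounded below since [s <= eta],
    is inserted to match the second increment. *)
Lemma prod_step1_bound f g K1 K2 N q x1 x2 : besov_le b f K1 -> besov_le s g K2 ->
  Cmod (LP_block q (prod_step1 f g N) x1 x2) <=
  Rpower 2 (kap + s) * Gc kap * Rpower 2 (eta - s) * Rpower 2 (- eta) * Crho *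
    (K1 * K2) * ((INR q + 2) ^ 2 * (wt (eta - s) q * wt (- eta) N)).
Proof.
  intros Hf Hg. assert (Hk : 0 < kap) by (unfold kap; lra).
  pose proof (besov_le_ge0 _ _ _ Hf) as P1. pose proof (besov_le_ge0 _ _ _ Hg) as P2.
  eapply Rle_trans.
  - eapply LP_conv_bound.
    + apply Scut_supp.
    + intros y1 y2. rewrite ev_dblock by lia. rewrite besov_le_iff in Hf. apply Hf.
    + intros y1 y2. apply Scut_bound. exact Hg.
  - assert (B : rsum (seq 0 (S (S N))) (fun n => wt (- s) n) <=
       Rpower 2 (kap + s) * Gc kap * wt kap (S N)).
    { apply Rle_trans with (rsum (seq 0 (S (S N))) (fun n => Rpower 2 (kap + s) * wt kap n)).
      - apply rsum_le. intros n _. unfold wt. rewrite <- Rpower_plus. apply Rpower2_mono.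
        pose proof (pos_INR n). unfold kap in *. nra.
      - rewrite rsum_scal, Rmult_assoc. apply Rmult_le_compat_l; [left; apply Rpower_pos|].
        apply sum_wt_up; auto. }
    assert (W : wt (- b) (S N) * wt kap (S N) = Rpower 2 (- eta) * wt (- eta) N).
    { rewrite <- wt_plus, <- wt_S. f_equal. unfold kap; ring. }
    assert (W2 : 1 <= Rpower 2 (eta - s) * wt (eta - s) q).
    { unfold wt. rewrite <- Rpower_plus, <- (Rpower_O 2) at 1 by lra. apply Rpower2_mono.
      pose proof (pos_INR q). nra. }
    pose proof (wt_pos (- b) (S N)).
    pose proof (Rpower_pos 2 (kap + s)). destruct (Gc_pos _ Hk) as [G _].
    pose proof Crho_pos. pose proof (pow2_ge_0 (INR q + 2)).
    set (c := Rpower 2 (kap + s) * Gc kap) in *.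
    assert (0 < c) by (apply Rmult_lt_0_compat; auto).
    apply Rle_trans with (Crho * (INR q + 2) ^ 2 * (K1 * K2 * (c * (Rpower 2 (- eta) * wt (- eta) N)))).
    + apply Rmult_le_compat_l; [apply Rmult_le_pos; lra|].
      rewrite <- W.
      replace (K1 * wt (- b) (S N) * (K2 * _)) with
        (K1 * K2 * (wt (- b) (S N) * rsum (seq 0 (S (S N))) (fun n => wt (- s) n))) by ring.
      apply Rmult_le_compat_l; [apply Rmult_le_pos; auto|].
      replace (c * (wt (- b) (S N) * wt kap (S N))) with (wt (- b) (S N) * (c * wt kap (S N))) by ring.
      apply Rmult_le_compat_l; lra.
    + replace (c * Rpower 2 (eta - s) * Rpower 2 (- eta) * Crho * (K1 * K2) *
       ((INR q + 2) ^ 2 * (wt (eta - s) q * wt (- eta) N))) with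
       (Crho * (INR q + 2) ^ 2 * (K1 * K2 * (c * (Rpower 2 (- eta) * wt (- eta) N))) *
        (Rpower 2 (eta - s) * wt (eta - s) q)) by ring.
      rewrite <- Rmult_1_r at 1. apply Rmult_le_compat_l; [|auto].
      nonneg.
Qed.

(** If [N >= q + 3] only the resonant part is left, both factors at frequency about [2 ^ N], and
    [eta < b + s] gives the decay. Otherwise the partial sums of [f] are bounded since [b > 0]; the
    size [2 ^ (- s N)] of the block of [g] is split into [2 ^ ((eta - s) N)] and [2 ^ (- eta N)],
    and [N < q + 3] turns the first factor into [wt (eta - s) q]. *)
Lemma prod_step2_bound f g K1 K2 N q x1 x2 : besov_le b f K1 -> besov_le s g K2 ->
  Cmod (LP_block q (prod_step2 f g N) x1 x2) <=
  (Rpower 2 (2 * (eta - s) - s) * (Gc b * Rpower 2 b) + Rpower 2 (b - s)) * Crho *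
    (K1 * K2) * ((INR q + 2) ^ 2 * (wt (eta - s) q * wt (- eta) N)).
Proof.
  intros Hf Hg. assert (Hb0 : 0 < b) by lra.
  pose proof (besov_le_ge0 _ _ _ Hf) as P1. pose proof (besov_le_ge0 _ _ _ Hg) as P2.
  destruct (Gc_pos b Hb0) as [G _].
  pose proof (Rpower_pos 2 (2 * (eta - s) - s)) as R1. pose proof (Rpower_pos 2 b) as R2.
  pose proof (Rpower_pos 2 (b - s)) as R3. pose proof Crho_pos as R4.
  pose proof (pow2_ge_0 (INR q + 2)) as W3.
  assert (HX : forall X c, 0 <= c -> c <= Rpower 2 (2 * (eta - s) - s) * (Gc b * Rpower 2 b) + Rpower 2 (b - s) ->
     X <= Crho * (INR q + 2) ^ 2 * (K1 * K2 * (c * (wt (eta - s) q * wt (- eta) N))) ->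
     X <= (Rpower 2 (2 * (eta - s) - s) * (Gc b * Rpower 2 b) + Rpower 2 (b - s)) * Crho *
    (K1 * K2) * ((INR q + 2) ^ 2 * (wt (eta - s) q * wt (- eta) N))).
  { intros X c Hc Hcl HX. eapply Rle_trans; [exact HX|].
    replace (Crho * (INR q + 2) ^ 2 * (K1 * K2 * (c * (wt (eta - s) q * wt (- eta) N)))) with
      (c * (Crho * (K1 * K2) * ((INR q + 2) ^ 2 * (wt (eta - s) q * wt (- eta) N)))) by ring.
    rewrite (Rmult_assoc _ Crho), (Rmult_assoc _ (Crho * (K1 * K2))).
    apply Rmult_le_compat_r; [|auto]. nonneg. }
  destruct (le_lt_dec (q + 3) N) as [L|L].
  - rewrite LP_prod_step2_high by auto. apply (HX _ (Rpower 2 (b - s))); [lra| |].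
    { rewrite <- (Rplus_0_l (Rpower 2 (b - s))) at 1. apply Rplus_le_compat_r. nonneg. }
    eapply Rle_trans.
    + apply (LP_conv_bound q (2 ^ (N + 1)) (2 ^ (S N + 1))).
      * apply dblock_supp.
      * intros y1 y2. rewrite ev_dblock by lia. rewrite besov_le_iff in Hf. apply Hf.
      * intros y1 y2. rewrite ev_dblock by lia. rewrite besov_le_iff in Hg. apply Hg.
    + apply Rmult_le_compat_l; [apply Rmult_le_pos; lra|].
      replace (K1 * wt (- b) N * (K2 * wt (- s) (S N))) with (K1 * K2 * (wt (- b) N * wt (- s) (S N))) by ring.
      apply Rmult_le_compat_l; [apply Rmult_le_pos; auto|].
      unfold wt. rewrite <- !Rpower_plus. apply Rpower2_mono.
      rewrite S_INR. pose proof (pos_INR q). pose proof (pos_INR N).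
      assert (eta * INR N <= (b + s) * INR N) by (apply Rmult_le_compat_r; lra).
      assert (0 <= (eta - s) * INR q) by (apply Rmult_le_pos; lra).
      lra.
  - apply (HX _ (Rpower 2 (2 * (eta - s) - s) * (Gc b * Rpower 2 b))).
    { apply Rmult_le_pos; [lra|apply Rmult_le_pos; lra]. }
    { lra. }
    eapply Rle_trans.
    + apply (LP_conv_bound q (2 ^ (N + 1)) (2 ^ (S N + 1))).
      * apply dblock_supp.
      * intros y1 y2. apply Scut_bound. exact Hf.
      * intros y1 y2. rewrite ev_dblock by lia. rewrite besov_le_iff in Hg. apply Hg.
    + apply Rmult_le_compat_l; [apply Rmult_le_pos; lra|].
      pose proof (sum_wt_down b 0 (S N) Hb0) as Sd.
      assert (E : wt (- b) 0 = Rpower 2 b) by (unfold wt; f_equal; simpl; ring).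
      rewrite E in Sd.
      assert (W : wt (- s) (S N) <= Rpower 2 (2 * (eta - s) - s) * (wt (eta - s) q * wt (- eta) N)).
      { unfold wt. rewrite <- !Rpower_plus. apply Rpower2_mono. rewrite S_INR.
        assert (INR N <= INR q + 2) by (change 2 with (INR 2); rewrite <- plus_INR; apply le_INR; lia).
        assert (0 <= (eta - s) * (INR q + 2 - INR N)) by (apply Rmult_le_pos; lra). lra. }
      set (sg := rsum (seq 0 (S N)) (fun n => wt (- b) n)) in *.
      assert (0 <= sg) by (apply rsum_ge0; intros; left; apply wt_pos).
      replace (K1 * sg * (K2 * wt (- s) (S N))) with (K1 * K2 * (sg * wt (- s) (S N))) by ring.
      apply Rmult_le_compat_l; [apply Rmult_le_pos; auto|].
      replace (Rpower 2 (2 * (eta - s) - s) * (Gc b * Rpower 2 b) * (wt (eta - s) q * wt (- eta) N)) with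
        (Gc b * Rpower 2 b * (Rpower 2 (2 * (eta - s) - s) * (wt (eta - s) q * wt (- eta) N))) by ring.
      apply Rmult_le_compat; auto. left; apply wt_pos.
Qed.

Definition step_const : R :=
  Rpower 2 (kap + s) * Gc kap * Rpower 2 (eta - s) * Rpower 2 (- eta) * Crho +
  (Rpower 2 (2 * (eta - s) - s) * (Gc b * Rpower 2 b) + Rpower 2 (b - s)) * Crho.

Lemma step_const_pos : 0 < step_const.
Proof.
  unfold step_const. destruct (Gc_pos b ltac:(lra)) as [G1 _].
  destruct (Gc_pos kap ltac:(unfold kap; lra)) as [G2 _]. pose proof Crho_pos.
  posit.
Qed.

(** The threshold [N + 4] is where the truncations at [N] and at [S N] both miss block [q]. *)
Lemma LP_prod_trunc_step f g K1 K2 N q x1 x2 : besov_le b f K1 -> besov_le s g K2 ->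
  Cmod (Cminus (LP_block q (prod_trunc f g (S N)) x1 x2) (LP_block q (prod_trunc f g N) x1 x2)) <=
  step_const * (K1 * K2) * ((INR q + 2) ^ 2 * wt (eta - s) q) * (if le_lt_dec (N + 4) q then 0 else wt (- eta) N).
Proof.
  intros Hf Hg. destruct (le_lt_dec (N + 4) q) as [L|L].
  - rewrite !LP_prod_trunc_low by lia. replace (Cminus (RtoC 0) (RtoC 0)) with (RtoC 0) by ring.
    rewrite Cmod_0. lra.
  - replace (prod_trunc f g (S N)) with
      (dadd (prod_trunc f g N) (dadd (prod_step1 f g N) (prod_step2 f g N)))
      by (apply functional_extensionality; intros k; symmetry; apply prod_trunc_step).
    rewrite !LP_block_add.
    replace (Cminus _ _) with (Cplus (LP_block q (prod_step1 f g N) x1 x2) (LP_block q (prod_step2 f g N) x1 x2)) by ring.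
    eapply Rle_trans; [apply Cmod_triangle|].
    pose proof (prod_step1_bound f g K1 K2 N q x1 x2 Hf Hg) as B1.
    pose proof (prod_step2_bound f g K1 K2 N q x1 x2 Hf Hg) as B2.
    unfold step_const. rewrite !Rmult_plus_distr_r. lra.
Qed.

Lemma LP_prod_trunc_0 f g K1 K2 q x1 x2 : besov_le b f K1 -> besov_le s g K2 ->
  Cmod (LP_block q (prod_trunc f g 0) x1 x2) <=
  Crho * Rpower 2 b * Rpower 2 (s + Rabs s) * (K1 * K2) * ((INR q + 2) ^ 2 * wt (- s) q).
Proof.
  intros Hf Hg. pose proof (besov_le_ge0 _ _ _ Hf) as P1. pose proof (besov_le_ge0 _ _ _ Hg) as P2.
  pose proof Crho_pos.
  destruct (le_lt_dec 3 q) as [L|L].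
  - rewrite LP_prod_trunc_low by lia. rewrite Cmod_0. nonneg.
  - eapply Rle_trans.
    + apply (LP_conv_bound q (2 ^ (0 + 1)) (2 ^ (0 + 1))).
      * apply Scut_supp.
      * intros y1 y2. apply Scut_bound. exact Hf.
      * intros y1 y2. apply Scut_bound. exact Hg.
    + cbn [seq rsum]. rewrite !Rplus_0_r.
      assert (E : wt (- b) 0 = Rpower 2 b) by (unfold wt; f_equal; simpl; ring).
      assert (W : wt (- s) 0 <= Rpower 2 (s + Rabs s) * wt (- s) q).
      { unfold wt. rewrite <- Rpower_plus. apply Rpower2_mono. simpl.
        assert (0 <= INR q <= 2) by (split; [apply pos_INR|apply (le_INR q 2); lia]).
        pose proof (Rle_abs s). pose proof (Rle_abs (- s)). rewrite Rabs_Ropp in *. nra. }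
      rewrite E.
      replace (Crho * (INR q + 2) ^ 2 * (K1 * Rpower 2 b * (K2 * wt (- s) 0))) with
        (Crho * Rpower 2 b * (K1 * K2) * (INR q + 2) ^ 2 * wt (- s) 0) by ring.
      replace (Crho * Rpower 2 b * Rpower 2 (s + Rabs s) * (K1 * K2) * ((INR q + 2) ^ 2 * wt (- s) q)) with
        (Crho * Rpower 2 b * (K1 * K2) * (INR q + 2) ^ 2 * (Rpower 2 (s + Rabs s) * wt (- s) q)) by ring.
      apply Rmult_le_compat_l; auto. nonneg.
Qed.

Definition trunc_const : R :=
  Crho * Rpower 2 b * Rpower 2 (s + Rabs s) + step_const * (Gc eta * Rpower 2 (3 * eta)).

(** Only increments with [N >= q - 3] contribute, so their sum is of order [2 ^ (- eta q)]; it
    cancels the growth of [wt (eta - s) q] and leaves the expected [wt (- s) q]. *)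
Lemma LP_prod_trunc_bound f g K1 K2 N q x1 x2 : besov_le b f K1 -> besov_le s g K2 ->
  Cmod (LP_block q (prod_trunc f g N) x1 x2) <=
  trunc_const * (K1 * K2) * ((INR q + 2) ^ 2 * wt (- s) q).
Proof.
  intros Hf Hg. pose proof (besov_le_ge0 _ _ _ Hf) as P1. pose proof (besov_le_ge0 _ _ _ Hg) as P2.
  set (D := step_const * (K1 * K2) * ((INR q + 2) ^ 2 * wt (eta - s) q)).
  assert (HD : 0 <= D).
  { unfold D. pose proof step_const_pos.
    nonneg. }
  assert (A : Cmod (LP_block q (prod_trunc f g N) x1 x2) <= Cmod (LP_block q (prod_trunc f g 0) x1 x2) +
     D * rsum (seq 0 N) (fun n => if le_lt_dec (n + 4) q then 0 else wt (- eta) n)).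
  { induction N.
    - simpl. lra.
    - rewrite seq_S, rsum_app. cbn [rsum Nat.add].
      pose proof (LP_prod_trunc_step f g K1 K2 N q x1 x2 Hf Hg) as St. fold D in St.
      pose proof (Cmod_triangle (Cminus (LP_block q (prod_trunc f g (S N)) x1 x2) (LP_block q (prod_trunc f g N) x1 x2))
        (LP_block q (prod_trunc f g N) x1 x2)) as T.
      replace (Cplus (Cminus (LP_block q (prod_trunc f g (S N)) x1 x2) (LP_block q (prod_trunc f g N) x1 x2))
        (LP_block q (prod_trunc f g N) x1 x2)) with (LP_block q (prod_trunc f g (S N)) x1 x2) in T by ring.
      lra. }
  assert (S0 : rsum (seq 0 N) (fun n => if le_lt_dec (n + 4) q then 0 else wt (- eta) n)
     <= Gc eta * Rpower 2 (3 * eta) * wt (- eta) q).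
  { apply Rle_trans with (Gc eta * wt (- eta) (q - 3)).
    - destruct (le_lt_dec N (q - 3)) as [L|L].
      + rewrite (rsum_ext _ _ (fun _ => 0)).
        * rewrite rsum_const, Rmult_0_r. destruct (Gc_pos eta He). pose proof (wt_pos (- eta) (q - 3)).
          apply Rmult_le_pos; lra.
        * intros n Hn. apply in_seq in Hn. destruct (le_lt_dec _ _); [auto|lia].
      + replace N with ((q - 3) + (N - (q - 3)))%nat by lia. rewrite seq_app, rsum_app.
        rewrite (rsum_ext (seq 0 (q - 3)) _ (fun _ => 0)).
        * rewrite rsum_const, Rmult_0_r, Rplus_0_l. cbn [Nat.add].
          eapply Rle_trans; [|apply sum_wt_down; auto]. apply rsum_le. intros n _.
          destruct (le_lt_dec _ _); [left; apply wt_pos|lra].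
        * intros n Hn. apply in_seq in Hn. destruct (le_lt_dec _ _); [auto|lia].
    - destruct (Gc_pos eta He) as [G _]. rewrite Rmult_assoc. apply Rmult_le_compat_l; [lra|].
      apply wt_le_const.
      assert (INR q <= INR (q - 3) + 3) by (replace 3 with (INR 3) by (simpl; ring); rewrite <- plus_INR; apply le_INR; lia).
      nra. }
  pose proof (LP_prod_trunc_0 f g K1 K2 q x1 x2 Hf Hg) as B0.
  apply (Rmult_le_compat_l D) in S0; auto.
  assert (E : wt (eta - s) q * wt (- eta) q = wt (- s) q) by (rewrite <- wt_plus; f_equal; ring).
  unfold trunc_const. rewrite <- E in *.
  replace (D * (Gc eta * Rpower 2 (3 * eta) * wt (- eta) q)) with
    (step_const * (Gc eta * Rpower 2 (3 * eta)) * (K1 * K2) * ((INR q + 2) ^ 2 * (wt (eta - s) q * wt (- eta) q))) in S0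
    by (unfold D; ring).
  rewrite !Rmult_plus_distr_r. lra.
Qed.

(** Gives [dmul] its meaning in this range: at a fixed frequency finitely many blocks matter, and
    each increment is geometrically small in [N]. *)
Lemma prod_trunc_cvg f g K1 K2 k : besov_le b f K1 -> besov_le s g K2 ->
  cvgc (fun N => prod_trunc f g N k) (dmul f g k).
Proof.
  intros Hf Hg. pose proof (besov_le_ge0 _ _ _ Hf) as P1. pose proof (besov_le_ge0 _ _ _ Hg) as P2.
  destruct (Gc_pos eta He) as [_ G]. pose proof (Rpower_pos 2 (- eta)).
  set (c := fun q => step_const * (K1 * K2) * ((INR q + 2) ^ 2 * wt (eta - s) q)).
  assert (Hc : forall q, 0 <= c q).
  { intros q. unfold c. pose proof step_const_pos.
    nonneg. }
  rewrite dmul_eq.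
  apply (cvgc_geom _ (rsum (seq 0 (S (coef_level k))) c * Rpower 2 eta) (Rpower 2 (- eta))).
  - lra.
  - apply Rmult_le_pos; [apply rsum_ge0; auto|left; apply Rpower_pos].
  - intros N.
    change (Cmod (dsub (prod_trunc f g (S N)) (prod_trunc f g N) k) <=
       rsum (seq 0 (S (coef_level k))) c * Rpower 2 eta * Rpower 2 (- eta) ^ N).
    rewrite (coef_decomp _ k _ (le_n _)).
    eapply Rle_trans; [apply Cmod_csum|].
    rewrite Rmult_assoc, (Rmult_comm (rsum _ _)), <- rsum_scal. apply rsum_le. intros q _.
    apply LP_block_coef. intros x1 x2. rewrite LP_block_sub.
    eapply Rle_trans; [apply (LP_prod_trunc_step f g K1 K2); auto|]. fold (c q).
    rewrite Rmult_comm. apply Rmult_le_compat_r; [apply Hc|].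
    assert (E : Rpower 2 eta * Rpower 2 (- eta) ^ N = wt (- eta) N).
    { rewrite <- Rpower_pow, Rpower_mult, <- Rpower_plus by apply Rpower_pos.
      unfold wt. f_equal. ring. }
    rewrite E. destruct (le_lt_dec _ _); [left; apply wt_pos|lra].
Qed.

Lemma dmul_bound s' : s' < s -> exists Cm, 0 < Cm /\ forall f g K1 K2,
  besov_le b f K1 -> besov_le s g K2 -> besov_le s' (dmul f g) (Cm * (K1 * K2)).
Proof.
  intros Hs'. destruct (poly_le_wt (s - s')) as [D [HD1 HD2]]; [lra|].
  assert (Ht : 0 < trunc_const).
  { unfold trunc_const. pose proof step_const_pos. destruct (Gc_pos eta He) as [G _]. pose proof Crho_pos.
    posit. }
  exists (trunc_const * D). split; [apply Rmult_lt_0_compat; auto|].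
  intros f g K1 K2 Hf Hg.
  pose proof (besov_le_ge0 _ _ _ Hf) as P1. pose proof (besov_le_ge0 _ _ _ Hg) as P2.
  apply (besov_lim s' (prod_trunc f g) _ _ 0).
  - intros N _. rewrite besov_le_iff. intros q x1 x2.
    eapply Rle_trans; [apply (LP_prod_trunc_bound f g K1 K2); auto|].
    replace (- s') with ((s - s') + - s) by ring. rewrite wt_plus.
    replace (trunc_const * D * (K1 * K2) * (wt (s - s') q * wt (- s) q)) with
      (trunc_const * (K1 * K2) * (D * wt (s - s') q * wt (- s) q)) by ring.
    apply Rmult_le_compat_l; [apply Rmult_le_pos; [lra|apply Rmult_le_pos; auto]|].
    apply Rmult_le_compat_r; [left; apply wt_pos|apply HD2].
  - intros k. eapply prod_trunc_cvg; eauto.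
Qed.

(** Each truncated product is bilinear, but [dmul] inherits this only where the three limits
    exist. *)
Lemma dmul_sub_l f1 f2 g K1 K2 K : besov_le b f1 K1 -> besov_le b f2 K2 -> besov_le s g K ->
  dmul (dsub f1 f2) g = dsub (dmul f1 g) (dmul f2 g).
Proof.
  intros H1 H2 Hg. apply functional_extensionality. intros k.
  pose proof (besov_sub _ _ _ _ _ H1 H2) as H12.
  apply (cvgc_unique (fun N => prod_trunc (dsub f1 f2) g N k)).
  - eapply prod_trunc_cvg; eauto.
  - apply (cvgc_ext (fun N => Cminus (prod_trunc f1 g N k) (prod_trunc f2 g N k))).
    + intros N. unfold prod_trunc, conv. rewrite <- csum_minus. apply csum_ext. intros l _.
      unfold Scut, dsub. ring.
    + apply cvgc_minus; eapply prod_trunc_cvg; eauto.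
Qed.

Lemma dmul_sub_r f g1 g2 K1 K2 K : besov_le b f K -> besov_le s g1 K1 -> besov_le s g2 K2 ->
  dmul f (dsub g1 g2) = dsub (dmul f g1) (dmul f g2).
Proof.
  intros Hf H1 H2. apply functional_extensionality. intros k.
  pose proof (besov_sub _ _ _ _ _ H1 H2) as H12.
  apply (cvgc_unique (fun N => prod_trunc f (dsub g1 g2) N k)).
  - eapply prod_trunc_cvg; eauto.
  - apply (cvgc_ext (fun N => Cminus (prod_trunc f g1 N k) (prod_trunc f g2 N k))).
    + intros N. unfold prod_trunc, conv. rewrite <- csum_minus. apply csum_ext. intros l _.
      unfold Scut, dsub. ring.
    + apply cvgc_minus; eapply prod_trunc_cvg; eauto.
Qed.
End ProductEstimate.

(** * Pairs with a relative difference bound *)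

(** [A] bounds both functions and [d] measures their difference relative to [A]. Under products the
    sizes multiply and the relative differences add, so one induction yields bounds and Lipschitz
    estimates at once. *)
Definition rel (a A d : R) (f g : Dist) : Prop :=
  besov_le a f A /\ besov_le a g A /\ besov_le a (dsub f g) (A * d).

Lemma dmul_rel b s eta s' : 0 < eta -> s <= eta -> eta < b -> eta < b + s -> s' < s ->
  exists Cm, 0 < Cm /\ forall f f' g g' A1 A2 d1 d2,
  rel b A1 d1 f f' -> rel s A2 d2 g g' ->
  rel s' (Cm * (A1 * A2)) (d1 + d2) (dmul f g) (dmul f' g').
Proof.
  intros H1 H2 H3 H4 H5. destruct (dmul_bound b s eta H1 H2 H3 H4 s' H5) as [Cm [HC B]].
  exists Cm. split; auto. intros f f' g g' A1 A2 d1 d2 [F1 [F2 F3]] [G1 [G2 G3]].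
  repeat split; auto.
  replace (dsub (dmul f g) (dmul f' g')) with (dadd (dmul (dsub f f') g) (dmul f' (dsub g g'))).
  - replace (Cm * (A1 * A2) * (d1 + d2)) with (Cm * (A1 * d1 * A2) + Cm * (A1 * (A2 * d2))) by ring.
    apply besov_add; apply B; auto.
  - rewrite (dmul_sub_l b s eta H1 H2 H3 H4 _ _ _ _ _ _ F1 F2 G1).
    rewrite (dmul_sub_r b s eta H1 H2 H3 H4 _ _ _ _ _ _ F2 G1 G2).
    apply functional_extensionality. intros k. unfold dadd, dsub. ring.
Qed.

Lemma rel_embed a b A d f g : b <= a -> rel a A d f g -> rel b (Rpower 2 (a - b) * A) d f g.
Proof.
  intros L [H1 [H2 H3]]. repeat split; try (apply besov_embed; auto).
  rewrite Rmult_assoc. apply besov_embed; auto.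
Qed.

Lemma rel_conj a A d f g : rel a A d f g -> rel a A d (dconj f) (dconj g).
Proof.
  intros [H1 [H2 H3]]. split; [|split].
  - apply besov_conj; auto.
  - apply besov_conj; auto.
  - rewrite <- dconj_dsub. apply besov_conj; auto.
Qed.

Lemma rel_refl a A f : besov_le a f A -> rel a A 0 f f.
Proof.
  intros H. repeat split; auto. rewrite Rmult_0_r.
  replace (dsub f f) with dzero; [apply besov_zero|].
  apply functional_extensionality. intros k. unfold dsub, dzero. ring.
Qed.

Lemma rel_mono a A A' d d' f g : rel a A d f g -> A <= A' -> d <= d' -> 0 <= d -> rel a A' d' f g.
Proof.
  intros [H1 [H2 H3]] L1 L2 L3. pose proof (besov_le_ge0 _ _ _ H1) as P.
  repeat split; eapply besov_le_mono; eauto. apply Rmult_le_compat; auto.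
Qed.

(* Each product loses an arbitrarily small amount of regularity, hence the gap between [b] and [s]. *)
Lemma dpow_rel b n : 0 < b -> forall s, 0 < s < b ->
  exists Cm, 0 < Cm /\ forall f g A d, 0 <= d -> rel b A d f g ->
  rel s (Cm * A ^ n) (INR n * d) (dpow f n) (dpow g n).
Proof.
  intros Hb. induction n; intros s Hs.
  - exists (Rpower 2 (- s)). split; [apply Rpower_pos|]. intros f g A d _ _. simpl.
    rewrite Rmult_1_r, Rmult_0_l. apply rel_refl, besov_done.
  - set (t := (s + b) / 2). destruct (IHn t) as [C1 [P1 H1]]; [unfold t; lra|].
    destruct (dmul_rel b t t s) as [C2 [P2 H2]]; try (unfold t; lra).
    exists (C2 * C1). split; [apply Rmult_lt_0_compat; auto|].
    intros f g A d Hd H. specialize (H1 f g A d Hd H). specialize (H2 _ _ _ _ _ _ _ _ H H1).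
    cbn [dpow]. rewrite S_INR.
    replace (C2 * C1 * A ^ S n) with (C2 * (A * (C1 * A ^ n))) by (simpl; ring).
    replace ((INR n + 1) * d) with (d + INR n * d) by ring. auto.
Qed.

(** * Smoothing by the semigroup *)

Lemma Cmod_le_sum x y : Cmod (x, y) <= Rabs x + Rabs y.
Proof.
  replace (x, y) with (Cplus (RtoC x) (Cmult Ci (RtoC y)))
    by (apply injective_projections; simpl; ring).
  eapply Rle_trans; [apply Cmod_triangle|]. rewrite Cmod_mult, Cmod_Ci, !Cmod_R. lra.
Qed.

Lemma Cmod_cexp z : Cmod (cexp z) = exp (fst z).
Proof.
  destruct z as [a b]. unfold cexp, Cmod; simpl.
  replace (exp a * cos b * (exp a * cos b * 1) + exp a * sin b * (exp a * sin b * 1)) with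
    (exp a * exp a * (Rsqr (sin b) + Rsqr (cos b))) by (unfold Rsqr; ring).
  rewrite sin2_cos2, Rmult_1_r. apply sqrt_square. left; apply exp_pos.
Qed.

Lemma exp_lip_max a b : a <= b -> exp b - exp a <= (b - a) * exp b.
Proof.
  intros H. replace (exp a) with (exp b * exp (a - b)) by (rewrite <- exp_plus; f_equal; ring).
  pose proof (exp_ineq1_le (a - b)). pose proof (exp_pos b). nra.
Qed.

Lemma sin_lip x y : Rabs (sin x - sin y) <= Rabs (x - y).
Proof.
  assert (S : forall z, 0 <= z -> sin z <= z).
  { intros z Hz. destruct (Req_dec z 0) as [->|]; [rewrite sin_0; lra|left; apply sin_lt_x; lra]. }
  assert (SA : forall z, Rabs (sin z) <= Rabs z).
  { assert (P : forall z, 0 <= z -> Rabs (sin z) <= z).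
    { intros z Hz. destruct (Rle_dec z 1).
      - rewrite Rabs_pos_eq; auto. apply sin_ge_0; auto. pose proof PI2_3_2. lra.
      - apply Rabs_le. pose proof (SIN_bound z). lra. }
    intros z. destruct (Rle_dec 0 z).
    - rewrite (Rabs_pos_eq z) by auto. auto.
    - rewrite <- (Rabs_Ropp z), (Rabs_pos_eq (- z)), <- Rabs_Ropp, <- sin_neg by lra. apply P; lra. }
  rewrite form4, !Rabs_mult, (Rabs_pos_eq 2) by lra.
  pose proof (SA ((x - y) / 2)) as B.
  assert (C1 : Rabs (cos ((x + y) / 2)) <= 1) by (apply Rabs_le; pose proof (COS_bound ((x + y) / 2)); lra).
  assert (E : Rabs ((x - y) / 2) = Rabs (x - y) / 2).
  { unfold Rdiv. rewrite Rabs_mult, (Rabs_pos_eq (/ 2)); lra. }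
  rewrite E in B. pose proof (Rabs_pos (sin ((x - y) / 2))). nra.
Qed.

Lemma cos_lip x y : Rabs (cos x - cos y) <= Rabs (x - y).
Proof.
  rewrite <- !sin_shift. eapply Rle_trans; [apply sin_lip|].
  right. rewrite <- Rabs_Ropp. f_equal. ring.
Qed.

Lemma cexp_lip z w m : fst z <= m -> fst w <= m ->
  Cmod (Cminus (cexp z) (cexp w)) <= (2 * Rabs (fst z - fst w) + 2 * Rabs (snd z - snd w)) * exp m.
Proof.
  intros Hz Hw. destruct z as [a b], w as [a' b']; simpl in *.
  eapply Rle_trans; [apply Cmod_le_sum|].
  assert (Ea : exp a <= exp m) by (destruct Hz as [L| ->]; [left; apply exp_increasing; auto|lra]).
  assert (Ea' : exp a' <= exp m) by (destruct Hw as [L| ->]; [left; apply exp_increasing; auto|lra]).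
  assert (D : Rabs (exp a - exp a') <= Rabs (a - a') * exp m).
  {
    destruct (Rle_dec a a') as [L|L].
    - rewrite Rabs_minus_sym, (Rabs_minus_sym a), Rabs_pos_eq, Rabs_pos_eq.
      + pose proof (exp_lip_max a a' L). nra.
      + lra.
      + destruct L as [L| ->]; [pose proof (exp_increasing _ _ L); lra|lra].
    - rewrite Rabs_pos_eq, Rabs_pos_eq.
      + pose proof (exp_lip_max a' a ltac:(lra)). nra.
      + lra.
      + assert (L' : a' < a) by lra. pose proof (exp_increasing _ _ L'). lra. }
  assert (G : forall u v, Rabs u <= 1 -> Rabs (u - v) <= Rabs (b - b') ->
     Rabs (exp a * u + - (exp a' * v)) <= Rabs (a - a') * exp m + Rabs (b - b') * exp m).
  { intros u v Hu Huv.
    replace (exp a * u + - (exp a' * v)) with ((exp a - exp a') * u + exp a' * (u - v)) by ring.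
    eapply Rle_trans; [apply Rabs_triang|]. rewrite !Rabs_mult, (Rabs_pos_eq (exp a')) by (left; apply exp_pos).
    pose proof (Rabs_pos (exp a - exp a')). pose proof (Rabs_pos (u - v)).
    pose proof (exp_pos a').
    apply Rplus_le_compat; [nra|]. rewrite Rmult_comm. apply Rmult_le_compat; lra. }
  pose proof (G (cos b) (cos b') ltac:(apply Rabs_le; apply COS_bound) (cos_lip b b')).
  pose proof (G (sin b) (sin b') ltac:(apply Rabs_le; apply SIN_bound) (sin_lip b b')).
  simpl. lra.
Qed.

Lemma power_le_exp p c : 0 < p -> 0 < c -> exists D, 0 < D /\ forall X, 0 <= X ->
  Rpower (1 + X) p <= D * exp (c * X).
Proof.
  intros Hp Hc. exists (exp (c - p * ln (c / p))). split; [apply exp_pos|].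
  intros X HX. rewrite <- exp_plus. unfold Rpower.
  assert (Hcp : 0 < c / p) by (apply Rdiv_lt_0_compat; auto).
  (* Tangent bound for the logarithm, placed at the point where [p ln (1 + X) - c X] is largest. *)
  pose proof (ln_le_sub1 (c / p * (1 + X)) ltac:(nra)) as L.
  rewrite ln_mult in L by lra.
  assert (p * ln (1 + X) <= c - p * ln (c / p) + c * X).
  { apply (Rmult_le_compat_l p) in L; [|lra].
    replace (p * (c / p * (1 + X) - 1)) with (c * (1 + X) - p) in L by (field; lra). lra. }
  destruct H as [H| ->]; [left; apply exp_increasing; auto|lra].
Qed.

Definition heat_sym (mu t : R) (k : Z * Z) : C := cexp (Cmult (RtoC t) (lambdaA mu k)).

Lemma heat_sym_arg mu t k : Cmult (RtoC t) (lambdaA mu k) =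
  (t * (- mu * (4 * PI ^ 2 * knorm k ^ 2) - 1), t * - (4 * PI ^ 2 * knorm k ^ 2)).
Proof. rewrite knorm_sqr. unfold lambdaA, Cmult, RtoC; simpl. f_equal; ring. Qed.

Lemma four_pi2 : 1 <= 4 * PI ^ 2.
Proof. pose proof PI2_3_2. nra. Qed.

Lemma heat_sym_le mu t k L : 0 <= mu -> 0 <= t -> 0 <= L <= knorm k ->
  fst (Cmult (RtoC t) (lambdaA mu k)) <= - (mu * t * L ^ 2).
Proof.
  intros Hm Ht HL. rewrite heat_sym_arg. simpl fst. pose proof four_pi2 as P.
  assert (L ^ 2 <= knorm k ^ 2) by (apply pow_incr; auto).
  assert (knorm k ^ 2 <= 4 * PI ^ 2 * knorm k ^ 2) by (pose proof (pow2_ge_0 (knorm k)); nra).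
  assert (0 <= mu * t) by nra. nra.
Qed.

Lemma Cmod_heat_sym_le1 mu t k : 0 <= mu -> 0 <= t -> Cmod (heat_sym mu t k) <= 1.
Proof.
  intros Hm Ht. unfold heat_sym. rewrite Cmod_cexp, <- exp_0.
  pose proof (heat_sym_le mu t k 0 Hm Ht ltac:(split; [lra|apply knorm_ge0])) as H.
  rewrite pow_i, Rmult_0_r, Ropp_0 in H by lia.
  destruct H as [H| ->]; [left; apply exp_increasing; auto|lra].
Qed.

Lemma Cmod_heat_sym_lip mu t k l L M : 0 <= mu -> 0 <= t ->
  0 <= L -> L <= knorm k <= M -> L <= knorm l <= M -> Rabs (knorm k - knorm l) <= 1 ->
  Cmod (Cminus (heat_sym mu t k) (heat_sym mu t l)) <=
  t * (16 * PI ^ 2 * (mu + 1) * M) * exp (- (mu * t * L ^ 2)).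
Proof.
  intros Hm Ht HL Hk Hl Hd. unfold heat_sym.
  eapply Rle_trans; [apply (cexp_lip _ _ (- (mu * t * L ^ 2))); apply heat_sym_le; lra|].
  rewrite !heat_sym_arg. cbn [fst snd].
  apply Rmult_le_compat_r; [left; apply exp_pos|].
  replace (t * (- mu * (4 * PI ^ 2 * knorm k ^ 2) - 1) - t * (- mu * (4 * PI ^ 2 * knorm l ^ 2) - 1))
    with (- (t * mu * (4 * PI ^ 2) * (knorm k ^ 2 - knorm l ^ 2))) by ring.
  replace (t * - (4 * PI ^ 2 * knorm k ^ 2) - t * - (4 * PI ^ 2 * knorm l ^ 2))
    with (- (t * (4 * PI ^ 2) * (knorm k ^ 2 - knorm l ^ 2))) by ring.
  rewrite !Rabs_Ropp, !Rabs_mult, (Rabs_pos_eq t), (Rabs_pos_eq mu), (Rabs_pos_eq 4), (Rabs_pos_eq (PI ^ 2))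
    by (auto; try lra; apply pow2_ge_0).
  assert (E : Rabs (knorm k ^ 2 - knorm l ^ 2) <= 2 * M).
  { replace (knorm k ^ 2 - knorm l ^ 2) with ((knorm k - knorm l) * (knorm k + knorm l)) by ring.
    rewrite Rabs_mult, (Rabs_pos_eq (knorm k + knorm l)) by lra. nra. }
  replace (2 * (t * mu * (4 * PI ^ 2) * Rabs (knorm k ^ 2 - knorm l ^ 2)) +
           2 * (t * (4 * PI ^ 2) * Rabs (knorm k ^ 2 - knorm l ^ 2))) with
    (t * (8 * PI ^ 2 * (mu + 1)) * Rabs (knorm k ^ 2 - knorm l ^ 2)) by ring.
  replace (t * (16 * PI ^ 2 * (mu + 1) * M)) with (t * (8 * PI ^ 2 * (mu + 1)) * (2 * M)) by ring.
  apply Rmult_le_compat_l; auto. nonneg.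
Qed.

Definition heat_rho (mu t : R) (n : nat) : Dist := fun k => Cmult (rho_sym n k) (heat_sym mu t k).

Lemma heat_rho_supp mu t n : supp_in (2 ^ (n + 1)) (heat_rho mu t n).
Proof. intros k Hk. unfold heat_rho. rewrite rho_sym_supp by auto. ring. Qed.

Lemma Cmod_rho_sym_le1 n k : Cmod (rho_sym n k) <= 1.
Proof. unfold rho_sym. rewrite Cmod_R. apply rhoj_abs. Qed.

Lemma rho_sym_lip n k e : knorm e = 1 ->
  Cmod (Cminus (rho_sym n (zadd k e)) (rho_sym n k)) <= 6 * Lh / 2 ^ (n + 1).
Proof.
  intros He. unfold rho_sym. rewrite <- RtoC_minus, Cmod_R.
  eapply Rle_trans; [apply rhoj_lip|]. unfold Rdiv. apply Rmult_le_compat_r.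
  - left; apply Rinv_0_lt_compat, two_pow_pos.
  - pose proof (knorm_unit_step k e He). pose proof Lh_ge1. nra.
Qed.

Lemma rho_sym_range n k : rho_sym (S n) k <> RtoC 0 -> 2 ^ n <= knorm k <= 4 / 3 * 2 ^ S n.
Proof.
  intros H. unfold rho_sym in H. split; apply Rnot_lt_le; intros L; apply H.
  - rewrite rhoj_low by lra. reflexivity.
  - rewrite rhoj_high by lra. reflexivity.
Qed.

Lemma heat_rho_abs_S mu t n k : 0 <= mu -> 0 <= t ->
  Cmod (heat_rho mu t (S n) k) <= exp (- (mu * t * (2 ^ n) ^ 2)).
Proof.
  intros Hm Ht. unfold heat_rho.
  destruct (Ceq_dec (rho_sym (S n) k) (RtoC 0)) as [E|E].
  - rewrite E, Cmult_0_l, Cmod_0. left; apply exp_pos.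
  - apply rho_sym_range in E. rewrite Cmod_mult.
    pose proof (Cmod_rho_sym_le1 (S n) k).
    assert (Cmod (heat_sym mu t k) <= exp (- (mu * t * (2 ^ n) ^ 2))).
    { unfold heat_sym. rewrite Cmod_cexp. pose proof (two_pow_pos n).
      destruct (heat_sym_le mu t k (2 ^ n) Hm Ht ltac:(lra)) as [L| ->]; [left; apply exp_increasing; auto|lra]. }
    pose proof (Cmod_ge_0 (heat_sym mu t k)). nra.
Qed.

(** The exponential factor is available only on the annulus of the block, hence the cases according
    to which of [k] and [k + e] lies in the support. *)
Lemma heat_rho_lip_S mu t n k e : 0 <= mu -> 0 <= t -> knorm e = 1 ->
  Cmod (Cminus (heat_rho mu t (S n) (zadd k e)) (heat_rho mu t (S n) k)) <=
  (6 * Lh / 2 ^ (S n + 1) + t * (16 * PI ^ 2 * (mu + 1) * (4 / 3 * 2 ^ S n))) *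
  exp (- (mu * t * (2 ^ n) ^ 2)).
Proof.
  intros Hm Ht He.
  set (E := exp (- (mu * t * (2 ^ n) ^ 2))).
  set (c1 := 6 * Lh / 2 ^ (S n + 1)). set (c2 := t * (16 * PI ^ 2 * (mu + 1) * (4 / 3 * 2 ^ S n))).
  pose proof (two_pow_pos n) as P. pose proof Lh_ge1.
  assert (HE : 0 < E) by apply exp_pos.
  assert (H1 : 0 <= c1) by (apply Rdiv_le_0_compat; [lra|apply two_pow_pos]).
  assert (H2 : 0 <= c2) by (unfold c2; pose proof (pow2_ge_0 PI); pose proof (two_pow_pos (S n)); nonneg).
  pose proof (rho_sym_lip (S n) k e He) as RL. fold c1 in RL.
  assert (SE : forall l, rho_sym (S n) l <> RtoC 0 -> Cmod (heat_sym mu t l) <= E).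
  { intros l Hl. apply rho_sym_range in Hl. unfold heat_sym. rewrite Cmod_cexp.
    destruct (heat_sym_le mu t l (2 ^ n) Hm Ht ltac:(lra)) as [L| ->]; [left; apply exp_increasing; auto|unfold E; lra]. }
  unfold heat_rho.
  destruct (Ceq_dec (rho_sym (S n) k) (RtoC 0)) as [Z1|Z1];
    destruct (Ceq_dec (rho_sym (S n) (zadd k e)) (RtoC 0)) as [Z2|Z2].
  - rewrite Z1, Z2. replace (Cminus _ _) with (RtoC 0) by ring. rewrite Cmod_0. nra.
  - rewrite Z1 in *. replace (Cminus (rho_sym (S n) (zadd k e)) (RtoC 0)) with (rho_sym (S n) (zadd k e)) in RL by ring.
    replace (Cminus _ _) with (Cmult (rho_sym (S n) (zadd k e)) (heat_sym mu t (zadd k e))) by ring.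
    rewrite Cmod_mult.
    apply Rle_trans with (c1 * E); [apply Rmult_le_compat; auto using Cmod_ge_0|nra].
  - rewrite Z2 in *. replace (Cminus (RtoC 0) (rho_sym (S n) k)) with (Copp (rho_sym (S n) k)) in RL by ring.
    rewrite Cmod_opp in RL.
    replace (Cminus _ _) with (Copp (Cmult (rho_sym (S n) k) (heat_sym mu t k))) by ring.
    rewrite Cmod_opp, Cmod_mult.
    apply Rle_trans with (c1 * E); [apply Rmult_le_compat; auto using Cmod_ge_0|nra].
  - replace (Cminus _ _) with (Cplus (Cmult (Cminus (rho_sym (S n) (zadd k e)) (rho_sym (S n) k)) (heat_sym mu t k))
      (Cmult (rho_sym (S n) (zadd k e)) (Cminus (heat_sym mu t (zadd k e)) (heat_sym mu t k)))) by ring.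
    eapply Rle_trans; [apply Cmod_triangle|]. rewrite !Cmod_mult, Rmult_plus_distr_r.
    apply Rplus_le_compat.
    + apply Rmult_le_compat; auto using Cmod_ge_0.
    + apply rho_sym_range in Z1. apply rho_sym_range in Z2.
      pose proof (Cmod_heat_sym_lip mu t (zadd k e) k (2 ^ n) (4 / 3 * 2 ^ S n) Hm Ht ltac:(lra) Z2 Z1
         (knorm_unit_step k e He)) as HL. fold c2 in HL. fold E in HL.
      pose proof (Cmod_rho_sym_le1 (S n) (zadd k e)).
      pose proof (Cmod_ge_0 (Cminus (heat_sym mu t (zadd k e)) (heat_sym mu t k))). nra.
Qed.

Lemma heat_rho_symbol mu r : 0 < mu -> 0 <= r -> exists C3, 0 < C3 /\ forall t n, 0 <= t <= 1 ->
  (forall k, Cmod (heat_rho mu t n k) <= C3 * Rpower (1 + t * 4 ^ n) (- r)) /\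
  (forall k e, knorm e = 1 -> Cmod (Cminus (heat_rho mu t n (zadd k e)) (heat_rho mu t n k)) <=
     C3 * Rpower (1 + t * 4 ^ n) (- r) / 2 ^ (n + 1)).
Proof.
  intros Hm Hr.
  (* The exponent is [r + 1] because a difference of the heat symbol brings a factor [t * 4 ^ n].
     The rate is [mu / 4] because block [n] starts at half of [2 ^ n]. *)
  destruct (power_le_exp (r + 1) (mu / 4)) as [D [HD1 HD2]]; [lra|lra|].
  (* Slope of the block symbol plus a bound for the slope of the heat symbol, which after
     multiplication by the box radius is [128 / 3 * PI ^ 2 * (mu + 1) * X]. *)
  set (c0 := 6 * Lh + 86 * PI ^ 2 * (mu + 1)).
  assert (Hc0 : 1 <= c0) by (unfold c0; pose proof Lh_ge1; pose proof (pow2_ge_0 PI); nra).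
  assert (H2r : 1 <= Rpower 2 r) by (rewrite <- (Rpower_O 2) by lra; apply Rpower2_mono; auto).
  exists (c0 * D + 4 * Rpower 2 r). split; [nra|].
  intros t n Ht.
  assert (HX : 0 <= t * 4 ^ n) by (apply Rmult_le_pos; [lra|apply pow_le; lra]).
  set (X := t * 4 ^ n) in *. pose proof (Rpower_pos (1 + X) (- r)) as PX.
  destruct n as [|n].
  (* Block [j = -1] contains [k = 0], with no lower bound on the frequency. The trivial bounds 1 and
     2 suffice, since [t <= 1] keeps [Rpower (1 + X) (- r)] above [Rpower 2 (- r)]; the 4 becomes 2
     after division by the box radius 2. *)
  - assert (B : 4 <= 4 * Rpower 2 r * Rpower (1 + X) (- r)).
    { assert (X <= 1) by (unfold X; simpl; lra).
      assert (Rpower (1 + X) r <= Rpower 2 r) by (apply Rle_Rpower_l; lra).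
      rewrite Rpower_Ropp. pose proof (Rpower_pos (1 + X) r).
      assert (1 <= Rpower 2 r * / Rpower (1 + X) r).
      { apply (Rle_trans _ (Rpower (1 + X) r * / Rpower (1 + X) r)); [rewrite Rinv_r; lra|].
        apply Rmult_le_compat_r; [left; apply Rinv_0_lt_compat; auto|auto]. }
      nra. }
    assert (0 <= c0 * D * Rpower (1 + X) (- r)) by nonneg.
    assert (A : forall k, Cmod (heat_rho mu t 0 k) <= 1).
    { intros k. unfold heat_rho. rewrite Cmod_mult.
      pose proof (Cmod_rho_sym_le1 0 k). pose proof (Cmod_heat_sym_le1 mu t k ltac:(lra) ltac:(lra)).
      pose proof (Cmod_ge_0 (heat_sym mu t k)). nra. }
    split.
    + intros k. specialize (A k). lra.
    + intros k e _. unfold Cminus. eapply Rle_trans; [apply Cmod_triangle|]. rewrite Cmod_opp.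
      pose proof (A k). pose proof (A (zadd k e)). simpl (2 ^ (0 + 1)). lra.
  -
    assert (E4 : 4 ^ S n = 4 * (2 ^ n) ^ 2).
    { simpl. replace 4 with (2 * 2) at 2 by ring. rewrite Rpow_mult_distr. ring. }
    assert (EX : t * (2 ^ n) ^ 2 = X / 4) by (unfold X; rewrite E4; field).
    assert (Eexp : exp (- (mu * t * (2 ^ n) ^ 2)) = exp (- (mu / 4 * X))).
    { f_equal. rewrite Rmult_assoc, EX. field. }
    assert (K1 : (1 + X) * exp (- (mu / 4 * X)) <= D * Rpower (1 + X) (- r)).
    { specialize (HD2 X HX). rewrite Rpower_plus, Rpower_1 in HD2 by lra.
      rewrite exp_Ropp, Rpower_Ropp. pose proof (exp_pos (mu / 4 * X)). pose proof (Rpower_pos (1 + X) r) as PR.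
      apply (Rmult_le_reg_r (exp (mu / 4 * X) * Rpower (1 + X) r)); [apply Rmult_lt_0_compat; auto|].
      field_simplify; lra. }
    assert (Hall : c0 * (1 + X) * exp (- (mu / 4 * X)) <= (c0 * D + 4 * Rpower 2 r) * Rpower (1 + X) (- r)).
    { apply Rle_trans with (c0 * (D * Rpower (1 + X) (- r))); [|].
      - rewrite Rmult_assoc. apply Rmult_le_compat_l; lra.
      - rewrite Rmult_plus_distr_r. assert (0 <= 4 * Rpower 2 r * Rpower (1 + X) (- r)) by nra. lra. }
    pose proof (exp_pos (- (mu / 4 * X))) as PE.
    split.
    + intros k. eapply Rle_trans; [apply heat_rho_abs_S; lra|]. rewrite Eexp.
      assert (1 <= c0 * (1 + X)) by nra. eapply Rle_trans; [|exact Hall]. nra.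
    + intros k e He. eapply Rle_trans; [apply heat_rho_lip_S; auto; lra|]. rewrite Eexp.
      apply Rle_trans with (c0 * (1 + X) * exp (- (mu / 4 * X)) / 2 ^ (S n + 1)).
      * unfold Rdiv. rewrite (Rmult_assoc (c0 * (1 + X))), (Rmult_comm (exp _) (/ _)), <- (Rmult_assoc (c0 * (1 + X))).
        apply Rmult_le_compat_r; [lra|].
        apply (Rmult_le_reg_r (2 ^ (S n + 1))); [apply two_pow_pos|].
        rewrite (Rmult_assoc (c0 * _)), Rinv_l, Rmult_1_r by (apply pow_nonzero; lra).
        replace ((6 * Lh * / 2 ^ (S n + 1) + t * (16 * PI ^ 2 * (mu + 1) * (4 * / 3 * 2 ^ S n))) * 2 ^ (S n + 1))
          with (6 * Lh + (16 * 4 / 3 * 8 * PI ^ 2 * (mu + 1)) * (t * (2 ^ n) ^ 2)).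
        2:{ rewrite pow_add. simpl. field. apply pow_nonzero; lra. }
        rewrite EX. unfold c0. pose proof Lh_ge1.
        assert (0 <= PI ^ 2 * (mu + 1)) by nra. set (y := PI ^ 2 * (mu + 1)) in *.
        replace (16 * 4 / 3 * 8 * PI ^ 2 * (mu + 1) * (X / 4)) with (128 / 3 * (y * X)) by (unfold y; field).
        replace (86 * PI ^ 2 * (mu + 1)) with (86 * y) by (unfold y; ring).
        nra.
      * unfold Rdiv. apply Rmult_le_compat_r; [left; apply Rinv_0_lt_compat, two_pow_pos|auto].
Qed.

(** The neighbouring blocks, whose symbols sum to 1 on the support of block [n]. With them an
    evolved block is one multiplier applied to a bounded polynomial. Truncated subtraction makes
    them 0, 1, 2 when [n = 0]. *)
Definition fat_block (n : nat) (f : Dist) : Dist := fun k => csum (seq (n - 1) 3) (fun i => dblock i f k).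

Lemma rho_fat_block n f k : Cmult (rho_sym n k) (fat_block n f k) = Cmult (rho_sym n k) (f k).
Proof.
  destruct (Ceq_dec (rho_sym n k) (RtoC 0)) as [E|E]; [rewrite E; ring|].
  f_equal. unfold fat_block, dblock. rewrite csum_scal_r.
  assert (H : csum (seq (n - 1) 3) (fun i => rho_sym i k) = RtoC 1); [|rewrite H; ring].
  assert (Hup : knorm k <= 4 / 3 * 2 ^ n).
  { apply Rnot_lt_le. intros L. apply E. unfold rho_sym. rewrite rhoj_high by lra. reflexivity. }
  assert (T : csum (seq 0 ((n - 1) + 3)) (fun i => rho_sym i k) = RtoC 1).
  { unfold rho_sym. rewrite (csum_RtoC _ (fun i => rhoj i (knorm k))).
    replace ((n - 1) + 3)%nat with (S ((n - 1) + 2)) by lia. rewrite sum_rhoj, chiN_1; auto.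
    apply Rle_trans with (2 ^ S n).
    - simpl. pose proof (two_pow_pos n). lra.
    - apply Rle_pow; [lra|lia]. }
  rewrite seq_app, csum_app in T. cbn [Nat.add] in T.
  rewrite (csum_zero (seq 0 (n - 1))) in T; [rewrite <- T; ring|].
  intros i Hi. apply in_seq in Hi. destruct n as [|n]; [lia|]. apply rho_sym_range in E.
  unfold rho_sym. rewrite rhoj_high; auto.
  assert (2 ^ S i <= 2 ^ n) by (apply Rle_pow; [lra|lia]). simpl in H.
  pose proof (two_pow_pos i). lra.
Qed.

Lemma fat_block_bound a f K n x1 x2 : besov_le a f K ->
  Cmod (ev (2 ^ (n + 3)) (fat_block n f) x1 x2) <= 3 * Rpower 2 (2 * Rabs a) * (K * wt (- a) n).
Proof.
  intros Hf. pose proof (besov_le_ge0 _ _ _ Hf) as P. rewrite besov_le_iff in Hf.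
  assert (E : ev (2 ^ (n + 3)) (fat_block n f) x1 x2 = csum (seq (n - 1) 3) (fun i => LP_block i f x1 x2)).
  { unfold ev, fat_block. rewrite (csum_ext _ _ (fun k => csum (seq (n - 1) 3) (fun i =>
      Cmult (dblock i f k) (fourier_char k x1 x2)))) by (intros; symmetry; apply csum_scal_r).
    rewrite csum_swap. apply csum_ext. intros i Hi. apply in_seq in Hi. apply ev_dblock.
    apply pow2_le_mono. lia. }
  rewrite E. eapply Rle_trans; [apply Cmod_csum|].
  eapply Rle_trans; [apply (rsum_le_const _ _ (Rpower 2 (2 * Rabs a) * (K * wt (- a) n)))|].
  - intros i Hi. apply in_seq in Hi. eapply Rle_trans; [apply Hf|].
    replace (Rpower 2 (2 * Rabs a) * (K * wt (- a) n)) with (K * (Rpower 2 (2 * Rabs a) * wt (- a) n)) by ring.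
    apply Rmult_le_compat_l; auto. apply wt_le_const.
    assert (D : Rabs (INR i - INR n) <= 2).
    { apply Rabs_le.
      assert (INR i <= INR n + 2) by (change 2 with (INR 2); rewrite <- plus_INR; apply le_INR; lia).
      assert (INR n <= INR i + 2) by (change 2 with (INR 2); rewrite <- plus_INR; apply le_INR; lia). lra. }
    eapply Rle_trans; [apply Rle_abs|]. rewrite Rabs_mult, Rabs_Ropp.
    pose proof (Rabs_pos a). nra.
  - rewrite length_seq. simpl (INR 3). lra.
Qed.

(** Keeping [/ 4 ^ n] next to [t] makes the bound finite at [t = 0], so for each block the Duhamel
    integrand is bounded near its upper endpoint. The strict inequality on [r] absorbs
    [(n + 2)^2]. *)
Theorem semigroup_smoothing mu a b r : 0 < mu -> 0 <= r -> (b - a) / 2 < r ->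
  exists Cs, 0 < Cs /\ forall f K t n x1 x2, besov_le a f K -> 0 <= t <= 1 ->
  wt b n * Cmod (LP_block n (semigroup mu t f) x1 x2) <= Cs * K * Rpower (t + / 4 ^ n) (- r).
Proof.
  intros Hm Hr Hab.
  destruct (heat_rho_symbol mu r Hm Hr) as [C3 [HC3 HS]].
  destruct (poly_le_wt (2 * r - (b - a))) as [D [HD1 HD2]]; [lra|].
  exists (54 * C3 * D * (3 * Rpower 2 (2 * Rabs a))).
  split; [posit|]. intros f K t n x1 x2 Hf Ht.
  pose proof (besov_le_ge0 _ _ _ Hf) as P.
  destruct (HS t n Ht) as [S1 S2].
  assert (P4 : 0 < 4 ^ n) by (apply pow_lt; lra).
  set (X := t * 4 ^ n) in *.
  assert (HX : 0 <= X) by (unfold X; nra).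
  set (B := C3 * Rpower (1 + X) (- r)) in *.
  assert (HB : 0 < B) by (unfold B; posit).
  assert (E : LP_block n (semigroup mu t f) x1 x2 =
     ev (2 ^ (n + 3)) (fun k => Cmult (heat_rho mu t n k) (fat_block n f k)) x1 x2).
  { rewrite (LP_block_ev_big n (2 ^ (n + 3))) by (apply pow2_le_mono; lia).
    apply csum_ext. intros k _. unfold heat_rho, semigroup. f_equal. fold (heat_sym mu t k).
    transitivity (Cmult (heat_sym mu t k) (Cmult (rho_sym n k) (f k))); [ring|].
    rewrite <- rho_fat_block. ring. }
  rewrite E.
  pose proof (multiplier_bound_pow2 n (2 ^ (n + 3)) (heat_rho mu t n) (fat_block n f) B
    (3 * Rpower 2 (2 * Rabs a) * (K * wt (- a) n)) HB (heat_rho_supp mu t n) S1 S2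
    (fun y1 y2 => fat_block_bound a f K n y1 y2 Hf) x1 x2) as M.
  apply (Rmult_le_compat_l (wt b n)) in M; [|left; apply wt_pos].
  eapply Rle_trans; [exact M|].
  set (c := 3 * Rpower 2 (2 * Rabs a)).
  assert (Hc : 0 <= c) by (unfold c; nonneg).
  assert (W : wt b n * (INR n + 2) ^ 2 * wt (- a) n <= D * Rpower (4 ^ n) r).
  { apply Rle_trans with (wt b n * (D * wt (2 * r - (b - a)) n) * wt (- a) n).
    - apply Rmult_le_compat_r; [left; apply wt_pos|]. apply Rmult_le_compat_l; [left; apply wt_pos|apply HD2].
    - replace (wt b n * (D * wt (2 * r - (b - a)) n) * wt (- a) n) with
        (D * (wt (b + (2 * r - (b - a)) + - a) n)) by (rewrite !wt_plus; ring).
      apply Rmult_le_compat_l; [lra|].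
      replace (4 ^ n) with (Rpower 2 (2 * INR n)).
      + rewrite Rpower_mult. apply Rpower2_mono. lra.
      + rewrite <- Rpower_mult, Rpower_pow by apply Rpower_pos. f_equal.
        change 2 with (INR 2) at 2. rewrite Rpower_pow by lra. ring. }
  assert (RP : Rpower (4 ^ n) r * Rpower (1 + X) (- r) = Rpower (t + / 4 ^ n) (- r)).
  { replace (Rpower (4 ^ n) r) with (Rpower (/ 4 ^ n) (- r)).
    - rewrite Rpower_mult_distr; [|apply Rinv_0_lt_compat; auto|lra]. f_equal. unfold X. field. lra.
    - unfold Rpower. rewrite ln_Rinv by auto. f_equal. ring. }
  rewrite <- RP. unfold B.
  replace (wt b n * (54 * (C3 * Rpower (1 + X) (- r)) * (INR n + 2) ^ 2 * (c * (K * wt (- a) n)))) with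
    (54 * C3 * c * K * Rpower (1 + X) (- r) * (wt b n * (INR n + 2) ^ 2 * wt (- a) n)) by ring.
  replace (54 * C3 * D * c * K * (Rpower (4 ^ n) r * Rpower (1 + X) (- r))) with
    (54 * C3 * c * K * Rpower (1 + X) (- r) * (D * Rpower (4 ^ n) r)) by ring.
  apply Rmult_le_compat_l; auto. nonneg.
Qed.

(** * Improper integrals at 0 *)

Notation CRint := (is_RInt (V := C_R_CompleteNormedModule)).

Lemma C_R_norm (z : C) : norm (V := C_R_CompleteNormedModule) z = Cmod z.
Proof.
  destruct z as [x y]. unfold norm; simpl. unfold prod_norm, Cmod; simpl. unfold norm; simpl.
  unfold abs; simpl. f_equal. rewrite !Rmult_1_r, <- !Rabs_mult, !Rabs_pos_eq by nra. reflexivity.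
Qed.

Lemma CRint_components F a b (l : C) :
  CRint F a b l <->
  is_RInt (fun s => fst (F s)) a b (fst l) /\ is_RInt (fun s => snd (F s)) a b (snd l).
Proof.
  split.
  - intros H. split; [apply (is_RInt_fct_extend_fst _ _ _ _ H)|apply (is_RInt_fct_extend_snd _ _ _ _ H)].
  - intros [H1 H2]. destruct l. apply (is_RInt_fct_extend_pair F); auto.
Qed.

Lemma CRint_mult c F a b l : CRint F a b l -> CRint (fun s => Cmult c (F s)) a b (Cmult c l).
Proof.
  rewrite !CRint_components. intros [H1 H2]. destruct c as [x y]; simpl. split.
  - apply (is_RInt_minus (fun s => x * fst (F s)) (fun s => y * snd (F s)));
      apply (is_RInt_scal (V := R_NormedModule)); auto.
  - apply (is_RInt_plus (fun s => x * snd (F s)) (fun s => y * fst (F s)));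
      apply (is_RInt_scal (V := R_NormedModule)); auto.
Qed.

Lemma CRint_plus F G a b l m : CRint F a b l -> CRint G a b m ->
  CRint (fun s => Cplus (F s) (G s)) a b (Cplus l m).
Proof. intros H1 H2. exact (is_RInt_plus _ _ _ _ _ _ H1 H2). Qed.

Lemma CRint_minus F G a b l m : CRint F a b l -> CRint G a b m ->
  CRint (fun s => Cminus (F s) (G s)) a b (Cminus l m).
Proof. intros H1 H2. exact (is_RInt_minus _ _ _ _ _ _ H1 H2). Qed.

Lemma CRint_bound F (g : R -> R) a b l y : a <= b ->
  (forall s, a <= s <= b -> Cmod (F s) <= g s) -> CRint F a b l -> is_RInt g a b y -> Cmod l <= y.
Proof.
  intros Hab H HF Hg. rewrite <- C_R_norm.
  apply (norm_RInt_le F g a b l y); auto. intros s Hs. rewrite C_R_norm. auto.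
Qed.

Lemma CRint_bound_const F a b l M : a <= b ->
  (forall s, a <= s <= b -> Cmod (F s) <= M) -> CRint F a b l -> Cmod l <= (b - a) * M.
Proof.
  intros Hab H HF. rewrite <- C_R_norm.
  apply (norm_RInt_le_const F a b l M); auto. intros s Hs. rewrite C_R_norm. auto.
Qed.

Definition imp (F : R -> C) (t : R) (I : C) : Prop :=
  forall eps, 0 < eps -> exists d, 0 < d /\ forall a, 0 < a < d ->
    exists y, CRint F a t y /\ Cmod (Cminus y I) <= eps.

Lemma C_R_ball_of_Cmod (x y : C) (e : posreal) : Cmod (Cminus y x) < e ->
  ball (M := C_R_CompleteNormedModule) x e y.
Proof.
  intros H. apply (norm_compat1 (V := C_R_CompleteNormedModule)).
  change (norm (V := C_R_CompleteNormedModule) (Cminus y x) < e). rewrite C_R_norm. exact H.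
Qed.

Lemma C_R_Cmod_of_ball (x y : C) (e : posreal) :
  ball (M := C_R_CompleteNormedModule) x e y -> Cmod (Cminus y x) < 2 * e.
Proof.
  intros [H1 H2]. change (Rabs (fst y - fst x) < e) in H1. change (Rabs (snd y - snd x) < e) in H2.
  destruct x, y; simpl in *. eapply Rle_lt_trans; [apply Cmod_le_sum|]. unfold Rminus in *. simpl. lra.
Qed.

Lemma imp_iff F t I : 0 < t ->
  imp F t I <-> is_RInt_gen (V := C_R_CompleteNormedModule) F (at_right 0) (at_point t) I.
Proof.
  intros Ht. split.
  - intros H P [e He].
    destruct (H (e / 2)) as [d [Hd HH]]; [destruct e; simpl; lra|].
    apply (Filter_prod _ _ _ (fun a => 0 < a < d) (fun b => b = t)).
    + exists (mkposreal d Hd). intros y Hy Hy0. unfold ball in Hy; simpl in Hy.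
      unfold AbsRing_ball, abs, minus, plus, opp in Hy; simpl in Hy.
      apply Rabs_def2 in Hy. lra.
    + reflexivity.
    + intros a b Ha ->. destruct (HH a Ha) as [y [Hy1 Hy2]]. exists y. split; auto.
      apply He. apply C_R_ball_of_Cmod. destruct e; simpl in *; lra.
  - intros H eps He.
    assert (He2 : 0 < eps / 2) by lra.
    destruct (H (fun y => Cmod (Cminus y I) <= eps)) as [Q R0 HQ HR HP].
    { exists (mkposreal _ He2). intros y Hy. apply C_R_Cmod_of_ball in Hy. simpl in Hy. lra. }
    destruct HQ as [d Hd]. exists d. split; [apply cond_pos|]. intros a Ha.
    apply (HP a t).
    + apply Hd; [|lra]. unfold ball; simpl. unfold AbsRing_ball, abs, minus, plus, opp; simpl.
      rewrite Rabs_pos_eq; lra.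
    + apply HR.
Qed.

Lemma imp_scal c F t I : imp F t I -> imp (fun s => Cmult c (F s)) t (Cmult c I).
Proof.
  intros H eps He. pose proof (Cmod_ge_0 c) as Hc.
  destruct (H (eps / (1 + Cmod c))) as [d [Hd HH]]; [apply Rdiv_lt_0_compat; lra|].
  exists d. split; auto. intros a Ha. destruct (HH a Ha) as [y [Hy1 Hy2]].
  exists (Cmult c y). split; [apply CRint_mult; auto|].
  replace (Cminus _ _) with (Cmult c (Cminus y I)) by ring. rewrite Cmod_mult.
  apply Rle_trans with (Cmod c * (eps / (1 + Cmod c))); [apply Rmult_le_compat_l; auto|].
  replace (Cmod c * (eps / (1 + Cmod c))) with (eps - eps / (1 + Cmod c)) by (field; lra).
  assert (0 < eps / (1 + Cmod c)) by (apply Rdiv_lt_0_compat; lra). lra.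
Qed.

Lemma imp_plus F G t I J : imp F t I -> imp G t J -> imp (fun s => Cplus (F s) (G s)) t (Cplus I J).
Proof.
  intros H1 H2 eps He. destruct (H1 (eps / 2)) as [d1 [Hd1 HH1]]; [lra|].
  destruct (H2 (eps / 2)) as [d2 [Hd2 HH2]]; [lra|].
  exists (Rmin d1 d2). split; [apply Rmin_pos; auto|]. intros a Ha.
  pose proof (Rmin_l d1 d2). pose proof (Rmin_r d1 d2).
  destruct (HH1 a ltac:(lra)) as [y [Hy1 Hy2]]. destruct (HH2 a ltac:(lra)) as [z [Hz1 Hz2]].
  exists (Cplus y z). split; [apply CRint_plus; auto|].
  replace (Cminus _ _) with (Cplus (Cminus y I) (Cminus z J)) by ring.
  eapply Rle_trans; [apply Cmod_triangle|]. lra.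
Qed.

Lemma imp_ext F G t I : (forall s, F s = G s) -> imp F t I -> imp G t I.
Proof. intros H. replace G with F; auto. apply functional_extensionality; auto. Qed.

Lemma imp_minus F G t I J : imp F t I -> imp G t J -> imp (fun s => Cminus (F s) (G s)) t (Cminus I J).
Proof.
  intros H1 H2. pose proof (imp_plus _ _ _ _ _ H1 (imp_scal (Copp (RtoC 1)) _ _ _ H2)) as H.
  replace (Cminus I J) with (Cplus I (Cmult (Copp (RtoC 1)) J)) by ring.
  revert H. apply imp_ext. intros s. ring.
Qed.

Lemma imp_zero t : 0 < t -> imp (fun _ => RtoC 0) t (RtoC 0).
Proof.
  intros Ht eps He. exists t. split; auto. intros a Ha. exists (RtoC 0). split.
  - apply CRint_components. simpl. split.
    + pose proof (is_RInt_const (V := R_NormedModule) a t 0) as H.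
      unfold scal in H; simpl in H. unfold mult in H; simpl in H. rewrite Rmult_0_r in H. exact H.
    + pose proof (is_RInt_const (V := R_NormedModule) a t 0) as H.
      unfold scal in H; simpl in H. unfold mult in H; simpl in H. rewrite Rmult_0_r in H. exact H.
  - replace (Cminus _ _) with (RtoC 0) by ring. rewrite Cmod_0. lra.
Qed.

Lemma imp_csum {A} (l : list A) (c : A -> C) (F : A -> R -> C) t (I : A -> C) : 0 < t ->
  (forall x, imp (F x) t (I x)) ->
  imp (fun s => csum l (fun x => Cmult (c x) (F x s))) t (csum l (fun x => Cmult (c x) (I x))).
Proof.
  intros Ht H. induction l as [|x l IH]; simpl.
  - apply imp_zero; auto.
  - apply (imp_plus (fun s => Cmult (c x) (F x s))); auto. apply imp_scal, H.
Qed.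

Lemma imp_bound F t I (g : R -> R) B : 0 < t -> imp F t I ->
  (forall s, 0 < s <= t -> Cmod (F s) <= g s) ->
  (forall a, 0 < a < t -> exists y, is_RInt g a t y /\ y <= B) -> Cmod I <= B.
Proof.
  intros Ht H Hg HB. apply Rnot_lt_le. intros L.
  destruct (H ((Cmod I - B) / 2)) as [d [Hd HH]]; [lra|].
  set (a := Rmin d t / 2).
  assert (Ha : 0 < a < d /\ a < t).
  { unfold a. pose proof (Rmin_l d t). pose proof (Rmin_r d t). pose proof (Rmin_pos d t Hd Ht). lra. }
  destruct (HH a ltac:(lra)) as [y [Hy1 Hy2]]. destruct (HB a ltac:(lra)) as [z [Hz1 Hz2]].
  assert (Cmod y <= z) by (apply (CRint_bound F g a t); auto; [lra|intros s Hs; apply Hg; lra]).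
  pose proof (Cmod_triangle (Cminus I y) y) as T.
  replace (Cplus (Cminus I y) y) with I in T by ring. rewrite Cmod_minus_sym in Hy2. lra.
Qed.

(** * Integrals of powers and the beta-type integral *)

Lemma is_derive_Rpower p x : 0 < x -> is_derive (fun s => Rpower s p) x (p * Rpower x (p - 1)).
Proof.
  intros Hx. unfold Rpower. auto_derive; auto.
  replace ((p - 1) * ln x) with (p * ln x + - ln x) by ring.
  rewrite exp_plus, exp_Ropp, exp_ln by auto. field. lra.
Qed.

Lemma continuous_Rpower p x : 0 < x -> continuous (fun s => Rpower s p) x.
Proof.
  intros Hx. apply (ex_derive_continuous (V := R_NormedModule)). eexists. apply is_derive_Rpower; auto.
Qed.

Lemma is_RInt_Rpower q a b : q < 1 -> 0 < a <= b ->
  is_RInt (fun s => Rpower s (- q)) a b ((Rpower b (1 - q) - Rpower a (1 - q)) / (1 - q)).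
Proof.
  intros Hq Hab.
  replace ((Rpower b (1 - q) - Rpower a (1 - q)) / (1 - q)) with
    (minus ((fun s => / (1 - q) * Rpower s (1 - q)) b) ((fun s => / (1 - q) * Rpower s (1 - q)) a))
    by (unfold minus, plus, opp; simpl; field; lra).
  apply (is_RInt_derive (fun s => / (1 - q) * Rpower s (1 - q)) (fun s => Rpower s (- q))); rewrite Rmin_left, Rmax_right by lra; intros x Hx.
  - replace (Rpower x (- q)) with (/ (1 - q) * ((1 - q) * Rpower x (1 - q - 1))).
    + apply (is_derive_scal (fun s => Rpower s (1 - q))). apply is_derive_Rpower. lra.
    + replace (1 - q - 1) with (- q) by ring. field. lra.
  - apply continuous_Rpower. lra.
Qed.

Lemma is_RInt_Rpower_refl r t sg a : r < 1 -> 0 < sg -> a <= t ->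
  is_RInt (fun s => Rpower (t - s + sg) (- r)) a t
   ((Rpower (t - a + sg) (1 - r) - Rpower sg (1 - r)) / (1 - r)).
Proof.
  intros Hr Hs Hat.
  set (G := fun s => - / (1 - r) * Rpower (t - s + sg) (1 - r)).
  replace ((Rpower (t - a + sg) (1 - r) - Rpower sg (1 - r)) / (1 - r)) with (minus (G t) (G a)).
  2:{ unfold minus, plus, opp, G; simpl. replace (t - t + sg) with sg by ring. field. lra. }
  apply (is_RInt_derive G (fun s => Rpower (t - s + sg) (- r))); rewrite Rmin_left, Rmax_right by lra; intros x Hx.
  - unfold G, Rpower. auto_derive; [try lra|].
    replace (- r * ln (t - x + sg)) with ((1 - r) * ln (t - x + sg) + - ln (t - x + sg)) by ring.
    rewrite exp_plus, exp_Ropp, exp_ln by lra.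
    replace (t + - x + sg) with (t - x + sg) by ring. field. split; lra.
  - apply (continuous_comp (fun s => t - s + sg) (fun s => Rpower s (- r))).
    + apply (ex_derive_continuous (V := R_NormedModule)). auto_derive. auto.
    + apply continuous_Rpower. lra.
Qed.

Lemma Rpower_le_compat_neg x y r : 0 < x <= y -> 0 <= r -> Rpower y (- r) <= Rpower x (- r).
Proof.
  intros H Hr. rewrite !Rpower_Ropp. apply Rinv_le_contravar; [apply Rpower_pos|].
  apply Rle_Rpower_l; lra.
Qed.

Lemma Rpower_subadd x y p : 0 < x -> 0 < y -> 0 < p <= 1 -> Rpower (x + y) p <= Rpower x p + Rpower y p.
Proof.
  intros Hx Hy Hp.
  assert (E : forall z, 0 < z -> Rpower z p = z * Rpower z (- (1 - p))).
  { intros z Hz. rewrite <- (Rpower_1 z) at 2 by auto. rewrite <- Rpower_plus. f_equal. ring. }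
  rewrite !E by lra. rewrite Rmult_plus_distr_r.
  apply Rplus_le_compat; (apply Rmult_le_compat_l; [lra|apply Rpower_le_compat_neg; lra]).
Qed.

(** On either side of [t / 2] one of the two singular factors is bounded by its value at distance
    [t / 2] from its singularity. Adding both alternatives gives a majorant with an explicit
    antiderivative on the whole interval. *)
Definition beta_major (q r t sg s : R) : R :=
  Rpower (t / 2) (- r) * Rpower s (- q) + Rpower (t / 2) (- q) * Rpower (t - s + sg) (- r).

Lemma beta_major_le q r t sg s : 0 <= q -> 0 <= r -> 0 < sg -> 0 < s <= t ->
  Rpower s (- q) * Rpower (t - s + sg) (- r) <= beta_major q r t sg s.
Proof.
  intros Hq Hr Hsg Hs. unfold beta_major.
  pose proof (Rpower_pos s (- q)). pose proof (Rpower_pos (t - s + sg) (- r)).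
  pose proof (Rpower_pos (t / 2) (- r)). pose proof (Rpower_pos (t / 2) (- q)).
  destruct (Rle_dec s (t / 2)).
  - assert (Rpower (t - s + sg) (- r) <= Rpower (t / 2) (- r)) by (apply Rpower_le_compat_neg; lra). nra.
  - assert (Rpower s (- q) <= Rpower (t / 2) (- q)) by (apply Rpower_le_compat_neg; lra). nra.
Qed.

Lemma beta_major_int q r : 0 <= q < 1 -> 0 <= r < 1 -> exists Cb, 0 < Cb /\
  forall t sg a, 0 < sg -> 0 < a < t ->
  exists y, is_RInt (beta_major q r t sg) a t y /\ y <= Cb * Rpower t (1 - q - r).
Proof.
  intros Hq Hr. exists (Rpower 2 r / (1 - q) + Rpower 2 q / (1 - r)). split.
  { pose proof (Rpower_pos 2). apply Rplus_lt_0_compat; apply Rdiv_lt_0_compat; auto; lra. }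
  intros t sg a Hsg Ha.
  exists (Rpower (t / 2) (- r) * ((Rpower t (1 - q) - Rpower a (1 - q)) / (1 - q)) +
     Rpower (t / 2) (- q) * ((Rpower (t - a + sg) (1 - r) - Rpower sg (1 - r)) / (1 - r))).
  split.
  - apply (is_RInt_plus (V := R_NormedModule)); apply (is_RInt_scal (V := R_NormedModule)).
    + apply is_RInt_Rpower; lra.
    + apply is_RInt_Rpower_refl; lra.
  - assert (H2 : forall p, Rpower (t / 2) (- p) = Rpower 2 p * Rpower t (- p)).
    { intros p. unfold Rdiv. rewrite <- Rpower_mult_distr by lra. rewrite Rmult_comm. f_equal.
      unfold Rpower. rewrite ln_Rinv by lra. f_equal. ring. }
    rewrite !H2, Rmult_plus_distr_r.
    assert (E1 : Rpower t (1 - q - r) = Rpower t (1 - q) * Rpower t (- r)) by (rewrite <- Rpower_plus; f_equal; ring).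
    assert (E2 : Rpower t (1 - q - r) = Rpower t (1 - r) * Rpower t (- q)) by (rewrite <- Rpower_plus; f_equal; ring).
    assert (Q : 0 < / (1 - q)) by (apply Rinv_0_lt_compat; lra).
    assert (R1 : 0 < / (1 - r)) by (apply Rinv_0_lt_compat; lra).
    apply Rplus_le_compat.
    + rewrite E1. unfold Rdiv.
      replace (Rpower 2 r * / (1 - q) * (Rpower t (1 - q) * Rpower t (- r))) with
        (Rpower 2 r * Rpower t (- r) * (Rpower t (1 - q) * / (1 - q))) by ring.
      apply Rmult_le_compat_l; [nonneg|]. apply Rmult_le_compat_r; [lra|].
      pose proof (Rpower_pos a (1 - q)). lra.
    + rewrite E2. unfold Rdiv.
      replace (Rpower 2 q * / (1 - r) * (Rpower t (1 - r) * Rpower t (- q))) with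
        (Rpower 2 q * Rpower t (- q) * (Rpower t (1 - r) * / (1 - r))) by ring.
      apply Rmult_le_compat_l; [nonneg|]. apply Rmult_le_compat_r; [lra|].
      pose proof (Rpower_subadd (t - a) sg (1 - r) ltac:(lra) Hsg ltac:(lra)).
      assert (Rpower (t - a) (1 - r) <= Rpower t (1 - r)) by (apply Rle_Rpower_l; lra). lra.
Qed.

(** * Existence of the improper integral *)

Definition ccont (D : R -> Prop) (F : R -> C) : Prop :=
  forall t, D t -> forall eps, 0 < eps -> exists delta, 0 < delta /\
    forall s, D s -> Rabs (s - t) < delta -> Cmod (Cminus (F s) (F t)) <= eps.

Lemma ccont_ex_RInt F t a : 0 < a < t -> ccont (fun s => 0 < s <= t) F ->
  exists y, CRint F a t y.
Proof.
  intros Ha HF.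
  assert (H : ex_RInt (V := C_R_CompleteNormedModule) F a t); [|destruct H as [y Hy]; exists y; auto].
  (* Continuity at the endpoint [t] is one-sided; freezing [F] beyond [t] makes it two-sided. *)
  apply (ex_RInt_ext (V := C_R_CompleteNormedModule) (fun s => F (Rmin s t))).
  { intros x. rewrite Rmin_left, Rmax_right by lra. intros Hx. rewrite Rmin_left by lra. reflexivity. }
  apply (ex_RInt_continuous (V := C_R_CompleteNormedModule)).
  intros z. rewrite Rmin_left, Rmax_right by lra. intros Hz.
  apply filterlim_locally. intros e.
  destruct (HF (Rmin z t) ltac:(rewrite Rmin_left; lra) (e / 2)) as [d [Hd HH]]; [destruct e; simpl; lra|].
  assert (Hd' : 0 < Rmin d a) by (apply Rmin_pos; lra).
  exists (mkposreal _ Hd'). intros y Hy. apply C_R_ball_of_Cmod.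
  assert (Hy' : Rabs (y - z) < Rmin d a) by exact Hy.
  pose proof (Rmin_l d a). pose proof (Rmin_r d a).
  apply Rabs_def2 in Hy'.
  assert (B : Cmod (Cminus (F (Rmin y t)) (F (Rmin z t))) <= e / 2).
  { apply HH.
    - split; [apply Rmin_glb_lt; lra|apply Rmin_r].
    - rewrite (Rmin_left z t) by lra. unfold Rmin. destruct (Rle_dec y t); apply Rabs_def1; lra. }
  destruct e; simpl in *; lra.
Qed.

(** As [q < 1], the part of the integral below [b] is of order [b ^ (1 - q)]. The integrals from the
    halving points [t / 2 ^ (n + 1)] are thus Cauchy at a geometric rate, and the same bound covers
    every lower endpoint. *)
Lemma imp_exists F t A q : 0 < t -> 0 <= A -> 0 <= q < 1 ->
  ccont (fun s => 0 < s <= t) F ->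
  (forall s, 0 < s <= t -> Cmod (F s) <= A * Rpower s (- q)) -> exists I, imp F t I.
Proof.
  intros Ht HA Hq HF HB.
  assert (T : forall a b y z, 0 < a <= b -> b < t -> CRint F a t y -> CRint F b t z ->
     Cmod (Cminus y z) <= A / (1 - q) * Rpower b (1 - q)).
  { intros a b y z Hab Hbt Hy Hz.
    assert (H : CRint F a b (Cminus y z)).
    { pose proof (is_RInt_Chasles _ _ _ _ _ _ Hy (is_RInt_swap _ _ _ _ Hz)) as H. exact H. }
    pose proof (is_RInt_scal (V := R_NormedModule) _ _ _ A _ (is_RInt_Rpower q a b ltac:(lra) Hab)) as HR.
    eapply Rle_trans; [apply (CRint_bound F (fun s => A * Rpower s (- q)) a b _ _ ltac:(lra)); [|exact H|exact HR]|].
    - intros s Hs. apply HB. lra.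
    - unfold scal; simpl. unfold mult; simpl. pose proof (Rpower_pos a (1 - q)).
      unfold Rdiv. assert (0 < / (1 - q)) by (apply Rinv_0_lt_compat; lra).
      rewrite (Rmult_comm _ (/ (1 - q))), <- Rmult_assoc. apply Rmult_le_compat_l; [nonneg|lra]. }
  set (an := fun n => t / 2 * (/ 2) ^ n).
  assert (Han : forall n, 0 < an n < t).
  { intros n. unfold an. assert (0 < (/ 2) ^ n <= 1).
    { split; [apply pow_lt; lra|]. rewrite <- (pow1 n). apply pow_incr; lra. } nra. }
  assert (HU : forall n, exists y, CRint F (an n) t y) by (intros n; apply ccont_ex_RInt; auto).
  set (u := fun n => RInt (V := C_R_CompleteNormedModule) F (an n) t).
  assert (Hu : forall n, CRint F (an n) t (u n)).
  { intros n. apply (RInt_correct (V := C_R_CompleteNormedModule)). destruct (HU n) as [y Hy]. exists y; auto. }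
  set (r := Rpower (/ 2) (1 - q)).
  assert (Hr : 0 <= r < 1).
  { unfold r. split; [left; apply Rpower_pos|]. apply (Rlt_le_trans _ (exp 0)); [|rewrite exp_0; lra].
    unfold Rpower. apply exp_increasing. rewrite ln_Rinv by lra. assert (0 < ln 2) by (rewrite <- ln_1; apply ln_increasing; lra). nra. }
  set (K := A / (1 - q) * Rpower (t / 2) (1 - q)).
  assert (HK : 0 <= K).
  { unfold K, Rdiv. assert (0 < / (1 - q)) by (apply Rinv_0_lt_compat; lra). nonneg. }
  assert (EK : forall n, A / (1 - q) * Rpower (an n) (1 - q) = K * r ^ n).
  { intros n. unfold K, r, an. rewrite <- Rpower_mult_distr by (try apply pow_lt; lra).
    rewrite Rmult_assoc. f_equal. f_equal.
    rewrite <- !Rpower_pow by (try apply Rpower_pos; lra). rewrite !Rpower_mult. f_equal. ring. }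
  destruct (cvgc_geom u K r Hr HK) as [L HL].
  { intros n. rewrite <- EK. apply (T (an (S n)) (an n)); auto.
    - split; [apply Han|]. unfold an. simpl. assert (0 < (/ 2) ^ n) by (apply pow_lt; lra). nra.
    - apply Han. }
  exists (Clim_seq u). intros eps He.
  assert (Lr : is_lim_seq (fun n => K * (1 + / (1 - r)) * r ^ n) 0).
  { replace 0 with (K * (1 + / (1 - r)) * 0) by ring. apply (is_lim_seq_scal_l _ _ 0).
    apply is_lim_seq_geom. rewrite Rabs_pos_eq; lra. }
  apply is_lim_seq_spec in Lr. destruct (Lr (mkposreal _ He)) as [N HN].
  specialize (HN N (le_n _)). rewrite Rminus_0_r in HN. simpl in HN. apply Rabs_def2 in HN.
  exists (an N). split; [apply Han|]. intros a Ha. pose proof (Han N).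
  destruct (ccont_ex_RInt F t a ltac:(lra) HF) as [y Hy]. exists y. split; auto.
  replace (Cminus y (Clim_seq u)) with (Cplus (Cminus y (u N)) (Copp (Cminus (Clim_seq u) (u N)))) by ring.
  eapply Rle_trans; [apply Cmod_triangle|]. rewrite Cmod_opp.
  pose proof (T a (an N) y (u N) ltac:(lra) ltac:(lra) Hy (Hu N)) as T1. rewrite EK in T1.
  specialize (HL N). unfold Rdiv in HL. lra.
Qed.

(** * Time continuity *)

Definition coef_cont (D : R -> Prop) (f : R -> Dist) : Prop := forall k, ccont D (fun t => f t k).

Lemma besov_cont_coef a D f : besov_continuous_on a D f -> coef_cont D f.
Proof.
  intros H k t Ht eps He. pose proof (coefC_pos a k) as P.
  destruct (H t Ht (eps / coefC a k)) as [d [Hd HH]]; [apply Rdiv_lt_0_compat; auto|].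
  exists d. split; auto. intros s Hs Hst.
  pose proof (besov_coef _ _ _ k (HH s Hs Hst)) as B. unfold dsub in B.
  replace (eps / coefC a k * coefC a k) with eps in B by (field; lra). exact B.
Qed.

Lemma uniform_delta {A} (l : list A) (P : A -> R -> Prop) :
  (forall x d d', P x d -> 0 < d' <= d -> P x d') ->
  (forall x, exists d, 0 < d /\ P x d) -> exists d, 0 < d /\ forall x, In x l -> P x d.
Proof.
  intros M H. induction l as [|x l [d [Hd IH]]]; [exists 1; split; [lra|intros x []]|].
  destruct (H x) as [e [He Hx]]. pose proof (Rmin_l d e). pose proof (Rmin_r d e).
  exists (Rmin d e). split; [apply Rmin_pos; auto|].
  pose proof (Rmin_pos d e Hd He).
  intros y [<-|Hy]; [apply (M x e); auto|apply (M y d); auto].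
Qed.

(* Interpolation: high-frequency blocks are small by the bound in [C^b], and the finitely many
   remaining blocks are controlled by finitely many Fourier coefficients. *)
Lemma besov_cont_of_coef a b D f : a < b -> coef_cont D f ->
  (forall t, D t -> exists d K, 0 < d /\ forall s, D s -> Rabs (s - t) < d -> besov_le b (f s) K) ->
  besov_continuous_on a D f.
Proof.
  intros Hab Hc Hb t Ht eps He.
  destruct (Hb t Ht) as [d0 [K [Hd0 HK]]].
  assert (Kt : besov_le b (f t) K) by (apply HK; auto; rewrite Rminus_diag, Rabs_R0; auto).
  assert (LN : exists N, forall n, (N <= n)%nat -> 2 * K * wt (- (b - a)) n <= eps).
  { set (r := Rpower 2 (- (b - a))).
    assert (Hr : 0 <= r < 1).
    { split; [left; apply Rpower_pos|]. unfold r. rewrite <- (Rpower_O 2) by lra. apply Rpower_lt; lra. }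
    assert (Lr : is_lim_seq (fun n => 2 * K * Rpower 2 (b - a) * r ^ n) 0).
    { replace 0 with (2 * K * Rpower 2 (b - a) * 0) by ring. apply (is_lim_seq_scal_l _ _ 0).
      apply is_lim_seq_geom. rewrite Rabs_pos_eq; lra. }
    apply is_lim_seq_spec in Lr. destruct (Lr (mkposreal _ He)) as [N HN]. exists N. intros n Hn.
    specialize (HN n Hn). rewrite Rminus_0_r in HN. simpl in HN. apply Rabs_def2 in HN.
    assert (E : wt (- (b - a)) n = Rpower 2 (b - a) * r ^ n).
    { unfold r. rewrite <- Rpower_pow, Rpower_mult, <- Rpower_plus by apply Rpower_pos.
      unfold wt. f_equal. ring. }
    rewrite E. lra. }
  destruct LN as [N HN].
  set (bx := box (2 ^ (N + 1))).
  (* Each of the finitely many coefficients may move by [eta]; the power of two is a lower bound for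
     the weights [wt (- a) n] with [n <= N], whatever the sign of [a]. *)
  set (eta := eps * Rpower 2 (- (Rabs a * (INR N + 1))) / (INR (length bx) + 1)).
  assert (PL : 0 <= INR (length bx)) by apply pos_INR.
  assert (Heta : 0 < eta).
  { unfold eta. apply Rdiv_lt_0_compat; [|lra]. apply Rmult_lt_0_compat; auto. apply Rpower_pos. }
  destruct (uniform_delta bx (fun k d => forall s, D s -> Rabs (s - t) < d -> Cmod (Cminus (f s k) (f t k)) <= eta))
    as [d1 [Hd1 HH]].
  { intros k d d' H Hd s Hs Hst. apply H; auto. lra. }
  { intros k. apply (Hc k t Ht eta Heta). }
  exists (Rmin d0 d1). split; [apply Rmin_pos; auto|]. intros s Hs Hst.
  pose proof (Rmin_l d0 d1). pose proof (Rmin_r d0 d1).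
  rewrite besov_le_iff. intros n x1 x2. destruct (le_lt_dec N n) as [L|L].
  - pose proof (besov_sub _ _ _ _ _ (HK s Hs ltac:(lra)) Kt) as B. rewrite besov_le_iff in B.
    eapply Rle_trans; [apply B|].
    replace (- b) with (- (b - a) + - a) by ring. rewrite wt_plus, <- Rmult_assoc.
    apply Rmult_le_compat_r; [left; apply wt_pos|]. specialize (HN n L). lra.
  - rewrite (LP_block_ev_big n (2 ^ (N + 1))) by (apply pow2_le_mono; lia).
    eapply Rle_trans; [apply Cmod_ev_le|]. fold bx.
    eapply Rle_trans; [apply (rsum_le_const _ _ eta)|].
    + intros k Hk. rewrite Cmod_mult. pose proof (Cmod_rho_sym_le1 n k).
      pose proof (HH k Hk s Hs ltac:(lra)) as B.
      change (Cmod (dsub (f s) (f t) k) <= eta) in B.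
      pose proof (Cmod_ge_0 (dsub (f s) (f t) k)). nra.
    + apply Rle_trans with (eps * Rpower 2 (- (Rabs a * (INR N + 1)))).
      * unfold eta. set (y := eps * Rpower 2 (- (Rabs a * (INR N + 1)))).
        assert (0 <= y) by (unfold y; nonneg).
        replace (INR (length bx) * (y / (INR (length bx) + 1))) with (y - y / (INR (length bx) + 1)) by (field; lra).
        assert (0 <= y / (INR (length bx) + 1)) by (apply Rdiv_le_0_compat; lra). lra.
      * apply Rmult_le_compat_l; [lra|]. apply Rpower2_mono.
        assert (0 <= INR n) by apply pos_INR. assert (INR n <= INR N) by (apply le_INR; lia).
        pose proof (Rle_abs a). pose proof (Rle_abs (- a)). rewrite Rabs_Ropp in *.
        nra.
Qed.

(** * The nonlinearity *)

Lemma rel_A_ge0 a A d f g : rel a A d f g -> 0 <= A.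
Proof. intros [H _]. eapply besov_le_ge0; eauto. Qed.

Lemma rel_add a A B d f g f' g' :
  rel a A d f g -> rel a B d f' g' -> rel a (A + B) d (dadd f f') (dadd g g').
Proof.
  intros [H1 [H2 H3]] [G1 [G2 G3]]. split; [apply besov_add; auto|split; [apply besov_add; auto|]].
  replace (dsub (dadd f f') (dadd g g')) with (dadd (dsub f g) (dsub f' g'))
    by (apply functional_extensionality; intros k; unfold dadd, dsub; ring).
  rewrite Rmult_plus_distr_r. apply besov_add; auto.
Qed.

Lemma rel_scal a A d c f g : rel a A d f g -> rel a (Cmod c * A) d (dscal c f) (dscal c g).
Proof.
  intros [H1 [H2 H3]]. split; [apply besov_scal; auto|split; [apply besov_scal; auto|]].
  replace (dsub (dscal c f) (dscal c g)) with (dscal c (dsub f g))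
    by (apply functional_extensionality; intros k; unfold dscal, dsub; ring).
  rewrite Rmult_assoc. apply besov_scal; auto.
Qed.

Lemma rel_csum {A} a (l : list A) (F G : A -> Dist) (K : A -> R) d :
  (forall x, In x l -> rel a (K x) d (F x) (G x)) ->
  rel a (rsum l K) d (fun k => csum l (fun x => F x k)) (fun k => csum l (fun x => G x k)).
Proof.
  induction l as [|x l IH]; intros H; simpl.
  - split; [apply besov_zero|split; [apply besov_zero|]]. rewrite Rmult_0_l.
    replace (dsub _ _) with dzero; [apply besov_zero|].
    apply functional_extensionality; intros k. unfold dsub, dzero. ring.
  - apply (rel_add a _ _ _ (F x) (G x)); [apply H; left; auto|apply IH; intros; apply H; right; auto].
Qed.

Lemma rel_weaken_mult a A d c f g : 0 <= d -> 1 <= c -> rel a A (c * d) f g -> rel a (c * A) d f g.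
Proof.
  intros Hd Hc H. pose proof (rel_A_ge0 _ _ _ _ _ H) as P. destruct H as [H1 [H2 H3]].
  split; [|split]; eapply besov_le_mono; eauto; nra.
Qed.

Lemma unif_const (P : nat -> R -> Prop) : (forall i c c', P i c -> c <= c' -> P i c') ->
  (forall i, exists c, 0 < c /\ P i c) -> forall n, exists c, 0 < c /\ forall i, (i <= n)%nat -> P i c.
Proof.
  intros M H n. induction n as [|n [c [Hc IH]]].
  - destruct (H 0%nat) as [c [Hc Hp]]. exists c. split; auto. intros i Hi. replace i with 0%nat by lia. auto.
  - destruct (H (S n)) as [c' [Hc' Hp]]. exists (c + c'). split; [lra|]. intros i Hi.
    destruct (Nat.eq_dec i (S n)) as [->|N].
    + apply (M _ c'); auto; lra.
    + apply (M _ c); [apply IH; lia|lra].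
Qed.

Section Nonlinearity.
Variables (m : nat) (nu tau : C) (beta alpha : R).
Hypotheses (Hbeta : 0 < beta) (Halpha : 0 < alpha < beta / 4).

Definition mono_term (i j : nat) (v Z : Dist) : Dist := dmul (dmul (dpow v i) (dpow (dconj v) j)) Z.

Lemma mono_term_rel i j : exists Cm, 0 < Cm /\ forall v w A d Z Z' AZ,
  0 <= d -> rel beta A d v w -> rel (- alpha) AZ d Z Z' ->
  rel (- (2 * alpha)) (Cm * (A ^ i * A ^ j * AZ)) d (mono_term i j v Z) (mono_term i j w Z').
Proof.
  (* Regularity is spent in steps: [3/4 beta] and [5/8 beta] for the two powers, [beta / 2] for
     their product, and [- 2 alpha] after the noise. The last product takes as rate half of
     [beta / 2 - alpha], its resonance margin. *)
  destruct (dpow_rel beta i Hbeta (3 / 4 * beta)) as [C1 [P1 H1]]; [lra|].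
  destruct (dpow_rel beta j Hbeta (5 / 8 * beta)) as [C2 [P2 H2]]; [lra|].
  destruct (dmul_rel (3 / 4 * beta) (5 / 8 * beta) (5 / 8 * beta) (beta / 2)) as [C3 [P3 H3]]; try lra.
  destruct (dmul_rel (beta / 2) (- alpha) ((beta / 2 - alpha) / 2) (- (2 * alpha))) as [C4 [P4 H4]]; try lra.
  exists ((INR i + INR j + 1) * (C4 * C3 * C1 * C2)).
  assert (Pij : 1 <= INR i + INR j + 1) by (pose proof (pos_INR i); pose proof (pos_INR j); lra).
  split; [repeat apply Rmult_lt_0_compat; auto; lra|].
  intros v w A d Z Z' AZ Hd Hv HZ.
  specialize (H1 v w A d Hd Hv). specialize (H2 _ _ A d Hd (rel_conj _ _ _ _ _ Hv)).
  specialize (H3 _ _ _ _ _ _ _ _ H1 H2). specialize (H4 _ _ _ _ _ _ _ _ H3 HZ).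
  (* The relative differences add up to [(i + j + 1) d]; the factor is moved into the size, so that
     all monomials share the same [d]. *)
  rewrite Rmult_assoc. apply rel_weaken_mult; auto.
  replace (C4 * C3 * C1 * C2 * (A ^ i * A ^ j * AZ)) with
    (C4 * (C3 * (C1 * A ^ i * (C2 * A ^ j)) * AZ)) by ring.
  replace ((INR i + INR j + 1) * d) with (INR i * d + INR j * d + d) by ring. exact H4.
Qed.

Lemma mono_term_rel_unif : exists Cm, 0 < Cm /\ forall i j, (i <= m + 1)%nat -> (j <= m)%nat ->
  forall v w A d Z Z' AZ, 0 <= d -> rel beta A d v w -> rel (- alpha) AZ d Z Z' ->
  rel (- (2 * alpha)) (Cm * (A ^ i * A ^ j * AZ)) d (mono_term i j v Z) (mono_term i j w Z').
Proof.
  set (P := fun i j c => forall v w A d Z Z' AZ, 0 <= d -> rel beta A d v w -> rel (- alpha) AZ d Z Z' ->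
    rel (- (2 * alpha)) (c * (A ^ i * A ^ j * AZ)) d (mono_term i j v Z) (mono_term i j w Z')).
  assert (M : forall i j c c', P i j c -> c <= c' -> P i j c').
  { intros i j c c' H L v w A d Z Z' AZ Hd Hv HZ.
    pose proof (rel_A_ge0 _ _ _ _ _ Hv). pose proof (rel_A_ge0 _ _ _ _ _ HZ).
    eapply rel_mono; [apply (H v w A d Z Z' AZ); auto| |apply Rle_refl|auto].
    apply Rmult_le_compat_r; auto.
    apply Rmult_le_pos; auto. apply Rmult_le_pos; apply pow_le; auto. }
  destruct (unif_const (fun i c => forall j, (j <= m)%nat -> P i j c)) with (n := (m + 1)%nat) as [c [Hc H]].
  - intros i c c' H L j Hj. apply (M i j c c'); auto.
  - intros i. apply (unif_const (P i)); [intros j; apply M|]. intros j. apply mono_term_rel.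
  - exists c. split; auto. intros i j Hi Hj. apply (H i Hi j Hj).
Qed.

Lemma Psi_csum v Zt Zij : Psi m nu tau v Zt Zij =
  dadd (dscal (Copp nu) (fun k => csum (seq 0 (m + 1 + 1)) (fun i => csum (seq 0 (m + 1)) (fun j =>
     dscal (RtoC (binom (m + 1) i * binom m j)) (mono_term i j v (Zext Zt Zij (m + 1 - i) (m - j))) k))))
   (dscal (Cplus tau (RtoC 1)) (dadd v Zt)).
Proof.
  unfold Psi. f_equal. f_equal. apply functional_extensionality. intros k.
  rewrite sum_n_csum. apply csum_ext. intros i _. rewrite sum_n_csum. reflexivity.
Qed.

(** Two noises appear because the estimate has two uses: with equal noises it gives the bound and
    the contraction, with the noises at two times it gives time continuity of the source. [Bd] is a
    common bound for all monomials and the linear part. *)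
Definition Psi_rel_const (Cp : R) : Prop := forall v w A d Z Z' Zij Zij' AZ Bd,
  0 <= d -> rel beta A d v w -> rel (- alpha) Bd d Z Z' -> A <= Bd ->
  (forall i j, (i <= m + 1)%nat -> (j <= m)%nat ->
     rel (- alpha) (AZ i j) d (Zext Z Zij (m + 1 - i) (m - j)) (Zext Z' Zij' (m + 1 - i) (m - j))) ->
  (forall i j, (i <= m + 1)%nat -> (j <= m)%nat -> A ^ i * A ^ j * AZ i j <= Bd) ->
  rel (- (2 * alpha)) (Cp * Bd) d (Psi m nu tau v Z Zij) (Psi m nu tau w Z' Zij').

Lemma Psi_rel : exists Cp, 0 < Cp /\ Psi_rel_const Cp.
Proof.
  destruct mono_term_rel_unif as [Cm [PC HC]].
  set (S0 := rsum (seq 0 (m + 1 + 1)) (fun i => rsum (seq 0 (m + 1)) (fun j =>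
     Rabs (binom (m + 1) i * binom m j) * Cm))).
  set (S1 := Rpower 2 (beta - - (2 * alpha)) + Rpower 2 (- alpha - - (2 * alpha))).
  assert (P0 : 0 <= S0).
  { unfold S0. apply rsum_ge0; intros i _; apply rsum_ge0; intros j _. pose proof (Rabs_pos (binom (m + 1) i * binom m j)). nra. }
  assert (P1 : 0 < S1) by (unfold S1; posit).
  exists (Cmod (Copp nu) * S0 + Cmod (Cplus tau (RtoC 1)) * S1 + 1).
  split.
  { pose proof (Cmod_ge_0 (Copp nu)). pose proof (Cmod_ge_0 (Cplus tau (RtoC 1))). nra. }
  intros v w A d Z Z' Zij Zij' AZ Bd Hd Hv HZ HA HZij HB.
  pose proof (rel_A_ge0 _ _ _ _ _ HZ) as PB.
  rewrite !Psi_csum.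
  apply (rel_mono _ (Cmod (Copp nu) * (S0 * Bd) + Cmod (Cplus tau (RtoC 1)) * (S1 * Bd)) _ d); try lra.
  apply rel_add; apply rel_scal.
  - replace (S0 * Bd) with (rsum (seq 0 (m + 1 + 1)) (fun i => rsum (seq 0 (m + 1)) (fun j =>
       Rabs (binom (m + 1) i * binom m j) * Cm * Bd))).
    2:{ unfold S0. rewrite Rmult_comm, <- rsum_scal. apply rsum_ext. intros i _.
        rewrite <- rsum_scal. apply rsum_ext. intros j _. ring. }
    apply (rel_csum _ _ (fun i k => csum (seq 0 (m + 1)) (fun j =>
     dscal (RtoC (binom (m + 1) i * binom m j)) (mono_term i j v (Zext Z Zij (m + 1 - i) (m - j))) k))
     (fun i k => csum (seq 0 (m + 1)) (fun j =>
     dscal (RtoC (binom (m + 1) i * binom m j)) (mono_term i j w (Zext Z' Zij' (m + 1 - i) (m - j))) k))).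
    intros i Hi. apply in_seq in Hi. apply rel_csum. intros j Hj. apply in_seq in Hj.
    rewrite Rmult_assoc, <- Cmod_R. apply rel_scal.
    eapply rel_mono; [apply (HC i j ltac:(lia) ltac:(lia) v w A d _ _ (AZ i j)); auto; apply HZij; lia| |lra|auto].
    apply Rmult_le_compat_l; [lra|]. apply HB; lia.
  - unfold S1. rewrite Rmult_plus_distr_r. apply rel_add.
    + eapply rel_mono; [apply (rel_embed beta (- (2 * alpha))); [lra|exact Hv]| |lra|auto].
      apply Rmult_le_compat_l; [left; apply Rpower_pos|auto].
    + apply rel_embed; [lra|auto].
Qed.

(** * Bounds and continuity of the noise terms *)

Section Noise.
Variables (alpha' gamma T K : R) (Zt : R -> Dist) (Zij : nat -> nat -> R -> Dist).
Hypotheses (Hg : 0 < gamma) (Ha' : 0 < alpha' <= gamma).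
Hypothesis HN : noise_norm_le m alpha alpha' T Zt Zij K.

Definition Zpq (p q : nat) (s : R) : Dist := Zext (Zt s) (fun i j => Zij i j s) p q.

(** Elimination principle for [Zext]: a property stable under conjugation is checked on the
    constant, on [Zt] and on the family over [inL]. Swapping indices preserves the total degree, and
    the ranges of [p] and [q] keep the swapped pair in [inL]. *)
Lemma Zpq_cases (P : (R -> Dist) -> Prop) p q : (p <= m + 1)%nat -> (q <= m)%nat ->
  ((p + q = 0)%nat -> P (fun _ => done)) ->
  ((p + q = 1)%nat -> P Zt) ->
  (forall i j, inL m i j -> (i + j = p + q)%nat -> P (Zij i j)) ->
  (forall f, P f -> P (fun s => dconj (f s))) -> P (Zpq p q).
Proof.
  intros Hp Hq H0 H1 H2 HC. unfold Zpq.
  destruct p as [|[|p]]; destruct q as [|[|q]]; cbn [Zext].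
  - apply H0; reflexivity.
  - apply HC, H1; reflexivity.
  - replace (S (S q) <=? 0)%nat with false by reflexivity.
    apply (HC (Zij (S (S q)) 0%nat)), H2; [|lia]. unfold inL. lia.
  - apply H1; reflexivity.
  - replace (1 <=? 1)%nat with true by reflexivity. apply (H2 1%nat 1%nat); [|lia]. unfold inL. lia.
  - replace (S (S q) <=? 1)%nat with false by reflexivity.
    apply (HC (Zij (S (S q)) 1%nat)), H2; [|lia]. unfold inL. lia.
  - replace (0 <=? S (S p))%nat with true by reflexivity. apply (H2 (S (S p)) 0%nat); [|lia]. unfold inL. lia.
  - replace (1 <=? S (S p))%nat with true by reflexivity. apply (H2 (S (S p)) 1%nat); [|lia]. unfold inL. lia.
  - destruct (Nat.leb_spec (S (S q)) (S (S p))).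
    + apply (H2 (S (S p)) (S (S q))); [|lia]. unfold inL. lia.
    + apply (HC (Zij (S (S q)) (S (S p)))), H2; [|lia]. unfold inL. lia.
Qed.

(** [Rpower 2 alpha] bounds the constant function 1 in [C^{-alpha}], because of the block
    [j = -1]. *)
Definition Kz : R := K + Rpower 2 alpha.

Lemma noise_K_ge0 : 0 <= T -> 0 <= K.
Proof. intros HT. eapply besov_le_ge0. apply (proj1 HN 0). lra. Qed.

Lemma Kz_ge1 : 0 <= T -> 1 <= Kz.
Proof.
  intros HT. pose proof (noise_K_ge0 HT). unfold Kz.
  assert (1 <= Rpower 2 alpha) by (rewrite <- (Rpower_O 2) by lra; apply Rpower2_mono; lra). lra.
Qed.

Lemma Rpower_le1_neg s e : 0 < s <= 1 -> 0 <= e -> 1 <= Rpower s (- e).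
Proof.
  intros Hs He. apply (Rle_trans _ (Rpower 1 (- e))).
  - unfold Rpower. rewrite ln_1, Rmult_0_r, exp_0. lra.
  - apply Rpower_le_compat_neg; lra.
Qed.

Lemma Rpower_neg_exp_mono s e e' : 0 < s <= 1 -> e <= e' -> Rpower s (- e) <= Rpower s (- e').
Proof.
  intros Hs He. replace (- e') with (- e + - (e' - e)) by ring. rewrite Rpower_plus.
  pose proof (Rpower_pos s (- e)). pose proof (Rpower_le1_neg s (e' - e) Hs ltac:(lra)). nra.
Qed.

(** The weight [(p + q - 1) alpha'] is coarsened to [(p + q) gamma]: noise factors then cost as much
    as factors [v], and every term of total degree [2 m + 1] has the same singularity. *)
Lemma Zpq_bound p q s : (p <= m + 1)%nat -> (q <= m)%nat -> 0 < s <= T -> s <= 1 ->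
  besov_le (- alpha) (Zpq p q s) (Kz * Rpower s (- (INR (p + q) * gamma))).
Proof.
  intros Hp Hq Hs Hs1. pose proof (noise_K_ge0 ltac:(lra)) as PK. pose proof (Rpower_pos 2 alpha) as PA.
  assert (R1 : 1 <= Rpower s (- (INR (p + q) * gamma))).
  { apply Rpower_le1_neg; [lra|]. pose proof (pos_INR (p + q)). nra. }
  apply (Zpq_cases (fun f => besov_le (- alpha) (f s) _)); auto.
  - intros _. eapply besov_le_mono; [apply besov_done|]. rewrite Ropp_involutive. unfold Kz. nra.
  - intros _. eapply besov_le_mono; [apply (proj1 HN s); lra|]. unfold Kz. nra.
  - intros i j HL E. eapply besov_le_mono; [apply (proj2 HN i j HL s Hs)|].
    rewrite E. unfold Rdiv. rewrite <- Rpower_Ropp.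
    assert (Rpower s (- ((INR (p + q) - 1) * alpha')) <= Rpower s (- (INR (p + q) * gamma))).
    { apply Rpower_neg_exp_mono; [lra|]. pose proof (pos_INR (p + q)). nra. }
    unfold Kz. nra.
  - intros f Hf. apply besov_conj; auto.
Qed.

Definition PsiS (v : Dist) (s : R) : Dist := Psi m nu tau v (Zt s) (fun i j => Zij i j s).

Lemma Rpower_pow_neg s g n : 0 < s -> Rpower s (- g) ^ n = Rpower s (- (INR n * g)).
Proof. intros Hs. rewrite <- Rpower_pow, Rpower_mult by apply Rpower_pos. f_equal. ring. Qed.

Lemma pow_ge1_mono M i n : 1 <= M -> (i <= n)%nat -> M ^ i <= M ^ n.
Proof. intros. apply Rle_pow; auto. Qed.

Lemma noise_product_le M s i j : 1 <= M -> 0 < s <= 1 -> 0 <= T -> (i <= m + 1)%nat -> (j <= m)%nat ->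
  (M * Rpower s (- gamma)) ^ i * (M * Rpower s (- gamma)) ^ j *
    (Kz * Rpower s (- (INR (m + 1 - i + (m - j)) * gamma)))
  <= M ^ (2 * m + 1) * Kz * Rpower s (- (INR (2 * m + 1) * gamma)).
Proof.
  intros HM Hs HT Hi Hj. rewrite <- pow_add, Rpow_mult_distr, Rpower_pow_neg by lra.
  replace (M ^ (i + j) * Rpower s (- (INR (i + j) * gamma)) * (Kz * Rpower s (- (INR (m + 1 - i + (m - j)) * gamma))))
    with (M ^ (i + j) * Kz * (Rpower s (- (INR (i + j) * gamma)) * Rpower s (- (INR (m + 1 - i + (m - j)) * gamma)))) by ring.
  rewrite <- Rpower_plus.
  replace (- (INR (i + j) * gamma) + - (INR (m + 1 - i + (m - j)) * gamma)) with (- (INR (2 * m + 1) * gamma)).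
  2:{ replace (2 * m + 1)%nat with ((i + j) + (m + 1 - i + (m - j)))%nat by lia. rewrite plus_INR. ring. }
  apply Rmult_le_compat_r; [left; apply Rpower_pos|].
  apply Rmult_le_compat_r; [pose proof (Kz_ge1 HT); lra|]. apply pow_ge1_mono; auto. lia.
Qed.

(* The constant [Cp] of [Psi_rel] is chosen before the noise, so it is passed as a parameter here. *)
Lemma PsiS_rel Cp v w M d s : Psi_rel_const Cp -> 0 < Cp -> 1 <= M -> 0 <= d -> 0 < s <= T -> s <= 1 ->
  rel beta (M * Rpower s (- gamma)) d v w ->
  rel (- (2 * alpha)) (Cp * (M ^ (2 * m + 1) * Kz * Rpower s (- (INR (2 * m + 1) * gamma)))) d
    (PsiS v s) (PsiS w s).
Proof.
  intros HC HCp HM Hd Hs Hs1 Hv.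
  pose proof (Kz_ge1 ltac:(lra)) as PK.
  assert (HMp : M <= M ^ (2 * m + 1)) by (rewrite <- (pow_1 M) at 1; apply pow_ge1_mono; auto; lia).
  assert (Rg : Rpower s (- gamma) <= Rpower s (- (INR (2 * m + 1) * gamma))).
  { apply Rpower_neg_exp_mono; [lra|]. assert (1 <= INR (2 * m + 1)) by (apply (le_INR 1); lia). nra. }
  pose proof (Rpower_pos s (- gamma)) as Pg.
  set (X := Rpower s (- (INR (2 * m + 1) * gamma))) in *.
  assert (RZ : forall p q, (p <= m + 1)%nat -> (q <= m)%nat ->
     rel (- alpha) (Kz * Rpower s (- (INR (p + q) * gamma))) d (Zpq p q s) (Zpq p q s)).
  { intros p q Hp Hq. eapply rel_mono; [apply rel_refl, Zpq_bound; auto|apply Rle_refl|auto|lra]. }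
  unfold PsiS.
  apply (HC v w (M * Rpower s (- gamma)) d (Zt s) (Zt s) (fun i j => Zij i j s) (fun i j => Zij i j s)
     (fun i j => Kz * Rpower s (- (INR (m + 1 - i + (m - j)) * gamma)))); auto.
  - eapply rel_mono; [apply rel_refl, (proj1 HN s); lra| |exact Hd|lra].
    assert (Kz * 1 <= M ^ (2 * m + 1) * Kz * X).
    { rewrite (Rmult_comm (M ^ _)), Rmult_assoc. apply Rmult_le_compat_l; [lra|].
      assert (1 <= X) by (apply Rpower_le1_neg; [lra|]; pose proof (pos_INR (2 * m + 1)); nra). nra. }
    pose proof (Rpower_pos 2 alpha). unfold Kz in *. lra.
  -
    assert (0 <= M ^ (2 * m + 1) * X) by nra. nra.
  - intros i j Hi Hj. apply RZ; lia.
  - intros i j Hi Hj. apply noise_product_le; auto; lra.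
Qed.

Hypothesis HZc : noise_ok m alpha alpha' T Zt Zij.

Lemma besov_continuous_conj a D f :
  besov_continuous_on a D f -> besov_continuous_on a D (fun s => dconj (f s)).
Proof.
  intros H t Ht eps He. destruct (H t Ht eps He) as [d [Hd HH]]. exists d. split; auto.
  intros s Hs Hst. rewrite <- dconj_dsub. apply besov_conj; auto.
Qed.

Lemma Zpq_cont p q : (p <= m + 1)%nat -> (q <= m)%nat ->
  besov_continuous_on (- alpha) (fun t => 0 < t <= T) (Zpq p q).
Proof.
  intros Hp Hq. apply Zpq_cases; auto.
  - intros _ t _ eps He. exists 1. split; [lra|]. intros s _ _.
    replace (dsub done done) with dzero.
    + eapply besov_le_mono; [apply besov_zero|lra].
    + apply functional_extensionality; intros k. unfold dzero, dsub. ring.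
  - intros _ t Ht eps He. destruct (proj1 HZc t ltac:(lra) eps He) as [d [Hd HH]].
    exists d. split; auto. intros s Hs. apply HH. lra.
  - intros i j HL _. apply (proj2 HZc i j HL).
  - intros f. apply besov_continuous_conj.
Qed.

Lemma PsiS_cont Cp v M T1 : Psi_rel_const Cp -> 0 < Cp -> 0 <= M -> T1 <= T -> T1 <= 1 ->
  besov_continuous_on beta (fun t => 0 < t <= T1) v ->
  (forall s, 0 < s <= T1 -> besov_le beta (v s) (M * Rpower s (- gamma))) ->
  coef_cont (fun t => 0 < t <= T1) (fun s => PsiS (v s) s).
Proof.
  intros HC HCp HM HT1 HT1' Hv HvB. apply (besov_cont_coef (- (2 * alpha))).
  intros t Ht eps He.
  pose proof (Kz_ge1 ltac:(lra)) as PK.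
  (* From [t / 2] on, all weights are bounded by their values at [t / 2]. The summand 1 makes [A]
     and [AZ] at least 1, so that norm distance [d] implies relative distance [d]. *)
  set (A := M * Rpower (t / 2) (- gamma) + 1).
  set (AZ := Kz * Rpower (t / 2) (- (INR (2 * m + 1) * gamma)) + 1).
  assert (PA : 1 <= A) by (unfold A; assert (0 <= M * Rpower (t / 2) (- gamma)) by nonneg; lra).
  assert (PAZ : 1 <= AZ) by (unfold AZ; assert (0 <= Kz * Rpower (t / 2) (- (INR (2 * m + 1) * gamma))) by nonneg; lra).
  set (Bd := A ^ (2 * m + 1) * AZ).
  assert (PA2 : 1 <= A ^ (2 * m + 1)) by (apply pow_R1_Rle; auto).
  assert (HBA : A <= Bd).
  { assert (A <= A ^ (2 * m + 1)) by (rewrite <- (pow_1 A) at 1; apply pow_ge1_mono; auto; lia).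
    unfold Bd. nra. }
  assert (HBZ : AZ <= Bd) by (unfold Bd; nra).
  set (d := eps / (Cp * Bd)).
  assert (Hd : 0 < d) by (unfold d; apply Rdiv_lt_0_compat; nra).
  assert (VB : forall s, t / 2 <= s -> 0 < s <= T1 -> besov_le beta (v s) A).
  { intros s Hs1 Hs. eapply besov_le_mono; [apply HvB; auto|].
    assert (Rpower s (- gamma) <= Rpower (t / 2) (- gamma)) by (apply Rpower_le_compat_neg; lra).
    unfold A. nra. }
  assert (ZB : forall p q s, (p <= m + 1)%nat -> (q <= m)%nat -> t / 2 <= s -> 0 < s <= T1 ->
     besov_le (- alpha) (Zpq p q s) AZ).
  { intros p q s Hp Hq Hs1 Hs. eapply besov_le_mono; [apply Zpq_bound; auto; lra|].
    assert (N1 : INR (p + q) * gamma <= INR (2 * m + 1) * gamma).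
    { apply Rmult_le_compat_r; [lra|]. apply le_INR. lia. }
    assert (Rpower s (- (INR (p + q) * gamma)) <= Rpower (t / 2) (- (INR (2 * m + 1) * gamma))).
    { eapply Rle_trans; [apply (Rpower_le_compat_neg (t / 2)); [lra|pose proof (pos_INR (p + q)); nra]|].
      apply Rpower_neg_exp_mono; lra. }
    unfold AZ. nra. }
  destruct (Hv t Ht d Hd) as [d1 [Hd1 H1]].
  destruct (proj1 HZc t ltac:(lra) d Hd) as [d2 [Hd2 H2]].
  destruct (uniform_delta (list_prod (seq 0 (m + 2)) (seq 0 (m + 1)))
    (fun pq dl => (fst pq <= m + 1)%nat -> (snd pq <= m)%nat -> forall s, 0 < s <= T -> Rabs (s - t) < dl ->
       besov_le (- alpha) (dsub (Zpq (fst pq) (snd pq) s) (Zpq (fst pq) (snd pq) t)) d)) as [d3 [Hd3 H3]].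
  { intros pq dl dl' H Hl Hp Hq s Hs Hst. apply H; auto. lra. }
  { intros [p q]. cbn [fst snd]. destruct (le_lt_dec p (m + 1)) as [Lp|Lp]; [destruct (le_lt_dec q m) as [Lq|Lq]|].
    - destruct (Zpq_cont p q Lp Lq t ltac:(lra) d Hd) as [dl [Hdl H]]. exists dl. split; auto.
    - exists 1. split; [lra|]. intros; lia.
    - exists 1. split; [lra|]. intros; lia. }
  set (dl := Rmin (Rmin d1 d2) (Rmin d3 (t / 2))).
  assert (L1 : dl <= d1 /\ dl <= d2 /\ dl <= d3 /\ dl <= t / 2).
  { unfold dl. pose proof (Rmin_l (Rmin d1 d2) (Rmin d3 (t / 2))). pose proof (Rmin_r (Rmin d1 d2) (Rmin d3 (t / 2))).
    pose proof (Rmin_l d1 d2). pose proof (Rmin_r d1 d2). pose proof (Rmin_l d3 (t / 2)). pose proof (Rmin_r d3 (t / 2)). lra. }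
  exists dl. split; [unfold dl; repeat apply Rmin_pos; lra|].
  intros s Hs Hst.
  assert (Hst2 : t / 2 <= s) by (apply Rabs_def2 in Hst; lra).
  assert (R : rel (- (2 * alpha)) (Cp * Bd) d (PsiS (v s) s) (PsiS (v t) t)).
  { unfold PsiS. apply (HC (v s) (v t) A d (Zt s) (Zt t) (fun i j => Zij i j s) (fun i j => Zij i j t) (fun _ _ => AZ)); auto; try lra.
    - split; [apply VB; auto|split; [apply VB; lra|]]. eapply besov_le_mono; [apply H1; auto; lra|]. nra.
    - pose proof (ZB 1%nat 0%nat s ltac:(lia) ltac:(lia) Hst2 Hs) as Z1.
      pose proof (ZB 1%nat 0%nat t ltac:(lia) ltac:(lia) ltac:(lra) Ht) as Z2.
      change (besov_le (- alpha) (Zt s) AZ) in Z1. change (besov_le (- alpha) (Zt t) AZ) in Z2.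
      split; [eapply besov_le_mono; [exact Z1|auto]|split; [eapply besov_le_mono; [exact Z2|auto]|]].
      eapply besov_le_mono; [apply H2; lra|]. nra.
    - intros i j Hi Hj.
      change (rel (- alpha) AZ d (Zpq (m + 1 - i) (m - j) s) (Zpq (m + 1 - i) (m - j) t)).
      split; [apply ZB; auto; lia|split; [apply ZB; auto; try lia; lra|]].
      eapply besov_le_mono; [apply (H3 ((m + 1 - i)%nat, (m - j)%nat)); cbn [fst snd]; try lia; try lra|nra].
      apply in_prod_iff. rewrite !in_seq. lia.
    - intros i j Hi Hj. rewrite <- pow_add. apply Rmult_le_compat_r; [lra|]. apply pow_ge1_mono; auto. lia. }
  destruct R as [_ [_ R]]. eapply besov_le_mono; [exact R|]. unfold d. right. field. split; nra.
Qed.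
End Noise.
End Nonlinearity.

(** * The Duhamel integral *)

(** Trades an exponential weight for a worse singularity with a better constant. The case [lam = 0]
    gives existence and large [lam] gives uniqueness, from one Duhamel bound. *)
Definition sing_major (lam r r' kap : R) : Prop := forall sg0, 0 < sg0 -> exists sg, 0 < sg /\
  forall x, 0 <= x -> exp (- (lam * x)) * Rpower (x + sg0) (- r) <= kap * Rpower (x + sg) (- r').

Lemma sing_major_0 r : sing_major 0 r r 1.
Proof.
  intros sg0 H. exists sg0. split; auto. intros x Hx.
  rewrite Rmult_0_l, Ropp_0, exp_0. lra.
Qed.

(** [exp (- lam x)] is at most a multiple of [(1 + lam x)^(- eta)], that is of
    [lam^(- eta) (x + / lam)^(- eta)]; the smaller of the two shifts then serves both factors. *)
Lemma sing_major_decay r eta : 0 <= r -> 0 < eta -> exists D, 0 < D /\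
  forall lam, 0 < lam -> sing_major lam r (r + eta) (D * Rpower lam (- eta)).
Proof.
  intros Hr He. destruct (power_le_exp eta 1) as [D [HD H]]; [auto|lra|].
  exists D. split; auto. intros lam Hl sg0 Hs0.
  assert (Hi : 0 < / lam) by (apply Rinv_0_lt_compat; auto).
  exists (Rmin sg0 (/ lam)). split; [apply Rmin_pos; auto|]. intros x Hx.
  pose proof (Rmin_l sg0 (/ lam)) as L1. pose proof (Rmin_r sg0 (/ lam)) as L2.
  pose proof (Rmin_pos _ _ Hs0 Hi) as L3. set (sg := Rmin sg0 (/ lam)) in *.
  assert (E1 : exp (- (lam * x)) <= D * (Rpower lam (- eta) * Rpower (x + / lam) (- eta))).
  { rewrite Rpower_mult_distr by lra.
    replace (lam * (x + / lam)) with (1 + lam * x) by (field; lra).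
    assert (0 <= lam * x) by nra. specialize (H (lam * x) H0). rewrite Rmult_1_l in H.
    rewrite exp_Ropp, Rpower_Ropp. pose proof (exp_pos (lam * x)). pose proof (Rpower_pos (1 + lam * x) eta).
    apply (Rmult_le_reg_r (exp (lam * x) * Rpower (1 + lam * x) eta)); [apply Rmult_lt_0_compat; auto|].
    field_simplify; lra. }
  assert (E2 : Rpower (x + / lam) (- eta) <= Rpower (x + sg) (- eta)) by (apply Rpower_le_compat_neg; lra).
  assert (E3 : Rpower (x + sg0) (- r) <= Rpower (x + sg) (- r)) by (apply Rpower_le_compat_neg; lra).
  replace (- (r + eta)) with (- eta + - r) by ring. rewrite Rpower_plus.
  pose proof (Rpower_pos (x + sg0) (- r)).
  pose proof (exp_pos (- (lam * x))).
  rewrite <- (Rmult_assoc (D * Rpower lam (- eta))).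
  apply Rmult_le_compat; try lra. eapply Rle_trans; [exact E1|].
  rewrite <- Rmult_assoc. apply Rmult_le_compat_l; [nonneg|auto].
Qed.

(** Done block by block: [/ 4 ^ n] is the shift [sg0], and the beta-type integral is bounded
    uniformly in the shift, so the block index drops out. [r] is the smoothing exponent, [r'] the
    one left after using the exponential weight. *)
Theorem duhamel_bound mu a b r r' q : 0 < mu -> 0 <= r -> (b - a) / 2 < r -> 0 <= r' < 1 -> 0 <= q < 1 ->
  exists Cd, 0 < Cd /\ forall lam kap h A t (I : Dist), sing_major lam r r' kap -> 0 <= kap -> 0 < t <= 1 -> 0 <= A ->
  (forall k, imp (fun s => semigroup mu (t - s) (h s) k) t (I k)) ->
  (forall s, 0 < s <= t -> besov_le a (h s) (A * Rpower s (- q) * exp (lam * s))) ->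
  besov_le b I (Cd * kap * A * exp (lam * t) * Rpower t (1 - q - r')).
Proof.
  intros Hm Hr Hab Hr' Hq.
  destruct (semigroup_smoothing mu a b r Hm Hr Hab) as [Cs [HCs S]].
  destruct (beta_major_int q r' Hq Hr') as [Cb [HCb BI]].
  exists (Cs * Cb). split; [nra|].
  intros lam kap h A t I SM Hk Ht HA HI Hh n x1 x2.
  assert (Hs0 : 0 < / 4 ^ n) by (apply Rinv_0_lt_compat, pow_lt; lra).
  destruct (SM _ Hs0) as [sg [Hsg HS]].
  change (wt b n * Cmod (LP_block n I x1 x2) <= Cs * Cb * kap * A * exp (lam * t) * Rpower t (1 - q - r')).
  pose proof (wt_pos b n) as W. pose proof (exp_pos (lam * t)) as E.
  assert (HL : imp (fun s => LP_block n (semigroup mu (t - s) (h s)) x1 x2) t (LP_block n I x1 x2)).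
  { rewrite LP_block_ev. unfold ev.
    pose proof (imp_csum (box (2 ^ (n + 1))) (fun k => Cmult (rho_sym n k) (fourier_char k x1 x2))
      (fun k s => semigroup mu (t - s) (h s) k) t (fun k => I k) ltac:(lra) HI) as H.
    replace (csum (box (2 ^ (n + 1))) (fun k => Cmult (Cmult (rho_sym n k) (I k)) (fourier_char k x1 x2))) with
      (csum (box (2 ^ (n + 1))) (fun k => Cmult (Cmult (rho_sym n k) (fourier_char k x1 x2)) (I k)))
      by (apply csum_ext; intros; ring).
    revert H. apply imp_ext. intros s. rewrite LP_block_ev. unfold ev. apply csum_ext; intros; ring. }
  set (c := / wt b n * (Cs * A * exp (lam * t) * kap)).
  assert (Hw : 0 < / wt b n) by (apply Rinv_0_lt_compat; auto).
  assert (Hc : 0 <= c) by (unfold c; nonneg; left; auto).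
  assert (B : Cmod (LP_block n I x1 x2) <= c * (Cb * Rpower t (1 - q - r'))).
  { apply (imp_bound _ t _ (fun s => c * beta_major q r' t sg s) _ ltac:(lra) HL).
    - intros s Hs.
      pose proof (S (h s) _ (t - s) n x1 x2 (Hh s Hs) ltac:(lra)) as S1.
      specialize (HS (t - s) ltac:(lra)).
      pose proof (beta_major_le q r' t sg s ltac:(lra) ltac:(lra) Hsg Hs) as BM.
      apply (Rmult_le_reg_l (wt b n)); auto. unfold c.
      replace (wt b n * (/ wt b n * (Cs * A * exp (lam * t) * kap) * beta_major q r' t sg s)) with
        (Cs * A * exp (lam * t) * kap * beta_major q r' t sg s) by (field; lra).
      eapply Rle_trans; [exact S1|].
      replace (exp (lam * s)) with (exp (lam * t) * exp (- (lam * (t - s)))) by (rewrite <- exp_plus; f_equal; ring).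
      replace (Cs * (A * Rpower s (- q) * (exp (lam * t) * exp (- (lam * (t - s))))) * Rpower (t - s + / 4 ^ n) (- r)) with
        (Cs * A * exp (lam * t) * (Rpower s (- q) * (exp (- (lam * (t - s))) * Rpower (t - s + / 4 ^ n) (- r)))) by ring.
      rewrite (Rmult_assoc (Cs * A * exp (lam * t))).
      apply Rmult_le_compat_l; [nonneg|].
      apply Rle_trans with (Rpower s (- q) * (kap * Rpower (t - s + sg) (- r'))).
      + apply Rmult_le_compat_l; [nonneg|auto].
      + replace (Rpower s (- q) * (kap * Rpower (t - s + sg) (- r'))) with
          (kap * (Rpower s (- q) * Rpower (t - s + sg) (- r'))) by ring.
        apply Rmult_le_compat_l; auto.
    - intros a' Ha'. destruct (BI t sg a' Hsg Ha') as [y [Hy1 Hy2]].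
      exists (c * y). split; [apply (is_RInt_scal (V := R_NormedModule)); auto|].
      apply Rmult_le_compat_l; auto. }
  apply (Rmult_le_compat_l (wt b n)) in B; [|lra].
  eapply Rle_trans; [exact B|]. right. unfold c. field. lra.
Qed.

(** * Existence and time regularity of the Duhamel term *)

Definition time_lip (mu : R) (k : Z * Z) : R :=
  2 * Rabs (fst (lambdaA mu k)) + 2 * Rabs (snd (lambdaA mu k)).

Lemma heat_sym_time_lip mu k t t' : 0 <= mu -> 0 <= t -> 0 <= t' ->
  Cmod (Cminus (heat_sym mu t k) (heat_sym mu t' k)) <= time_lip mu k * Rabs (t - t').
Proof.
  intros Hm Ht Ht'. unfold heat_sym.
  assert (N : forall u, 0 <= u -> fst (Cmult (RtoC u) (lambdaA mu k)) <= 0).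
  { intros u Hu. pose proof (heat_sym_le mu u k 0 Hm Hu ltac:(split; [lra|apply knorm_ge0])) as H.
    rewrite pow_i, Rmult_0_r, Ropp_0 in H by lia. exact H. }
  eapply Rle_trans; [apply (cexp_lip _ _ 0); auto|]. rewrite exp_0, Rmult_1_r.
  unfold time_lip. destruct (lambdaA mu k) as [x y]. simpl.
  replace (t * x - 0 * y - (t' * x - 0 * y)) with (x * (t - t')) by ring.
  replace (t * y + 0 * x - (t' * y + 0 * x)) with (y * (t - t')) by ring.
  rewrite !Rabs_mult. lra.
Qed.

Lemma time_lip_ge0 mu k : 0 <= time_lip mu k.
Proof. unfold time_lip. pose proof (Rabs_pos (fst (lambdaA mu k))). pose proof (Rabs_pos (snd (lambdaA mu k))). lra. Qed.

Lemma semigroup_eq mu t f k : semigroup mu t f k = Cmult (heat_sym mu t k) (f k).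
Proof. reflexivity. Qed.

Lemma duhamel_exists mu h A q a t : 0 < mu -> 0 < t -> 0 <= A -> 0 <= q < 1 ->
  coef_cont (fun s => 0 < s <= t) h ->
  (forall s, 0 < s <= t -> besov_le a (h s) (A * Rpower s (- q))) ->
  forall k, exists I, imp (fun s => semigroup mu (t - s) (h s) k) t I.
Proof.
  intros Hm Ht HA Hq Hc Hb k. pose proof (coefC_pos a k) as PC.
  apply (imp_exists _ t (A * coefC a k) q); auto.
  - nra.
  - intros s Hs eps He.
    set (H := Cmod (h s k) + 1).
    assert (PH : 1 <= H) by (unfold H; pose proof (Cmod_ge_0 (h s k)); lra).
    pose proof (time_lip_ge0 mu k) as PL.
    destruct (Hc k s Hs (eps / 2)) as [d [Hd HH]]; [lra|].
    set (d2 := eps / (2 * (time_lip mu k + 1) * H)).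
    assert (Hd2 : 0 < d2) by (unfold d2; apply Rdiv_lt_0_compat; nra).
    exists (Rmin d d2). split; [apply Rmin_pos; auto|]. intros s' Hs' Hss.
    pose proof (Rmin_l d d2). pose proof (Rmin_r d d2).
    rewrite !semigroup_eq.
    replace (Cminus _ _) with (Cplus (Cmult (heat_sym mu (t - s') k) (Cminus (h s' k) (h s k)))
       (Cmult (Cminus (heat_sym mu (t - s') k) (heat_sym mu (t - s) k)) (h s k))) by ring.
    eapply Rle_trans; [apply Cmod_triangle|]. rewrite !Cmod_mult.
    pose proof (Cmod_heat_sym_le1 mu (t - s') k ltac:(lra) ltac:(lra)).
    pose proof (heat_sym_time_lip mu k (t - s') (t - s) ltac:(lra) ltac:(lra) ltac:(lra)) as HL.
    replace (t - s' - (t - s)) with (- (s' - s)) in HL by ring. rewrite Rabs_Ropp in HL.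
    specialize (HH s' Hs' ltac:(lra)). simpl in HH.
    pose proof (Cmod_ge_0 (Cminus (h s' k) (h s k))).
    assert (X1 : Cmod (heat_sym mu (t - s') k) * Cmod (Cminus (h s' k) (h s k)) <= eps / 2) by nra.
    assert (X2 : Cmod (Cminus (heat_sym mu (t - s') k) (heat_sym mu (t - s) k)) * Cmod (h s k) <= eps / 2).
    { apply Rle_trans with ((time_lip mu k + 1) * d2 * H).
      - apply Rmult_le_compat; auto using Cmod_ge_0.
        + eapply Rle_trans; [exact HL|]. pose proof (Rabs_pos (s' - s)). apply Rmult_le_compat; lra.
        + unfold H; lra.
      - unfold d2. right. field. split; lra. }
    lra.
  - intros s Hs. rewrite semigroup_eq, Cmod_mult.
    pose proof (Cmod_heat_sym_le1 mu (t - s) k ltac:(lra) ltac:(lra)).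
    pose proof (besov_coef _ _ _ k (Hb s Hs)).
    pose proof (Cmod_ge_0 (h s k)). nra.
Qed.

(** Split at [t1]: before it only the heat symbol changes, after it the integrand is bounded. The
    constant depends on [k], which is enough for coefficientwise continuity. *)
Lemma duhamel_time_lip mu h A q t1 t2 k I1 I2 : 0 < mu -> 0 < t1 <= t2 -> t2 <= 1 -> 0 <= A -> 0 <= q < 1 ->
  (forall s, 0 < s <= t2 -> Cmod (h s k) <= A * Rpower s (- q)) ->
  imp (fun s => semigroup mu (t1 - s) (h s) k) t1 I1 ->
  imp (fun s => semigroup mu (t2 - s) (h s) k) t2 I2 ->
  Cmod (Cminus I2 I1) <= (time_lip mu k * A / (1 - q) + A * Rpower t1 (- q)) * (t2 - t1).
Proof.
  intros Hm Ht Ht2 HA Hq Hh H1 H2.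
  set (B := (time_lip mu k * A / (1 - q) + A * Rpower t1 (- q)) * (t2 - t1)).
  pose proof (time_lip_ge0 mu k) as PL.
  (* Each improper integral is reached only up to an error; allowing a third of the assumed gap for
     each leaves a contradiction. *)
  apply Rnot_lt_le. intros L.
  set (e := (Cmod (Cminus I2 I1) - B) / 3).
  destruct (H1 e) as [d1 [Hd1 HH1]]; [unfold e; lra|]. destruct (H2 e) as [d2 [Hd2 HH2]]; [unfold e; lra|].
  set (a := Rmin (Rmin d1 d2) t1 / 2).
  assert (Ha : 0 < a /\ a < d1 /\ a < d2 /\ a < t1).
  { unfold a. pose proof (Rmin_l (Rmin d1 d2) t1). pose proof (Rmin_r (Rmin d1 d2) t1).
    pose proof (Rmin_l d1 d2). pose proof (Rmin_r d1 d2).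
    assert (0 < Rmin (Rmin d1 d2) t1) by (repeat apply Rmin_pos; lra). lra. }
  destruct (HH1 a ltac:(lra)) as [y1 [Hy1 Hz1]]. destruct (HH2 a ltac:(lra)) as [y2 [Hy2 Hz2]].
  assert (Hex : exists z, CRint (fun s => semigroup mu (t2 - s) (h s) k) t1 t2 z).
  { assert (X : ex_RInt (V := C_R_CompleteNormedModule) (fun s => semigroup mu (t2 - s) (h s) k) t1 t2).
    { apply (ex_RInt_Chasles_2 (V := C_R_CompleteNormedModule) _ a); [lra|]. exists y2; auto. }
    destruct X as [z Hz]. exists z; auto. }
  destruct Hex as [z Hz].
  assert (Hw : CRint (fun s => semigroup mu (t2 - s) (h s) k) a t1 (Cminus y2 z)).
  { pose proof (is_RInt_Chasles _ _ _ _ _ _ Hy2 (is_RInt_swap _ _ _ _ Hz)) as X. exact X. }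
  pose proof (CRint_minus _ _ _ _ _ _ Hw Hy1) as Hd.
  assert (B1 : Cmod (Cminus (Cminus y2 z) y1) <= time_lip mu k * A / (1 - q) * (t2 - t1)).
  { pose proof (is_RInt_scal (V := R_NormedModule) _ _ _ (time_lip mu k * (t2 - t1) * A) _ (is_RInt_Rpower q a t1 ltac:(lra) ltac:(lra))) as HR.
    eapply Rle_trans; [apply (CRint_bound (fun s => Cminus (semigroup mu (t2 - s) (h s) k) (semigroup mu (t1 - s) (h s) k))
        (fun s => time_lip mu k * (t2 - t1) * A * Rpower s (- q)) a t1 _ _ ltac:(lra)); [|exact Hd|exact HR]|].
    - intros s Hs. rewrite !semigroup_eq.
      replace (Cminus _ _) with (Cmult (Cminus (heat_sym mu (t2 - s) k) (heat_sym mu (t1 - s) k)) (h s k)) by ring.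
      rewrite Cmod_mult, Rmult_assoc.
      apply Rmult_le_compat; auto using Cmod_ge_0; [|apply Hh; lra].
      eapply Rle_trans; [apply heat_sym_time_lip; lra|]. right. f_equal.
      rewrite Rabs_pos_eq; lra.
    - unfold scal; simpl. unfold mult; simpl.
      pose proof (Rpower_pos a (1 - q)).
      assert (Rpower t1 (1 - q) <= 1).
      { apply (Rle_trans _ (Rpower 1 (1 - q))); [apply Rle_Rpower_l; lra|].
        unfold Rpower. rewrite ln_1, Rmult_0_r, exp_0. lra. }
      assert (0 < / (1 - q)) by (apply Rinv_0_lt_compat; lra).
      unfold Rdiv. replace (time_lip mu k * A * / (1 - q) * (t2 - t1)) with
        (time_lip mu k * (t2 - t1) * A * (1 * / (1 - q))) by ring.
      apply Rmult_le_compat_l; [nonneg|]. apply Rmult_le_compat_r; lra. }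
  assert (B2 : Cmod z <= (t2 - t1) * (A * Rpower t1 (- q))).
  { apply (CRint_bound_const (fun s => semigroup mu (t2 - s) (h s) k) t1 t2 z _ ltac:(lra)); [|exact Hz]. intros s Hs.
    rewrite semigroup_eq, Cmod_mult.
    pose proof (Cmod_heat_sym_le1 mu (t2 - s) k ltac:(lra) ltac:(lra)).
    pose proof (Hh s ltac:(lra)).
    assert (Rpower s (- q) <= Rpower t1 (- q)) by (apply Rpower_le_compat_neg; lra).
    pose proof (Cmod_ge_0 (h s k)). nra. }
  assert (F : Cmod (Cminus I2 I1) <= e + e + B).
  { replace (Cminus I2 I1) with (Cplus (Cplus (Copp (Cminus y2 I2)) (Cminus y1 I1)) (Cplus (Cminus (Cminus y2 z) y1) z)) by ring.
    eapply Rle_trans; [apply Cmod_triangle|]. apply Rplus_le_compat.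
    - eapply Rle_trans; [apply Cmod_triangle|]. rewrite Cmod_opp. lra.
    - eapply Rle_trans; [apply Cmod_triangle|]. unfold B. lra. }
  unfold e in F. lra.
Qed.

Lemma duhamel_coef_cont mu h A q a T1 (J : R -> Dist) : 0 < mu -> T1 <= 1 -> 0 <= A -> 0 <= q < 1 ->
  (forall s, 0 < s <= T1 -> besov_le a (h s) (A * Rpower s (- q))) ->
  (forall t, 0 < t <= T1 -> forall k, imp (fun s => semigroup mu (t - s) (h s) k) t (J t k)) ->
  coef_cont (fun t => 0 < t <= T1) J.
Proof.
  intros Hm HT1 HA Hq Hh HJ k t Ht eps He.
  pose proof (coefC_pos a k) as PC. pose proof (time_lip_ge0 mu k) as PL.
  set (A' := A * coefC a k). assert (PA : 0 <= A') by (unfold A'; nra).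
  set (D := time_lip mu k * A' / (1 - q) + A' * Rpower (t / 2) (- q)).
  assert (PD : 0 <= D).
  { unfold D, Rdiv. assert (0 < / (1 - q)) by (apply Rinv_0_lt_compat; lra).
    apply Rplus_le_le_0_compat; nonneg. }
  assert (Lp : forall t1 t2, t / 2 <= t1 <= t2 -> t2 <= T1 -> Cmod (Cminus (J t2 k) (J t1 k)) <= D * (t2 - t1)).
  { intros t1 t2 H12 H2.
    eapply Rle_trans; [apply (duhamel_time_lip mu h A' q t1 t2 k); auto; try lra|].
    - intros s Hs. pose proof (besov_coef _ _ _ k (Hh s ltac:(lra))). unfold A'. lra.
    - apply HJ; lra.
    - apply HJ; lra.
    - apply Rmult_le_compat_r; [lra|]. unfold D. apply Rplus_le_compat_l. apply Rmult_le_compat_l; auto.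
      apply Rpower_le_compat_neg; lra. }
  exists (Rmin (t / 2) (eps / (D + 1))). split.
  { apply Rmin_pos; [lra|apply Rdiv_lt_0_compat; lra]. }
  intros s Hs Hst. pose proof (Rmin_l (t / 2) (eps / (D + 1))). pose proof (Rmin_r (t / 2) (eps / (D + 1))).
  assert (X : Cmod (Cminus (J s k) (J t k)) <= D * Rabs (s - t)).
  { destruct (Rle_dec t s).
    - rewrite Rabs_pos_eq by lra. apply Lp; lra.
    - rewrite Rabs_minus_sym, Rabs_pos_eq, Cmod_minus_sym by lra. rewrite Rabs_minus_sym, Rabs_pos_eq in Hst by lra. apply Lp; lra. }
  eapply Rle_trans; [exact X|].
  apply Rle_trans with (D * (eps / (D + 1))); [apply Rmult_le_compat_l; lra|].
  replace (D * (eps / (D + 1))) with (eps - eps / (D + 1)) by (field; lra).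
  assert (0 < eps / (D + 1)) by (apply Rdiv_lt_0_compat; lra). lra.
Qed.

Lemma semigroup_coef_cont mu f (D : R -> Prop) : 0 < mu -> (forall t, D t -> 0 <= t) ->
  coef_cont D (fun t => semigroup mu t f).
Proof.
  intros Hm HD k t Ht eps He. pose proof (time_lip_ge0 mu k) as PL. pose proof (Cmod_ge_0 (f k)) as PF.
  exists (eps / ((time_lip mu k + 1) * (Cmod (f k) + 1))). split; [apply Rdiv_lt_0_compat; nra|].
  intros s Hs Hst. rewrite !semigroup_eq.
  replace (Cminus _ _) with (Cmult (Cminus (heat_sym mu s k) (heat_sym mu t k)) (f k)) by ring.
  rewrite Cmod_mult.
  pose proof (heat_sym_time_lip mu k s t ltac:(lra) (HD s Hs) (HD t Ht)) as L.
  apply Rle_trans with ((time_lip mu k + 1) * (eps / ((time_lip mu k + 1) * (Cmod (f k) + 1))) * (Cmod (f k) + 1)).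
  - apply Rmult_le_compat; auto using Cmod_ge_0; [|lra].
    eapply Rle_trans; [exact L|]. pose proof (Rabs_pos (s - t)). apply Rmult_le_compat; lra.
  - right. field. split; lra.
Qed.

Definition Duh (mu : R) (h : R -> Dist) (t : R) : Dist := fun k =>
  RInt_gen (V := C_R_CompleteNormedModule) (fun s => semigroup mu (t - s) (h s) k) (at_right 0) (at_point t).

Lemma Duh_spec mu h t k : 0 < t -> (exists I, imp (fun s => semigroup mu (t - s) (h s) k) t I) ->
  imp (fun s => semigroup mu (t - s) (h s) k) t (Duh mu h t k).
Proof.
  intros Ht [I HI]. apply imp_iff; auto. unfold Duh.
  apply (RInt_gen_correct (V := C_R_CompleteNormedModule)).
  exists I. apply imp_iff; auto.
Qed.

(** * Picard iteration *)

Lemma besov_continuous_add a D f g : besov_continuous_on a D f -> besov_continuous_on a D g ->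
  besov_continuous_on a D (fun t => dadd (f t) (g t)).
Proof.
  intros Hf Hg t Ht eps He. destruct (Hf t Ht (eps / 2)) as [d1 [Hd1 H1]]; [lra|].
  destruct (Hg t Ht (eps / 2)) as [d2 [Hd2 H2]]; [lra|].
  exists (Rmin d1 d2). split; [apply Rmin_pos; auto|]. intros s Hs Hst.
  pose proof (Rmin_l d1 d2). pose proof (Rmin_r d1 d2).
  replace (dsub _ _) with (dadd (dsub (f s) (f t)) (dsub (g s) (g t)))
    by (apply functional_extensionality; intros k; unfold dadd, dsub; ring).
  replace eps with (eps / 2 + eps / 2) by field. apply besov_add; [apply H1|apply H2]; auto; lra.
Qed.

Lemma half_pow_small c eps : 0 <= c -> 0 < eps -> exists n, c * (/ 2) ^ n <= eps.
Proof.
  intros Hc He.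
  assert (Lr : is_lim_seq (fun n => c * (/ 2) ^ n) 0).
  { replace 0 with (c * 0) by ring. apply (is_lim_seq_scal_l _ _ 0).
    apply is_lim_seq_geom. rewrite Rabs_pos_eq; lra. }
  apply is_lim_seq_spec in Lr. destruct (Lr (mkposreal _ He)) as [N HN]. exists N.
  specialize (HN N (le_n _)). rewrite Rminus_0_r in HN. simpl in HN. apply Rabs_def2 in HN. lra.
Qed.

Lemma Rpower_local_bound t s e : 0 < t -> t / 2 <= s <= 1 -> Rpower s e <= Rpower (t / 2) (- Rabs e).
Proof.
  intros Ht Hs. apply Rle_trans with (Rpower s (- Rabs e)).
  - rewrite <- (Ropp_involutive e) at 1. apply Rpower_neg_exp_mono; [lra|].
    rewrite <- Rabs_Ropp. apply Rle_abs.
  - apply Rpower_le_compat_neg; [lra|apply Rabs_pos].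
Qed.

(** Interpolation: the coefficients are continuous in time, and a bound in the stronger space of
    regularity [b'], locally uniform for [t > 0], upgrades this to continuity in regularity [b]. *)
Lemma duhamel_besov_cont mu h A q a b b' e C2 T1 (J : R -> Dist) :
  0 < mu -> T1 <= 1 -> 0 <= A -> 0 <= q < 1 -> b < b' -> 0 <= C2 ->
  (forall s, 0 < s <= T1 -> besov_le a (h s) (A * Rpower s (- q))) ->
  (forall t, 0 < t <= T1 -> forall k, imp (fun s => semigroup mu (t - s) (h s) k) t (J t k)) ->
  (forall t, 0 < t <= T1 -> besov_le b' (J t) (C2 * Rpower t e)) ->
  besov_continuous_on b (fun t => 0 < t <= T1) J.
Proof.
  intros Hm HT1 HA Hq Hb HC2 Hh HJ HB. apply (besov_cont_of_coef b b'); auto.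
  - apply (duhamel_coef_cont mu h A q a T1); auto.
  - intros t Ht. exists (t / 2), (C2 * Rpower (t / 2) (- Rabs e)). split; [lra|].
    intros s Hs Hst. eapply besov_le_mono; [apply HB; auto|].
    apply Rmult_le_compat_l; auto. apply Rabs_def2 in Hst. apply Rpower_local_bound; lra.
Qed.

(** The smallness of [T1] enters only through [HD]: a source of size [A * c] produces at most
    [c / 4]. With [c = 1] and [HMU] this gives an invariant ball, with [c = d] the contraction.
    [HDb] carries no smallness; its extra regularity [b'] serves time continuity. *)
Section Picard.
Variables (m : nat) (nu tau : C) (beta alpha mu alpha' gamma T K : R)
  (Zt : R -> Dist) (Zij : nat -> nat -> R -> Dist) (u0 : Dist) (T1 M MU Cp b' e : R).
Let q := INR (2 * m + 1) * gamma.
Hypotheses (Hmu : 0 < mu) (Hbeta : 0 < beta) (Halpha : 0 < alpha < beta / 4)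
  (Hg : 0 < gamma) (Ha' : 0 < alpha' <= gamma) (Hq : 0 <= q < 1)
  (HN : noise_norm_le m alpha alpha' T Zt Zij K) (HZc : noise_ok m alpha alpha' T Zt Zij)
  (HT : 0 < T1 <= T) (HT1 : T1 <= 1) (HCp : 0 < Cp) (HPsi : Psi_rel_const m nu tau beta alpha Cp)
  (HM : 1 <= M) (HMU : MU + / 4 <= M).
Let A := Cp * (M ^ (2 * m + 1) * Kz alpha K).
Hypothesis HU : forall t, 0 < t <= T1 -> besov_le beta (semigroup mu t u0) (MU * Rpower t (- gamma)).
Hypothesis HUc : besov_continuous_on beta (fun t => 0 < t <= T1) (fun t => semigroup mu t u0).
Hypothesis HD : forall h c t I, 0 < t <= T1 -> 0 <= c ->
  (forall k, imp (fun s => semigroup mu (t - s) (h s) k) t (I k)) ->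
  (forall s, 0 < s <= t -> besov_le (- (2 * alpha)) (h s) (A * c * Rpower s (- q))) ->
  besov_le beta I (c / 4 * Rpower t (- gamma)).
Hypothesis (Hb' : beta < b').
Hypothesis HDb : exists C2, 0 <= C2 /\ forall h t I, 0 < t <= T1 ->
  (forall k, imp (fun s => semigroup mu (t - s) (h s) k) t (I k)) ->
  (forall s, 0 < s <= t -> besov_le (- (2 * alpha)) (h s) (A * Rpower s (- q))) ->
  besov_le b' I (C2 * Rpower t e).

Let D (t : R) : Prop := 0 < t <= T1.
Let PS (v : Dist) (s : R) : Dist := PsiS m nu tau Zt Zij v s.

Lemma A_pos : 0 < A.
Proof.
  pose proof (Kz_ge1 m beta alpha Halpha alpha' T K Zt Zij HN ltac:(lra)).
  unfold A. assert (0 < M ^ (2 * m + 1)) by (apply pow_lt; lra). repeat apply Rmult_lt_0_compat; lra.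
Qed.

Definition admissible (v : R -> Dist) : Prop :=
  besov_continuous_on beta D v /\ forall t, D t -> besov_le beta (v t) (M * Rpower t (- gamma)).

Lemma PS_rel v w d s : D s -> 0 <= d -> rel beta (M * Rpower s (- gamma)) d v w ->
  rel (- (2 * alpha)) (A * Rpower s (- q)) d (PS v s) (PS w s).
Proof.
  intros Hs Hd H. unfold D in Hs.
  pose proof (PsiS_rel m nu tau beta alpha Halpha alpha' gamma T K Zt Zij Ha' HN Cp v w M d s HPsi HCp HM Hd
    ltac:(lra) ltac:(lra) H) as R.
  unfold A, q. rewrite Rmult_assoc. exact R.
Qed.

Lemma PS_bound v s : D s -> besov_le beta v (M * Rpower s (- gamma)) ->
  besov_le (- (2 * alpha)) (PS v s) (A * Rpower s (- q)).
Proof. intros Hs H. apply (PS_rel v v 0 s Hs (Rle_refl 0)). apply rel_refl; auto. Qed.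

Definition Phi (v : R -> Dist) (t : R) : Dist :=
  dadd (semigroup mu t u0) (Duh mu (fun s => PS (v s) s) t).

Lemma Phi_imp v t k : admissible v -> D t ->
  imp (fun s => semigroup mu (t - s) (PS (v s) s) k) t (Duh mu (fun s => PS (v s) s) t k).
Proof.
  intros [Hc Hb] Ht. unfold D in Ht. apply (Duh_spec mu (fun s => PS (v s) s)); [lra|].
  pose proof A_pos.
  apply (duhamel_exists mu (fun s => PS (v s) s) A q (- (2 * alpha)) t); try lra.
  - assert (CC : coef_cont D (fun s => PS (v s) s)).
    { apply (PsiS_cont m nu tau beta alpha Halpha alpha' gamma T K Zt Zij Hg Ha' HN HZc Cp v M T1 HPsi HCp); auto; lra. }
    intros l s Hs eps He. destruct (CC l s ltac:(unfold D; lra) eps He) as [d [Hd HH]].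
    exists d. split; auto. intros s' Hs' Hss. apply HH; auto. unfold D; lra.
  - intros s Hs. apply PS_bound; [unfold D; lra|apply Hb; unfold D; lra].
Qed.

Lemma Phi_admissible v : admissible v -> admissible (Phi v).
Proof.
  intros Hv. pose proof A_pos as PA. destruct HDb as [C2 [HC2 HB2]]. pose proof Hv as [Hc Hb].
  assert (Hh : forall s, D s -> besov_le (- (2 * alpha)) (PS (v s) s) (A * Rpower s (- q)))
    by (intros s Hs; apply PS_bound; auto).
  split.
  - apply besov_continuous_add; auto.
    apply (duhamel_besov_cont mu (fun s => PS (v s) s) A q (- (2 * alpha)) beta b' e C2 T1); auto; try lra.
    + intros t Ht k. apply Phi_imp; auto.
    + intros t Ht. apply (HB2 (fun s => PS (v s) s) t); auto.
      * intros k. apply Phi_imp; auto.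
      * intros s Hs. apply Hh. unfold D in *; lra.
  - intros t Ht. eapply besov_le_mono.
    + apply besov_add; [apply HU; auto|].
      apply (HD (fun s => PS (v s) s) 1 t); [exact Ht|lra| |].
      * intros k. apply Phi_imp; auto.
      * intros s Hs. rewrite Rmult_1_r. apply Hh. unfold D in *; lra.
    + rewrite <- Rmult_plus_distr_r. apply Rmult_le_compat_r; [left; apply Rpower_pos|lra].
Qed.

Lemma Phi_contract v w d : admissible v -> admissible w -> 0 <= d ->
  (forall s, D s -> besov_le beta (dsub (v s) (w s)) (M * Rpower s (- gamma) * d)) ->
  forall t, D t -> besov_le beta (dsub (Phi v t) (Phi w t)) (M * Rpower t (- gamma) * (d / 2)).
Proof.
  intros Hv Hw Hd H t Ht.
  replace (dsub (Phi v t) (Phi w t)) with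
    (dsub (Duh mu (fun s => PS (v s) s) t) (Duh mu (fun s => PS (w s) s) t))
    by (apply functional_extensionality; intros k; unfold Phi, dadd, dsub; ring).
  eapply besov_le_mono.
  - apply (HD (fun s => dsub (PS (v s) s) (PS (w s) s)) d t); [exact Ht|exact Hd| |].
    + intros k. pose proof (imp_minus _ _ _ _ _ (Phi_imp v t k Hv Ht) (Phi_imp w t k Hw Ht)) as X.
      revert X. apply imp_ext. intros s. unfold semigroup, dsub. ring.
    + intros s Hs. assert (Ds : D s) by (unfold D in *; lra).
      destruct (PS_rel (v s) (w s) d s Ds Hd) as [_ [_ R]].
      * split; [apply Hv; auto|split; [apply Hw; auto|apply H; auto]].
      * eapply besov_le_mono; [exact R|]. right; ring.
  (* The gain [d / 4] is at most [M * d / 2] because [1 <= M], so differences relative to [M] are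
     halved. *)
  - pose proof (Rpower_pos t (- gamma)). assert (0 <= Rpower t (- gamma) * d) by nra. nra.
Qed.

Fixpoint picard (n : nat) : R -> Dist :=
  match n with O => fun _ => dzero | S n' => Phi (picard n') end.

Lemma admissible_zero : admissible (fun _ => dzero).
Proof.
  split.
  - intros t _ eps He. exists 1. split; [lra|]. intros s _ _.
    replace (dsub dzero dzero) with dzero; [eapply besov_le_mono; [apply besov_zero|lra]|].
    apply functional_extensionality; intros k; unfold dsub, dzero; ring.
  - intros t _. eapply besov_le_mono; [apply besov_zero|]. pose proof (Rpower_pos t (- gamma)). nra.
Qed.

Lemma picard_admissible n : admissible (picard n).
Proof. induction n; [apply admissible_zero|apply Phi_admissible; auto]. Qed.

Lemma picard_cauchy n p t : D t ->
  besov_le beta (dsub (picard (n + p) t) (picard n t)) (M * Rpower t (- gamma) * (2 * (/ 2) ^ n)).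
Proof.
  revert t. induction n; intros t Ht.
  - replace (M * Rpower t (- gamma) * (2 * (/ 2) ^ 0)) with (M * Rpower t (- gamma) + M * Rpower t (- gamma)) by (simpl; ring).
    apply besov_sub; apply picard_admissible; auto.
  - replace (2 * (/ 2) ^ S n) with (2 * (/ 2) ^ n / 2) by (simpl; field).
    apply (Phi_contract (picard (n + p)) (picard n)); auto using picard_admissible.
    assert (0 <= (/ 2) ^ n) by (apply pow_le; lra). lra.
Qed.

Definition solution (t : R) : Dist := fun k => Clim_seq (fun n => picard n t k).

Lemma solution_cvg t k : D t -> cvgc (fun n => picard n t k) (solution t k).
Proof.
  intros Ht. pose proof (coefC_pos beta k).
  apply (cvgc_geom _ (M * Rpower t (- gamma) * 2 * coefC beta k) (/ 2)); [lra|nonneg|].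
  intros n. pose proof (picard_cauchy n 1 t Ht) as P. rewrite Nat.add_1_r in P.
  pose proof (besov_coef _ _ _ k P) as B. unfold dsub in B.
  eapply Rle_trans; [exact B|]. right; ring.
Qed.

Lemma solution_close n t : D t ->
  besov_le beta (dsub (solution t) (picard n t)) (M * Rpower t (- gamma) * (2 * (/ 2) ^ n)).
Proof.
  intros Ht. apply (besov_lim beta (fun p => dsub (picard p t) (picard n t)) _ _ n).
  - intros p Hp. replace p with (n + (p - n))%nat by lia. apply picard_cauchy; auto.
  - intros k. unfold dsub. apply cvgc_minus; [apply solution_cvg; auto|apply cvgc_const].
Qed.

Lemma solution_admissible : admissible solution.
Proof.
  split.
  - intros t Ht eps He. unfold D in Ht.
    set (c := M * Rpower (t / 2) (- gamma) * 2).
    assert (Hc : 0 <= c) by (unfold c; nonneg).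
    destruct (half_pow_small c (eps / 3) Hc ltac:(lra)) as [n Hn].
    destruct (proj1 (picard_admissible n) t Ht (eps / 3)) as [d [Hd HH]]; [lra|].
    exists (Rmin d (t / 2)). split; [apply Rmin_pos; lra|]. intros s Hs Hst.
    pose proof (Rmin_l d (t / 2)). pose proof (Rmin_r d (t / 2)).
    assert (NC : forall r, D r -> t / 2 <= r -> besov_le beta (dsub (solution r) (picard n r)) (eps / 3)).
    { intros r Hr Hrt. eapply besov_le_mono; [apply solution_close; auto|].
      eapply Rle_trans; [|exact Hn]. unfold c.
      assert (Rpower r (- gamma) <= Rpower (t / 2) (- gamma)) by (apply Rpower_le_compat_neg; lra).
      assert (0 <= (/ 2) ^ n) by (apply pow_le; lra).
      replace (M * Rpower r (- gamma) * (2 * (/ 2) ^ n)) with (M * (2 * (/ 2) ^ n) * Rpower r (- gamma)) by ring.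
      replace (M * Rpower (t / 2) (- gamma) * 2 * (/ 2) ^ n) with (M * (2 * (/ 2) ^ n) * Rpower (t / 2) (- gamma)) by ring.
      apply Rmult_le_compat_l; [nonneg|auto]. }
    pose proof Hst as Hst'. apply Rabs_def2 in Hst'.
    pose proof (besov_sub _ _ _ _ _ (NC s Hs ltac:(lra)) (NC t Ht ltac:(lra))) as B1.
    pose proof (besov_add _ _ _ _ _ B1 (HH s Hs ltac:(lra))) as B2.
    replace (dsub (solution s) (solution t)) with
      (dadd (dsub (dsub (solution s) (picard n s)) (dsub (solution t) (picard n t))) (dsub (picard n s) (picard n t)))
      by (apply functional_extensionality; intros k; unfold dadd, dsub; ring).
    eapply besov_le_mono; [exact B2|lra].
  - intros t Ht. apply (besov_lim beta (fun n => picard n t) _ _ 0).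
    + intros n _. apply picard_admissible; auto.
    + intros k. apply solution_cvg; auto.
Qed.

(** Compared through [picard (S n) = Phi (picard n)]: one distance is small by convergence, the
    other by contraction. *)
Lemma solution_fixed t k : D t -> solution t k = Phi solution t k.
Proof.
  intros Ht.
  assert (Z : forall eps, 0 < eps -> besov_le beta (dsub (solution t) (Phi solution t)) eps).
  { intros eps He.
    destruct (half_pow_small (M * Rpower t (- gamma) * 2) eps) as [n Hn]; [nonneg|auto|].
    assert (P : 0 <= (/ 2) ^ n) by (apply pow_le; lra).
    pose proof (Phi_contract solution (picard n) (2 * (/ 2) ^ n) solution_admissible (picard_admissible n)
      ltac:(lra) (solution_close n) t Ht) as B1.
    pose proof (solution_close (S n) t Ht) as B2.
    pose proof (besov_sub _ _ _ _ _ B2 B1) as B3.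
    replace (dsub (solution t) (Phi solution t)) with
      (dsub (dsub (solution t) (picard (S n) t)) (dsub (Phi solution t) (Phi (picard n) t)))
      by (apply functional_extensionality; intros l; unfold dsub; simpl; ring).
    eapply besov_le_mono; [exact B3|]. eapply Rle_trans; [|exact Hn]. right. simpl. field. }
  pose proof (besov_eq0 _ _ Z k) as E. unfold dsub in E.
  apply (f_equal (fun z => Cplus z (Phi solution t k))) in E. ring_simplify in E. exact E.
Qed.

Theorem picard_solution : exists v, mild_solution m mu nu tau beta gamma T1 u0 Zt Zij v.
Proof.
  exists solution. split; [apply solution_admissible|split].
  - exists M. intros t Ht. unfold Rdiv. rewrite <- Rpower_Ropp. apply solution_admissible; auto.
  - intros t Ht k. exists (Duh mu (fun s => PS (solution s) s) t k). split.
    + apply (imp_iff (fun s => semigroup mu (t - s) (PS (solution s) s) k)); [lra|].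
      apply Phi_imp; [apply solution_admissible|exact Ht].
    + apply solution_fixed; auto.
Qed.
End Picard.

(* Uniqueness by contraction in the norm weighted by [exp (- lam t)] with [lam] large, so that no
   smallness of the time interval or of the solutions is needed. *)
Theorem mild_unique m nu tau beta alpha mu alpha' gamma T K Zt Zij u0 T1 Cp r eta :
  0 < mu -> 0 < beta -> 0 < alpha < beta / 4 -> 0 < gamma -> 0 < alpha' <= gamma ->
  0 <= INR (2 * m + 1) * gamma < 1 -> noise_norm_le m alpha alpha' T Zt Zij K ->
  0 < T1 <= T -> T1 <= 1 -> 0 < Cp -> Psi_rel_const m nu tau beta alpha Cp ->
  0 <= r -> (beta - - (2 * alpha)) / 2 < r -> 0 < eta -> r + eta < 1 ->
  0 <= 1 - INR (2 * m + 1) * gamma - (r + eta) + gamma ->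
  forall v w, mild_solution m mu nu tau beta gamma T1 u0 Zt Zij v ->
  mild_solution m mu nu tau beta gamma T1 u0 Zt Zij w -> forall t, 0 < t <= T1 -> v t = w t.
Proof.
  intros Hmu Hbeta Halpha Hg Ha' Hq HN HT HT1 HCp HPsi Hr Hbr Heta Hre Hth v w
    [_ [[K1 HK1] Ev]] [_ [[K2 HK2] Ew]].
  set (q := INR (2 * m + 1) * gamma) in *.
  (* This size comes from the two given solutions and may exceed the radius used for existence. *)
  set (M := Rmax 1 (Rmax K1 K2)).
  assert (HM : 1 <= M) by apply Rmax_l.
  assert (HM1 : K1 <= M) by (eapply Rle_trans; [apply Rmax_l|apply Rmax_r]).
  assert (HM2 : K2 <= M) by (eapply Rle_trans; [apply Rmax_r|apply Rmax_r]).
  assert (Bv : forall t, 0 < t <= T1 -> besov_le beta (v t) (M * Rpower t (- gamma))).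
  { intros t Ht. eapply besov_le_mono; [apply HK1; auto|]. unfold Rdiv. rewrite <- Rpower_Ropp.
    apply Rmult_le_compat_r; [left; apply Rpower_pos|auto]. }
  assert (Bw : forall t, 0 < t <= T1 -> besov_le beta (w t) (M * Rpower t (- gamma))).
  { intros t Ht. eapply besov_le_mono; [apply HK2; auto|]. unfold Rdiv. rewrite <- Rpower_Ropp.
    apply Rmult_le_compat_r; [left; apply Rpower_pos|auto]. }
  set (A := Cp * (M ^ (2 * m + 1) * Kz alpha K)).
  assert (PA : 0 < A).
  { pose proof (Kz_ge1 m beta alpha Halpha alpha' T K Zt Zij HN ltac:(lra)).
    unfold A. assert (0 < M ^ (2 * m + 1)) by (apply pow_lt; lra). repeat apply Rmult_lt_0_compat; lra. }
  destruct (duhamel_bound mu (- (2 * alpha)) beta r (r + eta) q Hmu Hr Hbr ltac:(lra) Hq) as [Cd [HCd DB]].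
  destruct (sing_major_decay r eta Hr Heta) as [Ds [HDs SM]].
  set (Y := 2 * Cd * Ds * A).
  assert (HY : 0 < Y) by (unfold Y; posit).
  (* Chosen so that [lam^(- eta) = / (Y + 1)], which makes the Duhamel constant equal to
     [Y / (2 (Y + 1))], below one half. *)
  set (lam := Rpower (Y + 1) (/ eta)).
  assert (Hlam : 0 < lam) by apply Rpower_pos.
  assert (El : Rpower lam (- eta) = / (Y + 1)).
  { unfold lam. rewrite Rpower_mult. replace (/ eta * - eta) with (- (1)) by (field; lra).
    rewrite Rpower_Ropp, Rpower_1 by lra. reflexivity. }
  specialize (SM lam Hlam). rewrite El in SM.
  assert (Pk : 0 < / (Y + 1)) by (apply Rinv_0_lt_compat; lra).
  assert (Half : Cd * (Ds * / (Y + 1)) * A <= / 2).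
  { replace (Cd * (Ds * / (Y + 1)) * A) with (/ 2 * (1 - / (Y + 1))) by (unfold Y in *; field; lra). lra. }
  (* Starting from the crude bound for the difference, each pass through Duhamel gains one half;
     sending [n] to infinity replaces an absorption argument on a supremum. *)
  assert (Main : forall n t, 0 < t <= T1 -> besov_le beta (dsub (v t) (w t))
     (M * Rpower t (- gamma) * (2 * (/ 2) ^ n * exp (lam * t)))).
  { induction n; intros t Ht; pose proof (Rpower_pos t (- gamma)) as PR.
    - eapply besov_le_mono; [apply besov_sub; [apply Bv; auto|apply Bw; auto]|].
      assert (1 <= exp (lam * t)) by (pose proof (exp_ineq1_le (lam * t)); nra).
      simpl. assert (0 <= M * Rpower t (- gamma)) by nonneg. nra.
    - assert (P2 : 0 <= (/ 2) ^ n) by (apply pow_le; lra).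
      eapply besov_le_mono.
      + apply (DB lam (Ds * / (Y + 1)) (fun s => dsub (PsiS m nu tau Zt Zij (v s) s) (PsiS m nu tau Zt Zij (w s) s))
          (A * (2 * (/ 2) ^ n)) t); auto; try lra.
        * left; apply Rmult_lt_0_compat; auto.
        * nonneg.
        * intros k. destruct (Ev t Ht k) as [Iv [HIv Evk]]. destruct (Ew t Ht k) as [Iw [HIw Ewk]].
          apply imp_iff in HIv; [|lra]. apply imp_iff in HIw; [|lra].
          pose proof (imp_minus _ _ _ _ _ HIv HIw) as X.
          unfold dsub at 2. rewrite Evk, Ewk.
          replace (Cminus (Cplus (semigroup mu t u0 k) Iv) (Cplus (semigroup mu t u0 k) Iw)) with (Cminus Iv Iw) by ring.
          revert X. apply imp_ext. intros s. unfold semigroup, dsub, PsiS. ring.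
        * intros s Hs. pose proof (exp_pos (lam * s)).
          destruct (PsiS_rel m nu tau beta alpha Halpha alpha' gamma T K Zt Zij Ha' HN Cp (v s) (w s) M
            (2 * (/ 2) ^ n * exp (lam * s)) s HPsi HCp HM) as [_ [_ R]]; try lra.
          { nonneg. }
          { split; [apply Bv; lra|split; [apply Bw; lra|apply IHn; lra]]. }
          eapply besov_le_mono; [exact R|]. unfold A, q. right; ring.
      + replace (Cd * (Ds * / (Y + 1)) * (A * (2 * (/ 2) ^ n)) * exp (lam * t) * Rpower t (1 - q - (r + eta))) with
          (Cd * (Ds * / (Y + 1)) * A * (2 * (/ 2) ^ n * exp (lam * t) * Rpower t (1 - q - (r + eta)))) by ring.
        assert (ET : Rpower t (1 - q - (r + eta)) <= Rpower t (- gamma)).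
        { replace (1 - q - (r + eta)) with (- gamma + (1 - q - (r + eta) + gamma)) by ring. rewrite Rpower_plus.
          assert (Rpower t (1 - q - (r + eta) + gamma) <= 1).
          { apply (Rle_trans _ (Rpower 1 (1 - q - (r + eta) + gamma))); [apply Rle_Rpower_l; lra|].
            unfold Rpower. rewrite ln_1, Rmult_0_r, exp_0. lra. }
          nra. }
        pose proof (exp_pos (lam * t)) as PE.
        assert (PZ : 0 <= 2 * (/ 2) ^ n * exp (lam * t)) by nonneg.
        apply Rle_trans with (/ 2 * (2 * (/ 2) ^ n * exp (lam * t) * Rpower t (- gamma))).
        * apply Rmult_le_compat; auto.
          -- nonneg.
          -- nonneg.
          -- apply Rmult_le_compat_l; auto.
        * simpl. replace (M * Rpower t (- gamma) * (2 * (/ 2 * (/ 2) ^ n) * exp (lam * t))) with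
            (M * (/ 2 * (2 * (/ 2) ^ n * exp (lam * t) * Rpower t (- gamma)))) by ring.
          assert (0 <= / 2 * (2 * (/ 2) ^ n * exp (lam * t) * Rpower t (- gamma))) by nonneg.
          nra. }
  intros t Ht. apply functional_extensionality. intros k.
  assert (Z : forall eps, 0 < eps -> besov_le beta (dsub (v t) (w t)) eps).
  { intros eps He. pose proof (exp_pos (lam * t)).
    destruct (half_pow_small (M * Rpower t (- gamma) * 2 * exp (lam * t)) eps) as [n Hn]; [nonneg|auto|].
    eapply besov_le_mono; [apply (Main n t Ht)|]. eapply Rle_trans; [|exact Hn]. right; ring. }
  pose proof (besov_eq0 _ _ Z k) as E. unfold dsub in E.
  apply (f_equal (fun z => Cplus z (w t k))) in E. ring_simplify in E. exact E.
Qed.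

(** * Choice of the exponents and conclusion *)

Lemma semigroup_besov mu a b r : 0 < mu -> 0 <= r -> (b - a) / 2 < r -> exists Cs, 0 < Cs /\
  forall f K t, besov_le a f K -> 0 < t <= 1 -> besov_le b (semigroup mu t f) (Cs * K * Rpower t (- r)).
Proof.
  intros Hm Hr Hab. destruct (semigroup_smoothing mu a b r Hm Hr Hab) as [Cs [HCs S]].
  exists Cs. split; auto. intros f K t Hf Ht n x1 x2.
  pose proof (besov_le_ge0 _ _ _ Hf).
  eapply Rle_trans; [apply (S f K t n x1 x2 Hf ltac:(lra))|].
  apply Rmult_le_compat_l; [nonneg|]. apply Rpower_le_compat_neg; auto.
  assert (0 < / 4 ^ n) by (apply Rinv_0_lt_compat, pow_lt; lra). lra.
Qed.


Theorem mainTheorem4 :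
  forall (m : nat) (beta gamma : R),
    (1 <= m)%nat -> 0 < beta -> gamma < 1 / (2 * INR m + 1) ->
  (* alpha, alpha' sufficiently small, depending on beta, gamma, m *)
  exists eps : R, 0 < eps /\
  forall (alpha alpha' : R), 0 < alpha < eps -> 0 < alpha' < eps ->
  forall (mu : R) (nu tau : C) (alpha0 : R),
    0 < mu -> 0 < fst nu -> 0 < alpha0 -> (alpha0 + beta) / 2 < gamma ->
  forall T : R, 0 < T ->
  (* T* = min(T, F(R, ||Z||)) *)
  exists F : R -> R -> R, (forall Rb K, 0 < Rb -> 0 < F Rb K) /\
  forall (Zt : R -> Dist) (Zij : nat -> nat -> R -> Dist) (K : R),
    noise_ok m alpha alpha' T Zt Zij ->
    noise_norm_le m alpha alpha' T Zt Zij K ->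
  forall (Rb : R) (u0 : Dist), 0 < Rb -> besov_le (- alpha0) u0 Rb ->
    (exists v, mild_solution m mu nu tau beta gamma (Rmin T (F Rb K)) u0 Zt Zij v) /\
    (forall v w,
       mild_solution m mu nu tau beta gamma (Rmin T (F Rb K)) u0 Zt Zij v ->
       mild_solution m mu nu tau beta gamma (Rmin T (F Rb K)) u0 Zt Zij w ->
       forall t, 0 < t <= Rmin T (F Rb K) -> v t = w t).
Proof.
  intros m beta gamma Hm Hbeta Hgm.
  assert (Hm1 : 1 <= INR m) by (apply (le_INR 1); auto).
  (* [eps] is chosen before [alpha0]. If [2 gamma <= beta], no positive [alpha0] satisfies
     [(alpha0 + beta) / 2 < gamma], so any [eps] will do. *)
  destruct (Rle_dec (2 * gamma) beta) as [Hvac|Hbg].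
  { exists 1. split; [lra|]. intros; exfalso; lra. }
  set (q := INR (2 * m + 1) * gamma).
  assert (Eq : q = (2 * INR m + 1) * gamma) by (unfold q; rewrite plus_INR, mult_INR; simpl; ring).
  assert (Hq : 0 <= q < 1).
  { rewrite Eq. split; [nra|]. apply (Rmult_lt_compat_l (2 * INR m + 1)) in Hgm; [|lra].
    replace ((2 * INR m + 1) * (1 / (2 * INR m + 1))) with 1 in Hgm by (field; lra). lra. }
  assert (Hg3 : 3 * gamma <= q) by (rewrite Eq; nra).
  (* The unit of spare room: the margins in the Duhamel exponents below are small multiples of
     it. *)
  set (d := (1 - q) / 8).
  assert (Hd : 0 < d <= / 8) by (unfold d; lra).
  (* [beta / 4] is for the products, [d / 2] makes smoothing from [- 2 alpha] affordable, and
     [gamma] lets the noise weights be coarsened. *)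
  exists (Rmin (beta / 4) (Rmin (d / 2) gamma)).
  split; [repeat apply Rmin_pos; lra|].
  intros alpha alpha' Ha Ha' mu nu tau alpha0 Hmu _ Ha0 Hag T HT.
  pose proof (Rmin_l (beta / 4) (Rmin (d / 2) gamma)). pose proof (Rmin_r (beta / 4) (Rmin (d / 2) gamma)).
  pose proof (Rmin_l (d / 2) gamma). pose proof (Rmin_r (d / 2) gamma).
  assert (Halpha : 0 < alpha < beta / 4) by lra.
  (* High enough to smooth from [- 2 alpha] even to [beta + d]; low enough that [r + d < 1], since
     [beta / 2 < gamma <= q / 3]. *)
  set (r := beta / 2 + 2 * d).
  assert (Hr : 0 <= r) by (unfold r; lra).
  (* The power of [t] that Duhamel gains over [t^(- gamma)]; it is positive because
     [beta / 2 < gamma]. *)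
  set (th := 1 - q - r + gamma).
  assert (Hth : d < th) by (unfold th, r, d in *; lra).
  (* Half of the spare regularity of the initial datum: its evolution lies in regularity [beta + dl]
     with the same singularity [t^(- gamma)], and interpolation then gives time continuity. *)
  set (dl := gamma - (alpha0 + beta) / 2).
  destruct (Psi_rel m nu tau beta alpha Hbeta Halpha) as [Cp [HCp HPsi]].
  destruct (semigroup_besov mu (- alpha0) beta gamma Hmu ltac:(lra) ltac:(lra)) as [Cs1 [HCs1 S1]].
  destruct (semigroup_besov mu (- alpha0) (beta + dl) gamma Hmu ltac:(lra) ltac:(unfold dl; lra)) as [Cs2 [HCs2 S2]].
  destruct (duhamel_bound mu (- (2 * alpha)) beta r r q Hmu Hr ltac:(unfold r; lra) ltac:(unfold r in *; lra) Hq)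
    as [Cd1 [HCd1 D1]].
  destruct (duhamel_bound mu (- (2 * alpha)) (beta + d) r r q Hmu Hr ltac:(unfold r; lra) ltac:(unfold r in *; lra) Hq)
    as [Cd2 [HCd2 D2]].
  set (Mf := fun Rb => 2 * (Cs1 * Rb) + 1).
  set (X := fun Rb K => Cd1 * (Cp * (Mf Rb ^ (2 * m + 1) * Kz alpha K))).
  (* Solves [X T^th <= X / (4 X + 1) <= 1/4] for [T]; the added 1 avoids division by zero.
     Positivity holds for every [K], as [Rpower] is always an exponential. *)
  exists (fun Rb K => Rmin 1 (Rpower (/ (4 * X Rb K + 1)) (/ th))).
  split; [intros Rb K _; apply Rmin_pos; [lra|apply Rpower_pos]|].
  intros Zt Zij K HZc HN Rb u0 HRb Hu0.
  set (T1 := Rmin T (Rmin 1 (Rpower (/ (4 * X Rb K + 1)) (/ th)))).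
  assert (HT1 : 0 < T1 <= T /\ T1 <= 1 /\ T1 <= Rpower (/ (4 * X Rb K + 1)) (/ th)).
  { unfold T1. set (y := Rpower (/ (4 * X Rb K + 1)) (/ th)).
    assert (0 < y) by apply Rpower_pos.
    pose proof (Rmin_l T (Rmin 1 y)). pose proof (Rmin_r T (Rmin 1 y)). pose proof (Rmin_l 1 y). pose proof (Rmin_r 1 y).
    assert (0 < Rmin T (Rmin 1 y)) by (repeat apply Rmin_pos; lra). lra. }
  destruct HT1 as [HT1 [HT1' HT1'']].
  set (M := Mf Rb).
  assert (HM : 1 <= M) by (unfold M, Mf; nra).
  pose proof (Kz_ge1 m beta alpha Halpha alpha' T K Zt Zij HN ltac:(lra)) as PK.
  set (A := Cp * (M ^ (2 * m + 1) * Kz alpha K)).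
  assert (PMp : 0 < M ^ (2 * m + 1)) by (apply pow_lt; lra).
  assert (PA : 0 < A) by (unfold A; posit).
  assert (PX : 0 < X Rb K) by (unfold X; fold M; fold A; posit).
  assert (Small : forall t, 0 < t <= T1 -> Cd1 * A * Rpower t th <= / 4).
  { intros t Ht. assert (P : Rpower t th <= / (4 * X Rb K + 1)).
    { apply Rle_trans with (Rpower (Rpower (/ (4 * X Rb K + 1)) (/ th)) th).
      - apply Rle_Rpower_l; lra.
      - rewrite Rpower_mult, Rinv_l, Rpower_1 by (try apply Rinv_0_lt_compat; lra). lra. }
    change (Cd1 * A) with (X Rb K).
    apply Rle_trans with (X Rb K * / (4 * X Rb K + 1)); [apply Rmult_le_compat_l; lra|].
    replace (X Rb K * / (4 * X Rb K + 1)) with (/ 4 * (1 - / (4 * X Rb K + 1))) by (field; lra).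
    assert (0 < / (4 * X Rb K + 1)) by (apply Rinv_0_lt_compat; lra). lra. }
  assert (HUc : besov_continuous_on beta (fun t => 0 < t <= T1) (fun t => semigroup mu t u0)).
  { apply (besov_cont_of_coef beta (beta + dl)); [unfold dl; lra| |].
    - apply semigroup_coef_cont; auto. intros; lra.
    - intros t Ht. exists (t / 2), (Cs2 * Rb * Rpower (t / 2) (- gamma)). split; [lra|].
      intros s Hs Hst. apply Rabs_def2 in Hst.
      eapply besov_le_mono; [apply S2; [exact Hu0|lra]|].
      apply Rmult_le_compat_l; [nonneg|]. apply Rpower_le_compat_neg; lra. }
  split.
  - apply (picard_solution m nu tau beta alpha mu alpha' gamma T K Zt Zij u0 T1 M (Cs1 * Rb) Cp (beta + d) (1 - q - r));
      auto; try lra.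
    + unfold M, Mf. assert (0 <= Cs1 * Rb) by nonneg. lra.
    + intros t Ht. apply S1; [exact Hu0|lra].
    + intros h c t I Ht Hc HI Hh. fold q in Hh. fold A in Hh.
      eapply besov_le_mono.
      * apply (D1 0 1 h (A * c) t I (sing_major_0 r)); auto; try lra; try nonneg.
        intros s Hs. rewrite Rmult_0_l, exp_0, Rmult_1_r. apply Hh; auto.
      * rewrite Rmult_0_l, exp_0, !Rmult_1_r.
        replace (1 - q - r) with (th + - gamma) by (unfold th; ring). rewrite Rpower_plus.
        replace (Cd1 * (A * c) * (Rpower t th * Rpower t (- gamma))) with
          (Cd1 * A * Rpower t th * (c * Rpower t (- gamma))) by ring.
        replace (c / 4 * Rpower t (- gamma)) with (/ 4 * (c * Rpower t (- gamma))) by field.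
        apply Rmult_le_compat_r; [nonneg|apply Small; auto].
    + exists (Cd2 * A). split; [nonneg|]. intros h t I Ht HI Hh. fold q in Hh. fold A in Hh.
      eapply besov_le_mono.
      * apply (D2 0 1 h A t I (sing_major_0 r)); auto; try lra.
        intros s Hs. rewrite Rmult_0_l, exp_0, Rmult_1_r. apply Hh; auto.
      * rewrite Rmult_0_l, exp_0, !Rmult_1_r. lra.
  (* The exponential weight is bought with [eta = d]: worsening the singularity from [r] to [r + d]
     is allowed because [d < th]. *)
  - apply (mild_unique m nu tau beta alpha mu alpha' gamma T K Zt Zij u0 T1 Cp r d); auto; try lra.
    + unfold r; lra.
    + unfold r; lra.
    + fold q. unfold th in Hth. lra.
Qed.
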